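(* Assume that $\Lambda^{-1}\le a_i\le\Lambda$ a.e. in $\Omega_T$ for all $i$ and some constant $\Lambda\ge1$, let $f\in L^\beta(0,T;L^\beta_{\mathrm{loc}}(\Omega))$ for some $\beta>1$, and let $u$ be a weak solution in $\Omega_T$ of $$\partial_t(|u|^{\alpha-1}u)-\mathrm{div}\,[A(x,t,\nabla u)]=f.$$ Then $$\iint_{\Omega_T}\Big(\langle[A(x,t,\nabla u)]_h,\nabla\phi\rangle+\partial_t[|u|^{\alpha-1}u]_h\,\phi\Big)\,dx\,dt-\int_\Omega\tilde u_\alpha(x,0)\,\phi_{\bar h}(x,0)\,dx=\iint_{\Omega_T}f_h\,\phi\,dx\,dt$$ for all $h\in(0,T)$ and all $\phi\in C^\infty(\Omega\times[0,T])$ with support contained in $K\times[0,\tau]$, where $K\subset\Omega$ is compact and $\tau\in(0,T)$. Here $\tilde u_\alpha(x,0)$ denotes the value at time zero of the continuous representative of $|u|^{\alpha-1}u$ as a map $[0,T]\to L^{\frac{\alpha+1}{\alpha}}(K)$.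
   Context: Let $N\ge2$, $T\in(0,\infty)$, $\Omega\subset\mathbb{R}^N$ a bounded open set, $\Omega_T:=\Omega\times(0,T)$, $\alpha>0$, $p\in(1,\infty)$, $\delta_1,\dots,\delta_N\ge0$, $a_1,\dots,a_N:\Omega_T\to\mathbb{R}$ measurable. Write $s_+=\max\{s,0\}$; $|a|^{\gamma-1}a:=0$ if $a=0$, $\gamma>0$. Set $A_i(x,t,\xi):=a_i(x,t)(|\xi_i|-\delta_i)_+^{p-1}\frac{\xi_i}{|\xi_i|}$ (equal to $0$ if $\xi_i=0$), $A=(A_1,\dots,A_N)$; $\nabla$ and $\mathrm{div}$ are spatial. A function $u\in L^p(0,T;W^{1,p}(\Omega))\cap C^0([0,T];L^{\alpha+1}(\Omega))$ is a weak solution of the equation (with $f\in L^1_{\mathrm{loc}}(\Omega_T)$) if for all $\varphi\in C_0^\infty(\Omega_T)$ $$\iint_{\Omega_T}\big(\langle A(x,t,\nabla u),\nabla\varphi\rangle-|u|^{\alpha-1}u\,\partial_t\varphi\big)\,dx\,dt=\iint_{\Omega_T}f\varphi\,dx\,dt.$$ Exponential time mollifications: for $h\in(0,T)$, $t\in[0,T]$ and $v\in L^1(0,T;L^1_{\mathrm{loc}}(\Omega))$, $$v_h(x,t)=[v]_h(x,t):=\frac1h\int_0^te^{\frac{s-t}{h}}v(x,s)\,ds,\qquad v_{\bar h}(x,t):=\frac1h\int_t^Te^{\frac{t-s}{h}}v(x,s)\,ds,$$ applied componentwise to vector-valued functions. The mollification $v_h$ has the weak time derivative $\partial_tv_h=\frac{v-v_h}{h}$.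 *)

(* Defs.v *)
From HB Require Import structures.
From mathcomp Require Import all_boot all_order all_algebra.
From mathcomp Require Import all_classical all_reals all_analysis.
From mathcomp Require Import measurable_realfun.
Import Order.TTheory GRing.Theory Num.Theory.
Import numFieldNormedType.Exports.

Set Implicit Arguments.
Unset Strict Implicit.
Unset Printing Implicit Defensive.

Local Open Scope classical_set_scope.
Local Open Scope ring_scope.

(* The library has no sigma-algebra on row vectors.  The one generated by the
   coordinates is the Borel sigma-algebra of R^n. *)

Definition measure_rV_display : measure_display.
Proof. exact: default_measure_display. Qed.

Section measurable_rV.
Context {R : realType} (n : nat).

Definition rV_coord (i : 'I_n) (x : 'rV[R]_n) : R := x ord0 i.

Let rV_set0 : g_sigma_preimage rV_coord set0.
Proof. exact: sigma_algebra0. Qed.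

Let rV_setC A :
  g_sigma_preimage rV_coord A -> g_sigma_preimage rV_coord (~` A).
Proof. exact: sigma_algebraC. Qed.

Let rV_bigcup (F : (set 'rV[R]_n)^nat) :
  (forall i, g_sigma_preimage rV_coord (F i)) ->
  g_sigma_preimage rV_coord (\bigcup_i (F i)).
Proof. exact: sigma_algebra_bigcup. Qed.

HB.instance Definition _ := @isMeasurable.Build measure_rV_display
  'rV[R]_n (g_sigma_preimage rV_coord) rV_set0 rV_setC rV_bigcup.

Lemma measurable_fun_rVP d (T : measurableType d) (f : T -> 'rV[R]_n) :
  measurable_fun [set: T] f <->
  forall i, measurable_fun [set: T] (rV_coord i \o f).
Proof.
apply: (@iff_trans _
    (g_sigma_preimage (fun i => rV_coord i \o f) `<=` measurable)).
  rewrite g_sigma_preimage_comp; split=> [mf A [/= C preC <-]|prefS].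
    exact: mf.
  by move=> _ A mA; apply: prefS; exists A.
split=> [rVfS i|mf].
- move=> _ A mA; apply: rVfS; apply: sub_sigma_algebra.
  rewrite -bigcup_seq/=; exists i => /=; first by rewrite mem_index_enum.
  by exists A.
- apply: smallest_sub; first exact: sigma_algebra_measurable.
  rewrite -bigcup_seq/=; apply: bigcup_sub => i _.
  by move=> A [B mB <-]; exact: mf.
Qed.

Lemma measurable_rV_coord (i : 'I_n) :
  measurable_fun [set: 'rV[R]_n] (rV_coord i).
Proof. by have /measurable_fun_rVP := @measurable_id _ 'rV[R]_n setT; exact. Qed.

End measurable_rV.

Section rV_cons.
Context {R : realType} (n : nat).

Definition rV_cons (z : R * 'rV[R]_n) : 'rV[R]_n.+1 :=
  \row_i (if unlift ord0 i is Some j then z.2 ord0 j else z.1).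

Definition rV_uncons (x : 'rV[R]_n.+1) : R * 'rV[R]_n :=
  (x ord0 ord0, \row_j x ord0 (lift ord0 j)).

Lemma rV_consK : cancel rV_cons rV_uncons.
Proof.
case=> t x; rewrite /rV_uncons !mxE unlift_none; congr pair.
by apply/rowP => j; rewrite !mxE liftK.
Qed.

Lemma measurable_rV_cons : measurable_fun [set: (R * 'rV[R]_n)%type] rV_cons.
Proof.
apply/measurable_fun_rVP => i; rewrite /comp /rV_coord.
under eq_fun do rewrite mxE.
case: (unliftP ord0 i) => [j|] _; last exact: measurable_fst.
exact: (measurableT_comp (measurable_rV_coord j) measurable_snd).
Qed.

Lemma measurable_rV_uncons : measurable_fun [set: 'rV[R]_n.+1] rV_uncons.
Proof.
apply/measurable_fun_pairP; split; first exact: measurable_rV_coord.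
apply/measurable_fun_rVP => i; rewrite /comp /rV_coord /rV_uncons/=.
under eq_fun do rewrite mxE.
exact: measurable_rV_coord.
Qed.

Variable m : {sigma_finite_measure set 'rV[R]_n -> \bar R}.

Definition lebesgueS : set 'rV[R]_n.+1 -> \bar R :=
  pushforward (@lebesgue_measure R \x m)%E rV_cons.

Let lebesgueS0 : lebesgueS set0 = 0%E.
Proof. by rewrite /lebesgueS /pushforward preimage_set0 measure0. Qed.

Let lebesgueS_ge0 A : (0 <= lebesgueS A)%E.
Proof. by rewrite /lebesgueS /pushforward; exact: measure_ge0. Qed.

Let lebesgueS_sigma_additive : semi_sigma_additive lebesgueS.
Proof.
move=> F mF tF _; rewrite /lebesgueS /pushforward preimage_bigcup.
apply: measure_sigma_additive => [k|].
  by rewrite -[X in measurable X]setTI; exact: measurable_rV_cons.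
apply/trivIsetP => i j _ _ ij; rewrite -preimage_setI.
by move/trivIsetP : tF => /(_ _ _ _ _ ij) ->//; rewrite preimage_set0.
Qed.

HB.instance Definition _ := isMeasure.Build _ 'rV[R]_n.+1 R lebesgueS
  lebesgueS0 lebesgueS_ge0 lebesgueS_sigma_additive.

Let lebesgueS_sigma_finite : sigma_finite setT lebesgueS.
Proof.
have /sigma_finiteP[F [FT ndF Foo]] := sigma_finiteT (@lebesgue_measure R).
have /sigma_finiteP[G [GT ndG Goo]] := sigma_finiteT m.
exists (fun k => rV_uncons @^-1` (F k `*` G k)).
  rewrite predeqE => x; split=> // _.
  have : setT (rV_uncons x).1 by []. rewrite FT => -[k _ Fk].
  have : setT (rV_uncons x).2 by []. rewrite GT => -[l _ Gl].
  exists (maxn k l) => //; split.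
  - by move: Fk; exact/subsetPset/ndF/leq_maxl.
  - by move: Gl; exact/subsetPset/ndG/leq_maxr.
move=> k; have [mF Fk] := Foo k; have [mG Gk] := Goo k; split.
  rewrite -[X in measurable X]setTI; apply: measurable_rV_uncons => //.
  exact: measurableX.
rewrite /lebesgueS /pushforward -comp_preimage.
rewrite (_ : rV_uncons \o rV_cons = id); last by apply/funext/rV_consK.
by rewrite preimage_id product_measure1E// lte_mul_pinfty// ge0_fin_numE.
Qed.

HB.instance Definition _ := Measure_isSigmaFinite.Build _ 'rV[R]_n.+1 R
  lebesgueS lebesgueS_sigma_finite.

End rV_cons.

Fixpoint lebesgueN (R : realType) (n : nat) :
    {sigma_finite_measure set 'rV[R]_n -> \bar R} :=
  if n is n'.+1 then lebesgueS (lebesgueN R n') else dirac (0 : 'rV[R]_0).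

Lemma lebesgueN_box (R : realType) (n : nat) (A : 'I_n -> set R) :
  (forall i, measurable (A i)) ->
  lebesgueN R n [set x | forall i, A i (x ord0 i)] =
  (\big[*%E/1%E]_(i < n) lebesgue_measure (A i))%E.
Proof.
elim: n A => [|n IH] A mA.
  by rewrite big_ord0 /= diracE mem_set// => -[].
pose B := [set x : 'rV[R]_n | forall j, A (lift ord0 j) (x ord0 j)].
have mB : measurable B.
  have -> : B = \bigcap_(j in [set: 'I_n]) (rV_coord j @^-1` A (lift ord0 j)).
    by apply/seteqP; split => x /= Ax j; [move=> _|]; exact: Ax.
  apply: fin_bigcap_measurable => // j _.
  by rewrite -[X in measurable X]setTI; exact: measurable_rV_coord.
rewrite big_ord_recl -IH//.
rewrite -product_measure1E//=; last exact: mA.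
rewrite /lebesgueS /pushforward.
congr (_ _); apply/seteqP; split => -[t x] /=.
- move=> Ax; split => [|j].
    by have := Ax ord0; rewrite mxE unlift_none.
  by have := Ax (lift ord0 j); rewrite mxE liftK.
- by case=> At Ax i; rewrite mxE; case: unliftP => [j|] ->.
Qed.

Definition lebesgueNT (R : realType) (N : nat) :
    {measure set ('rV[R]_N * measurableTypeR R) -> \bar R} :=
  (lebesgueN R N \x @lebesgue_measure R)%E.

(* [measurable_fun] is Borel measurability; being a.e. equal to a Borel function
   is Lebesgue measurability. *)
Definition ae_measurable d (T : measurableType d) (R : realType)
    (mu : {measure set T -> \bar R}) (D : set T) (f : T -> R) : Prop :=
  exists2 g : T -> R, measurable_fun D g & f = g %[ae mu in D].

(* f represents an element of L^q(D); finite_norm integrates over the whole type,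
   hence the restriction f \_ D. *)
Definition Lp_on d (T : measurableType d) (R : realType)
    (mu : {measure set T -> \bar R}) (D : set T) (q : R) (f : T -> R) : Prop :=
  ae_measurable mu D f /\ finite_norm mu q%:E (f \_ D).

Section smooth.
Context {R : realType} {V : normedModType R}.
Implicit Types (U : set V) (f : V -> R).

(* iter_derive [:: v1; ...; vk] f = D_v1 (... (D_vk f)) *)
Definition iter_derive (vs : seq V) f : V -> R :=
  foldr (fun v g => 'D_v g) f vs.

(* C^oo(U) for U open *)
Definition smooth_on U f : Prop :=
  forall (vs : seq V) x, U x ->
    {for x, continuous (iter_derive vs f)} /\
    forall v, derivable (iter_derive vs f) x v.

Definition support_in U f : set V := closure (U `&` [set x | f x != 0]).

(* C_0^oo(U), each function being extended by 0 outside U *)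
Definition test_function U f : Prop :=
  [/\ smooth_on setT f, compact (support_in setT f) & support_in setT f `<=` U].

End smooth.

Section parabolic.
Context {R : realType} {N : nat}.
Notation E := 'rV[R]_N.
Implicit Types (Om K : set E) (T p q alpha h : R).

Definition cylinder Om T : set (E * R) := Om `*` `]0, T[.
Definition closed_cylinder Om T : set (E * R) := Om `*` `[0, T].

Definition grad (phi : E * R -> R) (z : E * R) : E :=
  \row_i 'D_((delta_mx 0 i, 0) : E * R) phi z.

Definition dt (phi : E * R -> R) (z : E * R) : R :=
  'D_((0, 1) : E * R) phi z.

Definition dot (x y : E) : R := \sum_(i < N) x 0 i * y 0 i.

(* C^oo(Om x [0, T]): every derivative taken in Om x (0, T) extends continuously
   up to t = 0 and t = T. *)
Definition smooth_closed_cylinder Om T (phi : E * R -> R) : Prop :=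
  [/\ smooth_on (cylinder Om T) phi,
      {within closed_cylinder Om T, continuous phi} &
      forall vs : seq (E * R)%type, exists2 g : E * R -> R,
        {within closed_cylinder Om T, continuous g} &
        {in cylinder Om T, g =1 iter_derive vs phi}].

Definition L1loc (U : set (E * R)) (f : E * R -> R) : Prop :=
  forall C, compact C -> C `<=` U -> Lp_on (lebesgueNT R N) C 1 f.

(* L^q(0, T; L^q_loc(Om)); by Tonelli the L^q(0, T; L^q(K)) norm is the L^q norm
   on K x (0, T). *)
Definition Lq_Lqloc Om T q (f : E * R -> R) : Prop :=
  forall K, compact K -> K `<=` Om -> Lp_on (lebesgueNT R N) (cylinder K T) q f.

Definition weak_gradient Om (v : E -> R) (g : E -> E) : Prop :=
  forall (i : 'I_N) (psi : E -> R), test_function Om psi ->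
    \int[lebesgueN R N]_(x in Om) (v x * 'D_(delta_mx 0 i : E) psi x) =
    - \int[lebesgueN R N]_(x in Om) (g x 0 i * psi x).

(* v \in W^{1,p}(Om) with weak gradient g *)
Definition W1p Om p (v : E -> R) (g : E -> E) : Prop :=
  [/\ Lp_on (lebesgueN R N) Om p v,
      forall i, Lp_on (lebesgueN R N) Om p (fun x => g x 0 i) &
      weak_gradient Om v g].

(* u \in L^p(0, T; W^{1,p}(Om)) with spatial weak gradient Du, for jointly
   measurable representatives: by Tonelli the first two conditions say that the
   p-th power of the W^{1,p}(Om)-norm of u(., t) is integrable over (0, T). *)
Definition Lp_W1p Om T p (u : E * R -> R) (Du : E * R -> E) : Prop :=
  [/\ Lp_on (lebesgueNT R N) (cylinder Om T) p u,
      forall i, Lp_on (lebesgueNT R N) (cylinder Om T) p (fun z => Du z 0 i) &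
      \forall t \ae @lebesgue_measure R, `]0, T[%classic t ->
        W1p Om p (fun x => u (x, t)) (fun x => Du (x, t))].

(* w : [0, T] -> L^q(D) is continuous and represents v. *)
Definition continuous_rep (D : set E) T q (v : E * R -> R) (w : R -> E -> R)
    : Prop :=
  [/\ forall t, `[0, T]%classic t -> Lp_on (lebesgueN R N) D q (w t),
      forall t0, `[0, T]%classic t0 ->
        Lnorm (lebesgueN R N) q%:E (EFin \o ((w t \- w t0) \_ D))
          @[t --> within `[0, T] (nbhs t0)] --> 0%E &
      \forall t \ae @lebesgue_measure R, `]0, T[%classic t ->
        (fun x => v (x, t)) = w t %[ae lebesgueN R N in D]].

(* |a|^(gamma - 1) a; the factor a makes the value at a = 0 equal to 0. *)
Definition spow (gamma a : R) : R := `|a| `^ (gamma - 1) * a.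

(* For xi_i = 0 the last factor is 0 / 0 = 0. *)
Definition vfield (a : 'I_N -> E * R -> R) (delta : 'I_N -> R) p
    (z : E * R) (xi : E) : E :=
  \row_i (a i z * Num.max (`|xi 0 i| - delta i) 0 `^ (p - 1)
          * (xi 0 i / `|xi 0 i|)).

(* Du is a representative of the weak gradient of u, determined by u up to a
   null set; it is an argument since statements about u mention it. *)
Definition weak_solution Om T alpha p (a : 'I_N -> E * R -> R)
    (delta : 'I_N -> R) (f u : E * R -> R) (Du : E * R -> E) : Prop :=
  [/\ L1loc (cylinder Om T) f,
      Lp_W1p Om T p u Du,
      exists w, continuous_rep Om T (alpha + 1) u w &
      forall phi, test_function (cylinder Om T) phi ->
        \int[lebesgueNT R N]_(z in cylinder Om T)
          (dot (vfield a delta p z (Du z)) (grad phi z)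
           - spow alpha (u z) * dt phi z) =
        \int[lebesgueNT R N]_(z in cylinder Om T) (f z * phi z)].

(* v_h, with z = (x, t) *)
Definition tmoll h (v : E * R -> R) (z : E * R) : R :=
  h^-1 * \int[@lebesgue_measure R]_(s in `[0, z.2])
           (expR ((s - z.2) / h) * v (z.1, s)).

Definition tmoll_vec h (F : E * R -> E) (z : E * R) : E :=
  \row_i tmoll h (fun y => F y 0 i) z.

(* v_{\bar h} *)
Definition tmoll_bar T h (v : E * R -> R) (z : E * R) : R :=
  h^-1 * \int[@lebesgue_measure R]_(s in `[z.2, T])
           (expR ((z.2 - s) / h) * v (z.1, s)).

Definition weak_dt Om T (v g : E * R -> R) : Prop :=
  [/\ L1loc (cylinder Om T) v,
      L1loc (cylinder Om T) g &
      forall phi, test_function (cylinder Om T) phi ->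
        \int[lebesgueNT R N]_(z in cylinder Om T) (v z * dt phi z) =
        - \int[lebesgueNT R N]_(z in cylinder Om T) (g z * phi z)].

(* The weak time derivative of v_h, in the sense of weak_dt. *)
Definition dt_tmoll h (v : E * R -> R) (z : E * R) : R :=
  (v z - tmoll h v z) / h.

End parabolic.

(* Main.v *)
Require Import Defs.
From mathcomp Require Import all_boot all_order all_algebra.
From mathcomp Require Import all_classical all_reals all_analysis.
From mathcomp Require Import measurable_realfun.
From mathcomp Require Import ring lra.
Import Order.TTheory GRing.Theory Num.Theory.
Import numFieldNormedType.Exports.
Local Open Scope classical_set_scope.
Local Open Scope ring_scope.

(** Write B g(x,t) = 1/h int_0^T e^(-r/h) g(x,t+r) dr.  By Fubini, B is the
    adjoint of the mollification: the integrals of [v]_h g and of v (B g) over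
    Om x (0,T) agree when g vanishes for times close to T.  Moreover B commutes
    with derivatives, and B (dg/dt) = (B g - g)/h.  This gives at once the weak
    time derivative of [v]_h.  For the equation, let Phi = B phi.  It does not
    vanish at t = 0, so the weak formulation is tested with Phi eta_k, where
    eta_k(t) = exp(-1/((k+1)t-1)) for t > 1/(k+1) and 0 otherwise is smooth and
    increases to 1.  As k grows, eta_k' concentrates at t = 0, and the
    continuity of the representative w of |u|^(alpha-1) u turns
    the integral of w Phi eta_k' into that of w(0) Phi(.,0), with
    Phi(.,0) = phi_bar_h(.,0).  Moving B back onto A, u and f gives the claim. *)

Set Implicit Arguments.
Unset Strict Implicit.
Unset Printing Implicit Defensive.

(** The mollification integrates along single slices [{x} x (0, t)], whereas the data are known only
    up to null sets and need not be Borel. For the equation, [v], [f] and each component of [A] are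
    therefore replaced by Borel functions that are integrable on every slice and vanish outside
    [K x (0, T)]. The duality is exact for these, and passing back to the data costs only null sets.
    Working over [K] is forced by [f], which is integrable only over compact sets in space.
    Integrability of |u|^alpha comes from the continuity of [u] in time with values in L^(alpha+1),
    as L^p integrability says too little when alpha > p.

    The cut-off eta_k depends on t alone, so it merely multiplies the spatial derivatives of Phi,
    and the only new term is v Phi eta_k'. Its limit needs a rate at which Phi(., t) approaches
    Phi(., 0). Averaging supplies it: Phi(., 0) involves phi at positive times only, and Phi is
    Lipschitz in t up to t = 0. The continuous representative of |u|^(alpha-1) u comes from an
    elementary inequality for signed powers that treats alpha < 1 and alpha > 1 alike. *)

(** * Borel sets and null sets in R^N x R *)

Lemma open_rV_prod_measurable {R : realType} {N : nat} (U : set ('rV[R]_N * R)) :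
  open U -> measurable (U : set ('rV[R]_N * measurableTypeR R)).
Proof.
move=> oU.
(* Boxes with rational centre and radius 1/(k+1) form a countable base of the topology, and each is
   cut out by finitely many coordinate conditions. *)
pose B (q : 'rV[rat]_N * rat * nat) : set ('rV[R]_N * R) :=
  [set z : 'rV[R]_N * R | (forall i : 'I_N, `|ratr (q.1.1 0 i) - z.1 0 i| < q.2.+1%:R^-1) /\
           `|ratr q.1.2 - z.2| < q.2.+1%:R^-1].
have mB q : measurable (B q : set ('rV[R]_N * measurableTypeR R)).
  have -> : B q = ([set x : 'rV[R]_N | forall i, `|ratr (q.1.1 0 i) - x 0 i| < q.2.+1%:R^-1])
     `*` [set t : R | `|ratr q.1.2 - t| < q.2.+1%:R^-1].
    by apply/seteqP; split.
  apply: measurableX; last first.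
    rewrite (_ : [set _ | _] = ball (ratr q.1.2 : R) q.2.+1%:R^-1)//.
    exact: measurable_ball.
  rewrite (_ : [set _ | _] = \bigcap_(i in [set: 'I_N])
    (rV_coord i @^-1` (ball (ratr (q.1.1 0 i) : R) q.2.+1%:R^-1))).
    apply: fin_bigcap_measurable => // j _.
    rewrite -[X in measurable X]setTI; apply: measurable_rV_coord => //.
    exact: measurable_ball.
  by apply/seteqP; split => x /= Bx i; [move=> _|]; exact: Bx.
have -> : U = \bigcup_q (if `[< B q `<=` U >] then B q else set0).
  apply/seteqP; split; last first.
    by move=> z [q _]; case: asboolP => // BU /BU.
  move=> [x t] Uz.
  have /nbhs_ballP[e /= e0 eU] : nbhs (x, t) U by exact: open_nbhs_nbhs.
  (* A box of radius below e/2 that contains the given point stays within distance e of it, hence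
     inside [U]. *)
  have [k ke] : exists k : nat, k.+1%:R^-1 < e / 2.
    exists (Num.truncn (2 / e)).
    rewrite invf_plt ?posrE ?divr_gt0// invf_div.
    exact: truncnS_gt.
  have [dl dlE] : exists dl : R, dl = k.+1%:R^-1 by eexists.
  have k0 : 0 < dl by rewrite dlE invr_gt0.
  rewrite -dlE in ke.
  have H (y : R) : exists q : rat, `|ratr q - y| < dl.
    have [|q] := @rat_in_itvoo R (y - dl) (y + dl); first by lra.
    by rewrite in_itv/= => q2; exists q; rewrite ltr_distl.
  have [r tr] := H t.
  have [s xs] := choice (fun i => H (x 0 i)).
  exists (\row_i s i, r, k) => //.
  rewrite /B/= -dlE; case: asboolP => [_|].
    by split => //= i; rewrite mxE.
  move=> []; apply: subset_trans eU => -[y u] [/= Hy Hu].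
  split => /=; last first.
    rewrite /ball/=.
    rewrite (_ : t - u = (ratr r - u) - (ratr r - t)); last by lra.
    by rewrite (le_lt_trans (ler_normB _ _))//; lra.
  split => [|i j]; [by []|rewrite ord1 /ball/=].
  have := Hy j; have := xs j; rewrite mxE => h1 h2.
  rewrite (_ : x 0 j - y 0 j = (ratr (s j) - y 0 j) - (ratr (s j) - x 0 j)); last by lra.
  by rewrite (le_lt_trans (ler_normB _ _))//; lra.
apply: countable_bigcupT_measurable => [|q]; first exact: countableP.
by case: ifP.
Qed.

Lemma within_continuous_measurable {R : realType} {N : nat}
    (A : set ('rV[R]_N * R)) (f : 'rV[R]_N * R -> R) :
  measurable (A : set ('rV[R]_N * measurableTypeR R)) ->
  {within A, continuous f} ->
  measurable_fun (A : set ('rV[R]_N * measurableTypeR R)) f.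
Proof.
move=> mA /continuousP cf.
apply: (measurability _ (RGenOpens.measurableE R)) => _ [_ [a [b ->] <-]].
have /open_subspaceP[V oV VA] : open (from_subspace A f @^-1` `]a, b[%classic).
  exact/cf/interval_open.
rewrite setIC -[X in measurable X]/(from_subspace A f @^-1` `]a, b[%classic `&` A) -VA.
by apply: measurableI => //; exact: open_rV_prod_measurable.
Qed.

(** Almost every slice of a null set is null. The set where [P] fails may be non-measurable, so the
    argument is run on a measurable null set [Z] covering it. *)
Lemma product_ae1 {d1 d2} {T1 : measurableType d1} {T2 : measurableType d2}
    {R : realType} (m1 : {sigma_finite_measure set T1 -> \bar R})
    (m2 : {sigma_finite_measure set T2 -> \bar R}) (P : T1 * T2 -> Prop) :
  {ae (m1 \x m2)%E, forall z, P z} ->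
  {ae m1, forall x, {ae m2, forall y, P (x, y)}}.
Proof.
move=> [Z [mZ Z0 PZ]].
have mF : measurable_fun setT (fun x => m2 (xsection Z x)) by exact: measurable_fun_xsection.
have : (\int[m1]_x `|m2 (xsection Z x)| = 0)%E.
  by rewrite -Z0; apply: eq_integral => x _; rewrite gee0_abs.
move/(ae_eq_integral_abs m1 measurableT mF).
apply: filterS => x /(_ I) /= H.
exists (xsection Z x); split => //; first exact: measurable_xsection.
move=> y /= Py; apply/xsectionP; exact: PZ.
Qed.

Lemma product_ae2 {d1 d2} {T1 : measurableType d1} {T2 : measurableType d2}
    {R : realType} (m1 : {sigma_finite_measure set T1 -> \bar R})
    (m2 : {sigma_finite_measure set T2 -> \bar R}) (P : T1 * T2 -> Prop) :
  {ae (m1 \x m2)%E, forall z, P z} ->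
  {ae m2, forall y, {ae m1, forall x, P (x, y)}}.
Proof.
move=> [Z [mZ Z0 PZ]].
have mF : measurable_fun setT (fun y => m1 (ysection Z y)) by exact: measurable_fun_ysection.
have : (\int[m2]_y `|m1 (ysection Z y)| = 0)%E.
  (* The product measure is an integral over the first factor by definition; the other order is
     Tonelli for the indicator of [Z]. *)
  rewrite -Z0 -[in RHS](setIT Z) -integral_indic// fubini_tonelli2//; last exact/measurable_EFinP.
  apply: eq_integral => y _.
  by rewrite -[RHS]/(fubini_G m1 (EFin \o \1_Z) y) (indic_fubini_tonelli_GE m1 mZ) gee0_abs.
move/(ae_eq_integral_abs m2 measurableT mF).
apply: filterS => x /(_ I) /= H.
exists (ysection Z x); split => //; first exact: measurable_ysection.
move=> y /= Py; apply/ysectionP; exact: PZ.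
Qed.

(** * Almost everywhere equality and integration *)

Section ae_integral.
Context {d} {T : measurableType d} {R : realType}.
Variable mu : {measure set T -> \bar R}.

(** The integral of a nonnegative function is a supremum over the simple functions below it, so
    arbitrary functions can be compared. *)
Lemma ge0_le_integralT (f g : T -> \bar R) :
  (forall x, 0 <= f x)%E -> (forall x, f x <= g x)%E ->
  (\int[mu]_x f x <= \int[mu]_x g x)%E.
Proof.
move=> f0 fg; rewrite !ge0_integralTE//; last first.
  by move=> x; exact: le_trans (f0 x) (fg x).
apply: le_ereal_sup => _ [k /= kf <-]; exists k => // x.
exact: le_trans (kf x) (fg x).
Qed.

(** [f] is squeezed between two measurable modifications of [g], equal to +oo and to 0 on the
    exceptional null set; both have the integral of [g]. *)
Let ge0_ae_integralT (f g : T -> \bar R) :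
  (forall x, 0 <= f x)%E -> (forall x, 0 <= g x)%E -> measurable_fun setT g ->
  {ae mu, forall x, f x = g x} ->
  (\int[mu]_x f x = \int[mu]_x g x)%E.
Proof.
move=> f0 g0 mg [Z [mZ Z0 fgZ]].
have fg x : ~ Z x -> f x = g x by move=> nZ; apply: contrapT => h; apply: nZ; exact: fgZ.
apply/eqP; rewrite eq_le; apply/andP; split.
- pose g1 x := if x \in Z then +oo%E else g x.
  have mg1 : measurable_fun setT g1.
    apply: measurable_fun_ifT => //.
    apply: (measurable_fun_bool true); rewrite setTI.
    by rewrite (_ : _ @^-1` _ = Z)//; apply/seteqP; split => x /=; [move=> /set_mem|exact: mem_set].
  apply: (@le_trans _ _ (\int[mu]_x g1 x)%E).
    apply: ge0_le_integralT => // x; rewrite /g1; case: ifPn; first by rewrite leey.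
    by move/negP => xZ; rewrite fg//; move=> /mem_set.
  rewrite (@ge0_ae_eq_integral _ _ _ mu setT g1 g)//.
    by move=> x _; rewrite /g1; case: ifP.
  exists Z; split => // x /=; apply: contra_notP => xZ _.
  by rewrite /g1 memNset.
- pose g1 x := if x \in Z then 0%E else g x.
  have mg1 : measurable_fun setT g1.
    apply: measurable_fun_ifT => //.
    apply: (measurable_fun_bool true); rewrite setTI.
    by rewrite (_ : _ @^-1` _ = Z)//; apply/seteqP; split => x /=; [move=> /set_mem|exact: mem_set].
  apply: (@le_trans _ _ (\int[mu]_x g1 x)%E); last first.
    apply: ge0_le_integralT => // x; rewrite /g1; case: ifPn => //.
    by move/negP => xZ; rewrite fg//; move=> /mem_set.
  rewrite (@ge0_ae_eq_integral _ _ _ mu setT g g1)//.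
    by move=> x _; rewrite /g1; case: ifP.
  exists Z; split => // x /=; apply: contra_notP => xZ _.
  by rewrite /g1 memNset.
Qed.

(** Here only [g] is Borel. This is the passage from the functions of the statement, measurable up
    to null sets, to their Borel representatives. *)
Lemma ae_integral (D : set T) (f g : T -> \bar R) :
  measurable D -> measurable_fun D g -> f = g %[ae mu in D] ->
  (\int[mu]_(x in D) f x = \int[mu]_(x in D) g x)%E.
Proof.
move=> mD mg fg.
have fgT : {ae mu, forall x, (f \_ D) x = (g \_ D) x}.
  apply: filterS fg => x fg; rewrite /patch; case: ifPn => // /set_mem; exact: fg.
have mgT : measurable_fun setT (g \_ D) by apply/(measurable_restrictT _ _).1.
rewrite integral_mkcond [RHS]integral_mkcond integralE [RHS]integralE.
congr (_ - _)%E; apply: ge0_ae_integralT => //.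
- exact: measurable_funepos.
- by apply: filterS fgT => x fgx; rewrite !funeposE fgx.
- exact: measurable_funeneg.
- by apply: filterS fgT => x fgx; rewrite !funenegE fgx.
Qed.

Lemma ae_Rintegral (D : set T) (f g : T -> R) :
  measurable D -> measurable_fun D g -> f = g %[ae mu in D] ->
  \int[mu]_(x in D) f x = \int[mu]_(x in D) g x.
Proof.
move=> mD mg fg; congr fine; apply: ae_integral => //.
  exact/measurable_EFinP.
by apply: filterS fg => x fg Dx; rewrite fg.
Qed.

End ae_integral.

Lemma measurable_EFin {d} {T : measurableType d} {R : realType} (D : set T)
    (f : T -> R) :
  measurable_fun D f -> measurable_fun D (fun x => (f x)%:E).
Proof. by move/measurable_EFinP. Qed.

Lemma measurable_integral_section {d1 d2} {T1 : measurableType d1}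
    {T2 : measurableType d2} {R : realType}
    (m2 : {sigma_finite_measure set T2 -> \bar R}) (f : T1 * T2 -> \bar R) :
  measurable_fun setT f -> measurable_fun setT (fun x => \int[m2]_y f (x, y))%E.
Proof.
move=> mf; under eq_fun do rewrite integralE.
apply: emeasurable_funB.
  under eq_fun do under eq_integral do rewrite funeposE.
  apply: (@measurable_fun_fubini_tonelli_F _ _ _ _ _ m2 (fun z => maxe (f z) 0)).
    by apply: eq_measurable_fun (measurable_funepos mf) => z _; rewrite funeposE.
  by move=> z; rewrite le_max lexx orbT.
under eq_fun do under eq_integral do rewrite funenegE.
apply: (@measurable_fun_fubini_tonelli_F _ _ _ _ _ m2 (fun z => maxe (- f z) 0)%E).
  by apply: eq_measurable_fun (measurable_funeneg mf) => z _; rewrite funenegE.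
by move=> z; rewrite le_max lexx orbT.
Qed.

(** * Exponential mollification *)

Section time_regular.
Context {R : realType} {N : nat}.
Notation E := 'rV[R]_N.
Notation mu := (lebesgueN R N).
Notation lam := (@lebesgue_measure R).
Notation nu := (lebesgueNT R N).
Notation ER := (E * measurableTypeR R)%type.

Definition strip (T : R) : set (E * R) := [set z | 0 < z.2 < T].

(* tmoll integrates along a single slice {x} x (0, t), hence integrability on every
   slice rather than on almost every one. *)
Definition time_regular (T : R) (v : E * R -> R) : Prop :=
  [/\ measurable_fun (setT : set ER) v,
      nu.-integrable setT (EFin \o v),
      forall x, lam.-integrable setT (fun s => (v (x, s))%:E) &
      forall z, ~ strip T z -> v z = 0].

Lemma measurable_cylinder (K : set E) (T : R) :
  measurable K -> measurable (cylinder K T : set ER).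
Proof. by move=> mK; exact: measurableX. Qed.

Lemma measurable_strip (T : R) : measurable (strip T : set ER).
Proof.
rewrite (_ : strip T = setT `*` `]0, T[); first exact: measurableX.
by apply/seteqP; split => z /=; rewrite in_itv/= => //-[].
Qed.

(** By Fubini the non-integrable slices lie over a null set of points x; setting the function to 0
    there makes every slice integrable and changes nothing almost everywhere. The slicewise equality
    is recorded separately because it is the form that [tmoll] depends on. *)
Lemma time_regular_rep (K : set E) (T : R) (v : E * R -> R) :
  measurable K -> ae_measurable nu (cylinder K T) v ->
  (\int[nu]_(z in cylinder K T) `|(v z)%:E| < +oo)%E ->
  exists v', [/\ time_regular T v',
    forall z, ~ cylinder K T z -> v' z = 0,
    v = v' %[ae nu in cylinder K T] &
    {ae mu, forall x, K x ->
       {ae lam, forall s, `]0, T[%classic s -> v (x, s) = v' (x, s)}}].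
Proof.
move=> mK [g mg vg] voo.
have mC := measurable_cylinder T mK.
pose v1 : E * R -> R := g \_ (cylinder K T).
have mv1 : measurable_fun (setT : set ER) v1 by apply/(measurable_restrictT _ _).1.
have iv1 : nu.-integrable setT (EFin \o v1).
  apply/integrableP; split; first exact/measurable_EFinP.
  apply: le_lt_trans voo; rewrite le_eqVlt; apply/orP; left; apply/eqP.
  rewrite [RHS](@ae_integral _ _ _ nu _ _ (fun z => `|(g z)%:E|))%E//.
  - rewrite [RHS]integral_mkcond; apply: eq_integral => z _.
    by rewrite /v1 /patch /=; case: ifP => //; rewrite normr0.
  - by apply: measurableT_comp => //; exact/measurable_EFinP.
  - by apply: filterS vg => z vg Cz; rewrite vg.
have /= [Z [mZ Z0 ZP]] := ae_integrable1 iv1.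
have nuZ : nu (Z `*` setT) = 0%E.
  rewrite [LHS](product_measure1E mu lam)//.
  by rewrite -[X in (X * _)%E]/(mu Z) Z0 mul0e.
have mZT : measurable (Z `*` setT : set ER) by exact: measurableX.
pose v2 : E * R -> R := v1 \_ (~` (Z `*` setT)).
have mv2 : measurable_fun (setT : set ER) v2.
  apply/(measurable_restrictT _ _).1; first exact: measurableC.
  exact: measurable_funS mv1.
have v2v1 z : ~ Z z.1 -> v2 z = v1 z.
  by move=> nZ; rewrite /v2 patchE mem_set//= => -[].
have v2Z z : Z z.1 -> v2 z = 0.
  by move=> nZ; rewrite /v2 patchE memNset//= => -[]; split.
have v2C z : ~ cylinder K T z -> v2 z = 0.
  move=> nC; have [/v2Z//|/v2v1->] := pselect (Z z.1).
  by rewrite /v1 patchE memNset.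
have vv2 : v = v2 %[ae nu in cylinder K T].
  have : {ae nu, forall z, ~ (Z `*` setT) z}.
    exists (Z `*` setT); split => //; first by move=> z /= /contrapT.
  move: vg; apply: filterS2 => z vg nZ Cz; rewrite v2v1; last first.
    by move=> Zz; apply: nZ.
  by rewrite /v1 patchE mem_set// vg.
exists v2; split => //.
- split => //.
  + apply: le_integrable iv1 => //; first exact/measurable_EFinP.
    move=> z _ /=; rewrite lee_fin /v2 patchE; case: ifP => // _.
    by rewrite normr0.
  + move=> x; have [Zx|nZx] := pselect (Z x).
      under eq_fun do rewrite v2Z//.
      exact: integrable0.
    under eq_fun do rewrite v2v1//.
    by apply: contrapT => h; apply: nZx; exact: ZP.
  + move=> z nz; apply: v2C => -[_]; rewrite /= in_itv/=; exact: nz.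
- have := product_ae1 vv2; apply: filterS => x vx Kx.
  by apply: filterS vx => s vs Ts; apply: vs; split.
Qed.

(** The upper limit of integration of [tmoll] is absorbed into the kernel, so that the mollification
    and its adjoint are integrals of the same kernel over the whole line, in s and in t
    respectively. *)
Definition exp_kernel (h t s : R) : R := if s <= t then expR ((s - t) / h) else 0.

Lemma measurable_exp_kernel h :
  measurable_fun (setT : set (measurableTypeR R * measurableTypeR R))
    (fun p => exp_kernel h p.1 p.2).
Proof.
apply: measurable_fun_ifT => //.
  by apply: measurable_fun_ler; [exact: measurable_snd|exact: measurable_fst].
apply: measurableT_comp => //; apply: measurable_funM => //.
by apply: measurable_funB; [exact: measurable_snd|exact: measurable_fst].
Qed.

Lemma exp_kernel_ge0 h t s : 0 <= exp_kernel h t s.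
Proof. by rewrite /exp_kernel; case: ifP => // _; exact: expR_ge0. Qed.

Lemma exp_kernel_le1 h t s : 0 < h -> exp_kernel h t s <= 1.
Proof.
move=> h0; rewrite /exp_kernel; case: ifP => // st.
by rewrite -expR0 ler_expR pmulr_lle0 ?invr_gt0// subr_le0.
Qed.

Lemma integrable_tensor {d1 d2} {T1 : measurableType d1}
    {T2 : measurableType d2}
    (m1 : {sigma_finite_measure set T1 -> \bar R})
    (m2 : {sigma_finite_measure set T2 -> \bar R}) (f : T1 -> R) (g : T2 -> R) :
  m1.-integrable setT (EFin \o f) -> m2.-integrable setT (EFin \o g) ->
  (m1 \x m2)%E.-integrable setT (fun z => (f z.1 * g z.2)%:E).
Proof.
move=> if_ ig.
have mf : measurable_fun setT f by have /integrableP[/measurable_EFinP] := if_.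
have mg : measurable_fun setT g by have /integrableP[/measurable_EFinP] := ig.
apply/integrable12ltyP.
  apply/measurable_EFinP; apply: measurable_funM.
    exact: measurableT_comp mf measurable_fst.
  exact: measurableT_comp mg measurable_snd.
have [c ->] : exists c : R, (fun x => \int[m2]_y `|(f (x, y).1 * g (x, y).2)%:E|)%E
   = (fun x => (c * `|f x|)%:E).
  have /integrableP[_ goo] := ig.
  exists (fine (\int[m2]_y `|(g y)%:E|)%E); apply/funext => x /=.
  under eq_integral do rewrite normrM EFinM.
  rewrite ge0_integralZl//=; last first.
    by apply/measurable_EFinP; exact: measurableT_comp.
  rewrite EFinM fineK; first by rewrite muleC.
  by rewrite ge0_fin_numE//; exact: integral_ge0.
have /(integrableZl measurableT c) /integrable_lty := integrable_norm if_.
by rewrite /comp; under eq_integral do rewrite -EFinM; apply.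
Qed.

(** Fubini on the plane: the kernel lies between 0 and 1, so |psi(t)| |v(s)| is an integrable
    majorant. *)
Lemma exp_kernel_duality h (v psi : R -> R) : 0 < h ->
  lam.-integrable setT (EFin \o v) -> lam.-integrable setT (EFin \o psi) ->
  (\int[lam]_t ((\int[lam]_s (exp_kernel h t s * v s)) * psi t)%:E =
   \int[lam]_s (v s * \int[lam]_t (exp_kernel h t s * psi t))%:E)%E.
Proof.
move=> h0 iv ip.
have mv : measurable_fun setT v by have /integrableP[/measurable_EFinP] := iv.
have mp : measurable_fun setT psi by have /integrableP[/measurable_EFinP] := ip.
pose F (z : measurableTypeR R * measurableTypeR R) :=
  ((exp_kernel h z.1 z.2 * v z.2) * psi z.1)%:E.
have mk := measurable_exp_kernel h.
have mF : measurable_fun setT F.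
  apply/measurable_EFinP; apply: measurable_funM.
    by apply: measurable_funM => //; exact: measurableT_comp mv measurable_snd.
  exact: measurableT_comp mp measurable_fst.
have iF : (lam \x lam)%E.-integrable setT F.
  apply: le_integrable (integrable_tensor ip iv) => // z _ /=.
  rewrite lee_fin mulrC !normrM ler_wpM2l// -[leRHS]mul1r ler_wpM2r//.
  by rewrite ger0_norm ?exp_kernel_ge0 ?exp_kernel_le1.
have mkl t : measurable_fun setT (exp_kernel h t).
  exact: measurableT_comp mk (pair1_measurable t).
have mkr s : measurable_fun setT (exp_kernel h ^~ s).
  exact: measurableT_comp mk (pair2_measurable s).
have ikv t : lam.-integrable setT (fun s => (exp_kernel h t s * v s)%:E).
  apply: le_integrable iv => //.
    exact: (measurable_EFin (measurable_funM (mkl t) mv)).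
  move=> s _ /=; rewrite lee_fin normrM -[leRHS]mul1r ler_wpM2r//.
  by rewrite ger0_norm ?exp_kernel_ge0 ?exp_kernel_le1.
have ikp s : lam.-integrable setT (fun t => (exp_kernel h t s * psi t)%:E).
  apply: le_integrable ip => //.
    exact: (measurable_EFin (measurable_funM (mkr s) mp)).
  move=> t _ /=; rewrite lee_fin normrM -[leRHS]mul1r ler_wpM2r//.
  by rewrite ger0_norm ?exp_kernel_ge0 ?exp_kernel_le1.
have := Fubini iF.
rewrite /F/=.
under eq_integral => t _.
  under eq_integral => s _ do rewrite EFinM.
  rewrite integralZr// -(@fineK _ (\int[lam]_y _)%E) ?integrable_fin_num// -EFinM.
  over.
move=> ->; apply: eq_integral => s _.
under eq_integral => t _ do rewrite mulrAC mulrC EFinM.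
by rewrite integralZl// -(@fineK _ (\int[lam]_y _)%E) ?integrable_fin_num// -EFinM.
Qed.

Section tmoll_theory.
Variables (T h : R).
Hypotheses (T0 : 0 < T) (h0 : 0 < h).

Lemma tmoll_kernelE (v : E * R -> R) z : time_regular T v ->
  tmoll h v z = h^-1 * \int[lam]_s (exp_kernel h z.2 s * v (z.1, s)).
Proof.
move=> [_ _ _ vS]; rewrite /tmoll; congr (_ * _).
rewrite Rintegral_mkcond; congr fine; apply: eq_integral => s _.
rewrite patchE; congr EFin; case: ifPn.
  by rewrite inE/= in_itv/= /exp_kernel => /andP[_ ->].
rewrite notin_setE/= in_itv/= => /negP; rewrite negb_and -!ltNge /exp_kernel.
move=> /orP[s0|st]; last by rewrite leNgt st mul0r.
by rewrite vS ?mulr0// => /= /andP[/ltW]; rewrite leNgt s0.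
Qed.

Lemma measurable_kernel_section (v : E * R -> R) :
  measurable_fun (setT : set ER) v ->
  measurable_fun (setT : set (ER * measurableTypeR R))
    (fun y => (exp_kernel h y.1.2 y.2 * v (y.1.1, y.2))%:E).
Proof.
move=> mv; apply/measurable_EFinP; apply: measurable_funM.
  apply: (measurableT_comp (measurable_exp_kernel h)
    (measurable_fun_pair (f := fun y : ER * measurableTypeR R => (y.1.2 : measurableTypeR R)) _ _)) => //.
  exact: measurableT_comp measurable_snd measurable_fst.
apply: (measurableT_comp mv
    (measurable_fun_pair (f := fun y : ER * measurableTypeR R => y.1.1) _ _)) => //.
exact: measurableT_comp measurable_fst measurable_fst.
Qed.

Lemma measurable_tmoll (v : E * R -> R) : time_regular T v ->
  measurable_fun (setT : set ER) (tmoll h v).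
Proof.
move=> rv; have [mv _ _ _] := rv.
have -> := funext (fun z => tmoll_kernelE z rv).
apply: measurable_funM => //; apply: measurableT_comp => //.
exact: (@measurable_integral_section _ _ _ _ _ lam _ (measurable_kernel_section mv)).
Qed.

(** Since the kernel is at most 1, [tmoll h v] at (x, t) is bounded by [h^-1] times the L^1 norm
    [V x] of the slice of [v] at x, for every t. Integrating over (0, T) gives the factor T / h. *)
Lemma integrable_tmoll (v : E * R -> R) : time_regular T v ->
  nu.-integrable (strip T) (EFin \o tmoll h v).
Proof.
move=> rv; have [mv iv ivx vS] := rv.
have mt := measurable_tmoll rv.
apply/(integrable_mkcond _ (measurable_strip T)).
have mtS : measurable_fun (setT : set ER) ((EFin \o tmoll h v) \_ (strip T)).
  apply/(measurable_restrictT _ _).1; first exact: measurable_strip.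
  by apply/measurable_EFinP; exact: measurable_funS mt.
apply/(integrable12ltyP mu lam mtS).
pose V x := (\int[lam]_s `|(v (x, s))%:E|)%E.
have Voo x : (V x < +oo)%E by have /integrableP[] := ivx x.
have V0 x : (0 <= V x)%E by exact: integral_ge0.
have mV : measurable_fun setT V.
  apply: (@measurable_integral_section _ _ _ _ _ lam (fun z : ER => `|(v z)%:E|%E)).
  by apply: measurableT_comp => //; exact/measurable_EFinP.
have tV x t : (`|(tmoll h v (x, t))%:E| <= h^-1%:E * V x)%E.
  rewrite (tmoll_kernelE _ rv) /= normrM gtr0_norm ?invr_gt0// EFinM.
  rewrite lee_wpmul2l ?lee_fin ?invr_ge0 ?(ltW h0)//.
  have mkv : measurable_fun setT (fun s => (exp_kernel h t s * v (x, s))%:E).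
    exact: measurableT_comp (measurable_kernel_section mv) (pair1_measurable (x, t)).
  have kvle s : (`|(exp_kernel h t s * v (x, s))%:E| <= `|(v (x, s))%:E|)%E.
    rewrite lee_fin normrM -[leRHS]mul1r ler_wpM2r//.
    by rewrite ger0_norm ?exp_kernel_ge0 ?exp_kernel_le1.
  have ikv : lam.-integrable setT (fun s => (exp_kernel h t s * v (x, s))%:E).
    exact: le_integrable (ivx x).
  apply: le_trans (_ : (\int[lam]_s `|(exp_kernel h t s * v (x, s))%:E| <= _)%E).
    rewrite EFin_normr_Rintegral//; last exact: le_abse_integral.
  have mvx := measurable_int _ (ivx x).
  by apply: ge0_le_integral => //; apply: measurableT_comp.
apply: (@le_lt_trans _ _ (\int[mu]_x ((T / h)%:E * V x))%E); last first.
  rewrite ge0_integralZl//=; last by rewrite lee_fin divr_ge0// ltW.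
  rewrite lte_mul_pinfty ?lee_fin ?divr_ge0 ?(ltW T0) ?(ltW h0)//.
  exact/(integrable12ltyP mu lam (measurable_int _ iv)).
apply: ge0_le_integral => //.
- by move=> x _; exact: integral_ge0.
- apply: (@measurable_integral_section _ _ _ _ _ lam (fun z : ER => `|((EFin \o tmoll h v) \_ (strip T)) z|%E)).
  exact: measurableT_comp.
- by apply: emeasurable_funM.
move=> x _.
rewrite [leLHS](_ : _ = \int[lam]_(t in `]0%R, T[) `|(tmoll h v (x, t))%:E|)%E; last first.
  rewrite [RHS]integral_mkcond; apply: eq_integral => t _.
  rewrite !patchE /strip.
  have -> : ((x, t) \in [set z | 0 < z.2 < T]) = (t \in `]0, T[%classic).
    by apply/idP/idP => /set_mem H; apply/mem_set; move: H; rewrite /= in_itv.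
  by case: ifP => //; rewrite abse0.
apply: (@le_trans _ _ (\int[lam]_(t in `]0%R, T[) (h^-1%:E * V x))%E).
  apply: ge0_le_integral => //.
  apply: measurableT_comp => //; apply/measurable_EFinP.
  exact: measurable_funS (measurableT_comp mt (pair1_measurable x)).
rewrite integral_cst//= lebesgue_measure_itv/= lte_fin T0 oppr0 adde0.
by rewrite muleAC -EFinM [(h^-1 * T)%R]mulrC.
Qed.

(** The one-dimensional duality is applied on every slice, which [time_regular] permits, and then
    integrated in x. Boundedness of [psi] makes both sides integrable, so that the iterated
    integrals are the integrals on the product. *)
Lemma tmoll_duality (v psi : E * R -> R) (C : R) : time_regular T v ->
  measurable_fun (setT : set ER) psi -> (forall z, `|psi z| <= C) ->
  (forall z, ~ strip T z -> psi z = 0) ->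
  \int[nu]_z (tmoll h v z * psi z) =
  \int[nu]_z (v z * (h^-1 * \int[lam]_t (exp_kernel h t z.2 * psi (z.1, t)))).
Proof.
move=> rv mp pC pS; have [mv iv ivx vS] := rv.
have C0 : 0 <= C by exact: le_trans (normr_ge0 _) (pC (0, 0)).
have ipx x : lam.-integrable setT (fun t => (psi (x, t))%:E).
  rewrite (_ : (fun t => _) = (fun t => (psi (x, t))%:E) \_ `]0, T[); last first.
    apply/funext => t; rewrite patchE; case: ifPn => //.
    rewrite notin_setE/= in_itv/= => nt; rewrite pS//.
  apply/(integrable_mkcond _ _).1 => //.
  apply: measurable_bounded_integrable => //.
  - by rewrite /= lebesgue_measure_itv/= lte_fin T0 -EFinB ltry.
  - exact: measurable_funS (measurableT_comp mp (pair1_measurable x)).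
  - exists C; split; first exact: num_real.
    by move=> D CD t _ /=; apply: le_trans (pC _) (ltW CD).
pose P z := h^-1 * \int[lam]_t (exp_kernel h t z.2 * psi (z.1, t)).
have mP : measurable_fun (setT : set ER) P.
  apply: measurable_funM => //; apply: measurableT_comp => //.
  apply: (@measurable_integral_section _ _ _ _ _ lam
    (fun y : ER * measurableTypeR R => (exp_kernel h y.2 y.1.2 * psi (y.1.1, y.2))%:E)).
  apply: measurable_EFin; apply: measurable_funM.
    apply: (measurableT_comp (measurable_exp_kernel h)
      (measurable_fun_pair (g := fun y : ER * measurableTypeR R => (y.1.2 : measurableTypeR R)) _ _)) => //.
    exact: measurableT_comp measurable_snd measurable_fst.
  apply: (measurableT_comp mp
    (measurable_fun_pair (f := fun y : ER * measurableTypeR R => y.1.1) _ _)) => //.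
  exact: measurableT_comp measurable_fst measurable_fst.
have ikp x s : lam.-integrable setT (fun t => (exp_kernel h t s * psi (x, t))%:E).
  apply: le_integrable (ipx x) => //.
    apply: measurable_EFin; apply: measurable_funM.
      exact: measurableT_comp (measurable_exp_kernel h) (pair2_measurable s).
    exact: measurableT_comp mp (pair1_measurable x).
  move=> t _ /=; rewrite lee_fin normrM -[leRHS]mul1r ler_wpM2r//.
  by rewrite ger0_norm ?exp_kernel_ge0 ?exp_kernel_le1.
have PC z : `|P z| <= h^-1 * (C * T).
  rewrite /P normrM gtr0_norm ?invr_gt0// ler_wpM2l ?invr_ge0 ?(ltW h0)//.
  apply: le_trans (le_normr_Rintegral measurableT (ikp _ _)) _.
  apply: le_trans (_ : \int[lam]_t (C * \1_`]0, T[ t) <= _).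
    apply: le_Rintegral => //.
    - exact: (integrable_norm (ikp _ _)).
    - apply: (@integrableZl _ _ _ lam setT measurableT C (EFin \o \1_`]0, T[)).
      exact: integrable_indic_itv.
    - move=> t _; rewrite indicE; case: (boolP (_ \in _)) => tT.
        rewrite mulr1 normrM -[leRHS]mul1r ler_pM//.
        by rewrite ger0_norm ?exp_kernel_ge0 ?exp_kernel_le1.
      move: tT; rewrite notin_setE/= in_itv/= => nt.
      by rewrite pS// mulr0 normr0 mulr0.
  rewrite RintegralZl//; last exact: integrable_indic_itv.
  rewrite /Rintegral integral_indic// setIT/= lebesgue_measure_itv/= lte_fin T0/=.
  by rewrite subr0.
have i1 : nu.-integrable setT (fun z => (tmoll h v z * psi z)%:E).
  have := integrable_tmoll rv; move/(integrable_mkcond _ (measurable_strip T)).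
  move/(integrableZl measurableT C); apply: le_integrable => //.
    by apply: measurable_EFin; apply: measurable_funM => //; exact: measurable_tmoll.
  move=> z _; rewrite patchE; case: ifPn => [_|] /=.
    by rewrite lee_fin mulrC !normrM ler_wpM2r// (le_trans (pC z))// ler_norm.
  by rewrite notin_setE => /pS->; rewrite mulr0 normr0 lee_fin.
have i2 : nu.-integrable setT (fun z => (v z * P z)%:E).
  move: iv => /(integrableZl measurableT (h^-1 * (C * T))).
  apply: le_integrable => //.
    by apply: measurable_EFin; apply: measurable_funM.
  move=> z _ /=; rewrite lee_fin mulrC normrM [leRHS]normrM ler_wpM2r//.
  by rewrite (le_trans (PC z))// ler_norm.
rewrite -/P; congr fine.
rewrite -(integral12_prod_meas1 (m1 := mu) (m2 := lam) i1).
rewrite -(integral12_prod_meas1 (m1 := mu) (m2 := lam) i2).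
apply: eq_integral => x _; rewrite /fubini_F.
under eq_integral do rewrite (tmoll_kernelE _ rv)/= mulrAC mulrC.
rewrite (exp_kernel_duality h0 (ivx x) (psi := fun t => h^-1 * psi (x, t)))//; last first.
  exact: (integrableZl measurableT h^-1 (ipx x)).
apply: eq_integral => s _; congr (_ * _)%:E; rewrite /P/= -RintegralZl//; last exact: ikp.
by apply: eq_Rintegral => t _; rewrite mulrCA.
Qed.

End tmoll_theory.

End time_regular.

(** * Smooth functions *)

Section smooth_theory.
Context {R : realType} {V : normedModType R}.
Implicit Types (U : set V) (f g : V -> R).

Lemma eq_iter_derive U f g : open U -> (forall x, U x -> f x = g x) ->
  forall vs x, U x -> iter_derive vs f x = iter_derive vs g x.
Proof.
move=> oU fg; elim=> [|v vs IH] x Ux; first exact: fg.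
rewrite /iter_derive /= -/(iter_derive vs f) -/(iter_derive vs g).
apply: near_eq_derive.
have : \forall y \near x, U y by exact: open_nbhs_nbhs.
by apply: filterS => y; exact: IH.
Qed.

Lemma smooth_on_eq U f g : open U -> (forall x, U x -> f x = g x) ->
  smooth_on U f -> smooth_on U g.
Proof.
move=> oU fg sf vs x Ux; have [cf df] := sf vs x Ux.
have nfg : \forall y \near x, iter_derive vs f y = iter_derive vs g y.
  have : \forall y \near x, U y by exact: open_nbhs_nbhs.
  by apply: filterS => y; exact: eq_iter_derive.
split.
  move: cf; rewrite /prop_for /continuous_at (nbhs_singleton nfg).
  by apply: cvg_trans; exact: near_eq_cvg.
by move=> v; exact: near_eq_derivable nfg (df v).
Qed.

(** A class of continuous functions closed under differentiation consists of smooth functions.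
    Equality on [U] is enough at each stage because derivatives are local. This replaces explicit
    formulas for iterated derivatives of products, averages and flat functions. *)
Lemma smooth_on_coind U (P : (V -> R) -> Prop) : open U ->
  (forall f, P f -> forall x, U x -> {for x, continuous f}) ->
  (forall f v, P f -> exists2 g, P g & forall x, U x -> is_derive x v f (g x)) ->
  forall f, P f ->
  smooth_on U f /\
  (forall vs, exists2 g, P g & forall x, U x -> iter_derive vs f x = g x).
Proof.
move=> oU cP dP f Pf.
have H vs : exists2 g, P g & forall x, U x -> iter_derive vs f x = g x.
  elim: vs => [|v vs [g Pg fg]]; first by exists f.
  have [k Pk gk] := dP g v Pg.
  exists k => // x Ux; rewrite -[LHS]/(iter_derive [:: v] (iter_derive vs f) x).
  by rewrite (eq_iter_derive oU fg)//=; have [] := gk x Ux.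
split=> // vs x Ux; have [g Pg fg] := H vs.
have nfg : \forall y \near x, g y = iter_derive vs f y.
  have : \forall y \near x, U y by exact: open_nbhs_nbhs.
  by apply: filterS => y Uy; rewrite fg.
split.
  move: (cP g Pg x Ux); rewrite /prop_for /continuous_at (nbhs_singleton nfg).
  by apply: cvg_trans; exact: near_eq_cvg.
move=> v; have [k _ /(_ x Ux)[dg _]] := dP g v Pg.
exact: near_eq_derivable nfg dg.
Qed.

Lemma smooth_on_derive U f v : smooth_on U f -> smooth_on U ('D_v f).
Proof.
move=> sf vs x Ux.
have -> : iter_derive vs ('D_v f) = iter_derive (rcons vs v) f.
  by rewrite /iter_derive foldr_rcons.
exact: sf.
Qed.

Lemma smooth_on_continuous U f x : smooth_on U f -> U x -> {for x, continuous f}.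
Proof. by move=> sf Ux; have [] := sf [::] x Ux. Qed.

Lemma smooth_on_derivable U f x v : smooth_on U f -> U x -> derivable f x v.
Proof. by move=> sf Ux; have [_] := sf [::] x Ux; exact. Qed.

(** The Leibniz rule turns a product into a sum of products, so this class, unlike that of products,
    is visibly closed under differentiation. *)
Inductive smooth_sum_prod U : (V -> R) -> Prop :=
| ssp_prod f g : smooth_on U f -> smooth_on U g -> smooth_sum_prod U (f * g)
| ssp_sum F G : smooth_sum_prod U F -> smooth_sum_prod U G ->
    smooth_sum_prod U (F + G).

Lemma smooth_onM U f g : open U -> smooth_on U f -> smooth_on U g ->
  smooth_on U (f * g).
Proof.
move=> oU sf sg.
apply: (proj1 (@smooth_on_coind U (smooth_sum_prod U) oU _ _ _ _)); last exact: ssp_prod.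
- move=> F; elim=> {sf sg f g F} [f g sf sg|F G _ cF _ cG] x Ux.
    apply: (@continuousM _ _ f g); exact: smooth_on_continuous Ux.
  by apply: (@continuousD _ _ _ F G); [exact: cF|exact: cG].
- move=> F v; elim=> {sf sg f g F} [f g sf sg|F G _ [F' PF dF] _ [G' PG dG]].
    exists (f * 'D_v g + g * 'D_v f).
      exact: (ssp_sum (ssp_prod sf (smooth_on_derive v sg))
                      (ssp_prod sg (smooth_on_derive v sf))).
    move=> x Ux.
    have := is_deriveM (derivableP (smooth_on_derivable (v := v) sf Ux)) (derivableP (smooth_on_derivable (v := v) sg Ux)).
    exact.
  exists (F' + G'); first exact: ssp_sum.
  move=> x Ux; exact: is_deriveD (dF x Ux) (dG x Ux).
Qed.

Lemma smooth_on_cst0 U : smooth_on U (cst 0).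
Proof.
have H vs : iter_derive vs (cst 0 : V -> R) = cst 0.
  elim: vs => //= v vs ->; apply/funext => x; exact: derive_cst.
move=> vs x Ux; rewrite H; split=> [|v]; first exact: cst_continuous.
exact: derivable_cst.
Qed.

End smooth_theory.

(** * The adjoint of the mollification *)

Section future_average.
Context {R : realType} {N : nat}.
Notation E := 'rV[R]_N.
Notation lam := (@lebesgue_measure R).
Notation nu := (lebesgueNT R N).
Notation ER := (E * measurableTypeR R)%type.

Definition upper : set (E * R) := [set z | 0 < z.2].

Lemma open_upper : open upper.
Proof.
rewrite (_ : upper = snd @^-1` [set t : R | 0 < t])//.
by apply: open_comp => [z _|]; [exact: cvg_snd|exact: open_gt].
Qed.

(* No condition at t = 0: phi need not vanish there, and its extension by 0 to
   t <= 0 is not continuous. *)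
Definition smooth_bounded (K : set E) (tau : R) (g : E * R -> R) : Prop :=
  [/\ smooth_on upper g,
      forall z, upper z -> ~ (K z.1 /\ z.2 <= tau) -> g z = 0 &
      forall vs, exists C, forall z, upper z -> `|iter_derive vs g z| <= C].

Lemma closed_shadow (K : set E) (tau : R) :
  closed K -> closed [set z : E * R | K z.1 /\ z.2 <= tau].
Proof.
move=> cK.
rewrite (_ : [set z | _] = (fst @^-1` K) `&` (snd @^-1` [set t : R | t <= tau]))//.
apply: closedI; apply: closed_comp => //; try exact: closed_le.
- by move=> z _; exact: cvg_fst.
- by move=> z _; exact: cvg_snd.
Qed.

Lemma smooth_bounded_derive K tau g v : closed K ->
  smooth_bounded K tau g -> smooth_bounded K tau ('D_v g).
Proof.
move=> cK [sg Sg Bg]; split.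
- exact: smooth_on_derive.
- move=> z Uz nz.
  transitivity ('D_v (cst 0 : E * R -> R) z); last exact: derive_cst.
  apply: near_eq_derive.
  have oW : open (upper `&` ~` [set z : E * R | K z.1 /\ z.2 <= tau]).
    apply: openI; first exact: open_upper.
    by rewrite openC; exact: closed_shadow.
  have := open_nbhs_nbhs (conj oW (conj Uz nz)).
  by apply: filterS => y [Uy ny]; rewrite Sg.
- move=> vs; have [C HC] := Bg (rcons vs v); exists C => z Uz.
  have -> : iter_derive vs ('D_v g) = iter_derive (rcons vs v) g.
    by rewrite /iter_derive foldr_rcons.
  exact: HC.
Qed.

Lemma is_derive_line (g : E * R -> R) (p w : E * R) (a d : R) :
  is_derive (a *: w + p) w g d -> is_derive a 1 (fun b => g (b *: w + p)) d.
Proof.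
have H : (fun h => h^-1 *: (((fun b : R => g (b *: w + p)) \o shift a) (h *: (1 : R)) - g (a *: w + p))) =
  (fun h => h^-1 *: ((g \o shift (a *: w + p)) (h *: w) - g (a *: w + p))).
  apply/funext => h /=; congr (_ *: (g _ - _)).
  by rewrite [h *: 1]mulr1 scalerDl addrA.
move=> [dg dE]; split.
  by rewrite /derivable H.
by rewrite -dE /derive H.
Qed.

Variables (T h : R).
Hypotheses (T0 : 0 < T) (h0 : 0 < h).

(* For g supported in t <= tau < T the upper limit T plays no role when t >= 0, and
   [future_avg g (x, t)] is tmoll_bar of g; unlike tmoll_bar it is differentiated
   under the integral sign without boundary terms. *)
Definition future_avg (g : E * R -> R) (z : E * R) : R :=
  \int[lam]_(r in `]0, T]) (h^-1 * expR (- r / h) * g (z.1, z.2 + r)).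

Variables (K : set E) (tau : R).
Hypotheses (cK : closed K) (tauT : tau < T).

Lemma future_weight_le r : 0 <= r -> `|h^-1 * expR (- r / h)| <= h^-1.
Proof.
move=> r0; rewrite ger0_norm; last by rewrite mulr_ge0 ?expR_ge0// invr_ge0 ltW.
rewrite ler_piMr ?invr_ge0 ?(ltW h0)// -expR0 ler_expR.
by rewrite mulNr oppr_le0 divr_ge0// ltW.
Qed.

Lemma continuous_time_section (g : E * R -> R) (x : E) (t : R) :
  smooth_bounded K tau g -> 0 < t -> {for t, continuous (fun s => g (x, s))}.
Proof.
move=> [sg _ _] t0.
apply: (@continuous_comp _ _ _ (fun s : R => (x, s)) g).
  exact: (cvg_pair (cvg_cst x) cvg_id).
exact: smooth_on_continuous sg _.
Qed.

Lemma measurable_future_integrand g z : smooth_bounded K tau g -> 0 <= z.2 ->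
  measurable_fun `]0, T]%classic
    (fun r => h^-1 * expR (- r / h) * g (z.1, z.2 + r)).
Proof.
move=> ng z0; apply: subspace_continuous_measurable_fun => //.
apply: continuous_in_subspaceT => r; rewrite inE/= in_itv/= => /andP[r0 _].
apply: cvgM.
  apply: cvgM; first exact: cvg_cst.
  apply: (@continuous_comp _ _ _ (fun r : R => - r / h) expR); last exact: continuous_expR.
  by apply: cvgM; [exact: cvgN|exact: cvg_cst].
apply: (@continuous_comp _ _ _ (fun r : R => z.2 + r) (fun s => g (z.1, s))).
  by apply: cvgD; [exact: cvg_cst|exact: cvg_id].
by apply: continuous_time_section => //; rewrite ltr_wpDl.
Qed.

Lemma future_integrand_le g C z r :
  (forall z, upper z -> `|g z| <= C) -> 0 <= z.2 -> 0 < r ->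
  `|h^-1 * expR (- r / h) * g (z.1, z.2 + r)| <= h^-1 * C.
Proof.
move=> gC z0 r0; rewrite normrM ler_pM//; first exact/future_weight_le/ltW.
by apply: gC; rewrite /upper/= ltr_wpDl.
Qed.

Lemma integrable_future_integrand g z : smooth_bounded K tau g -> 0 <= z.2 ->
  lam.-integrable `]0, T]%classic
    (EFin \o (fun r => h^-1 * expR (- r / h) * g (z.1, z.2 + r))).
Proof.
move=> ng z0; apply: measurable_bounded_integrable => //.
- by rewrite /= lebesgue_measure_itv/= lte_fin T0 -EFinB ltry.
- exact: measurable_future_integrand.
- have [_ _ /(_ [::])[C gC]] := ng.
  exists (h^-1 * C); split; first exact: num_real.
  move=> D CD r /=; rewrite in_itv/= => /andP[r0 _].
  by rewrite (le_trans (future_integrand_le gC z0 r0))// ltW.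
Qed.

Lemma integrable_cst_ocT c : lam.-integrable `]0, T]%classic (EFin \o cst c).
Proof.
apply: measurable_bounded_integrable => //; last exact: bounded_cst.
by rewrite /= lebesgue_measure_itv/= lte_fin T0 -EFinB ltry.
Qed.

Lemma future_avg_bounded g C z : smooth_bounded K tau g ->
  (forall z, upper z -> `|g z| <= C) -> 0 <= z.2 ->
  `|future_avg g z| <= h^-1 * C * T.
Proof.
move=> ng gC z0.
have ig := integrable_future_integrand ng z0.
apply: le_trans (le_normr_Rintegral _ ig) _ => //.
apply: le_trans (_ : \int[lam]_(r in `]0, T]) (cst (h^-1 * C)) r <= _).
  apply: le_Rintegral => //.
  - exact: integrable_norm ig.
  - exact: integrable_cst_ocT.
  - by move=> r; rewrite /= in_itv/= => /andP[r0 _]; exact: future_integrand_le.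
rewrite Rintegral_cst//= lebesgue_measure_itv/= lte_fin T0/=.
by rewrite subr0.
Qed.

(** The average looks only forward in time and leaves x fixed, so it creates no support beyond [tau]
    or outside [K]. *)
Lemma future_avg0 g z : smooth_bounded K tau g -> upper z ->
  ~ (K z.1 /\ z.2 <= tau) -> future_avg g z = 0.
Proof.
move=> [_ Sg _] Uz nz; rewrite /future_avg /Rintegral integral0_eq// => r.
rewrite /= in_itv/= => /andP[r0 _]; rewrite Sg ?mulr0//.
  by rewrite /upper/= addr_gt0.
by move=> [/= Kz zt]; apply: nz; split => //; rewrite (le_trans _ zt)// lerDl ltW.
Qed.

Lemma future_avg_derive g z w : smooth_bounded K tau g -> upper z ->
  is_derive z w (future_avg g) (future_avg ('D_w g) z).
Proof.
move=> ng Uz; have [sg Sg Bg] := ng.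
pose f (a r : R) := h^-1 * expR (- r / h) * g (a *: w + (z.1, z.2 + r)).
(* For |a| < dl the point [a *: w + z] keeps a positive time coordinate; the added 1 covers
   directions with [w.2 = 0]. *)
pose dl := z.2 / (`|w.2| + 1).
have dl0 : 0 < dl by rewrite divr_gt0// ltr_wpDl.
have posz a : `]-dl, dl[%classic a -> 0 < (a *: w + z).2.
  rewrite /= in_itv/= -ltr_norml => adl.
  rewrite -[ltRHS]/(a * w.2 + z.2) addrC -[w.2]opprK mulrN subr_gt0.
  rewrite (le_lt_trans (ler_norm _))// normrM normrN.
  apply: (@le_lt_trans _ _ (`|a| * (`|w.2| + 1))).
    by rewrite ler_wpM2l// lerDl.
  by rewrite -ltr_pdivlMr// ltr_wpDl.
have fE a r : f a r = h^-1 * expR (- r / h) * g ((a *: w + z).1, (a *: w + z).2 + r).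
  rewrite /f; congr (_ * g _); apply: injective_projections => //=.
  by rewrite addrA.
have FE a : future_avg g (a *: w + z) = \int[lam]_(r in `]0, T]) f a r.
  by rewrite /future_avg; apply: eq_Rintegral => r _; rewrite fE.
have Upt a r : `]-dl, dl[%classic a -> 0 < r -> upper (a *: w + (z.1, z.2 + r)).
  move=> /posz az r0; rewrite /upper/= addrA; exact: addr_gt0.
have df a r : `]-dl, dl[%classic a -> `]0, T]%classic r ->
    is_derive a 1 (f ^~ r) (h^-1 * expR (- r / h) * 'D_w g (a *: w + (z.1, z.2 + r))).
  move=> Ia; rewrite /= in_itv/= => /andP[r0 _].
  have := is_derive_line (derivableP (smooth_on_derivable (v := w) sg (Upt a r Ia r0))).
  by move=> H; exact: (is_deriveZ (h^-1 * expR (- r / h)) H).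
have I0 : `]-dl, dl[%classic (0 : R) by rewrite /= in_itv/= oppr_lt0 dl0.
(* A bound for ['D_w g] on [upper] makes the constant [h^-1 * C] an integrable majorant of the
   differentiated integrand. *)
have [C gC] := Bg [:: w].
have C0 : 0 <= C by exact: le_trans (normr_ge0 _) (gC z Uz).
have := @cvg_differentiation_under_integral R _ _ lam f `]0, T]%classic _ 0 (- dl) dl I0.
move=> /(_ _ _ _ (cst (h^-1 * C))) H.
have {}H : h1^-1 *: (\int[lam]_(r in `]0, T]) f (h1 + 0) r - \int[lam]_(r in `]0, T]) f 0 r)
    @[h1 --> 0^'] --> future_avg ('D_w g) z.
  have -> : future_avg ('D_w g) z = \int[lam]_(y in `]0, T]) partial1of2 f 0 y.
    apply: eq_Rintegral => r /set_mem Tr.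
    have [_ dE] := df 0 r I0 Tr.
    by rewrite partial1of2E dE scale0r add0r.
  have H1 a : `]-dl, dl[%classic a -> lam.-integrable `]0, T]%classic (EFin \o f a).
    move=> Ia; rewrite (_ : EFin \o f a = EFin \o (fun r => h^-1 * expR (- r / h) * g ((a *: w + z).1, (a *: w + z).2 + r))).
      by apply: integrable_future_integrand => //; exact/ltW/posz.
    by apply/funext => r /=; rewrite fE.
  have H2 a r : `]-dl, dl[%classic a -> `]0, T]%classic r -> derivable (f ^~ r) a 1.
    by move=> Ia Tr; have [] := df a r Ia Tr.
  have H3 (r : R) : 0 <= cst (h^-1 * C) r by rewrite /= mulr_ge0// invr_ge0 ltW.
  have H4 a r : `]-dl, dl[%classic a -> `]0, T]%classic r ->
      `|partial1of2 f a r| <= cst (h^-1 * C) r.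
    move=> Ia Tr; have [_ dE] := df a r Ia Tr; rewrite partial1of2E dE/=.
    move: Tr; rewrite /= in_itv/= => /andP[r0 _].
    rewrite normrM ler_pM//; first exact/future_weight_le/ltW.
    by apply: gC; exact: Upt.
  exact: (H (measurable_itv _) H1 H2 H3 (integrable_cst_ocT _) H4).
have HE : (fun h1 => h1^-1 *: (\int[lam]_(r in `]0, T]) f (h1 + 0) r - \int[lam]_(r in `]0, T]) f 0 r)) =
   (fun h1 => h1^-1 *: ((future_avg g \o shift z) (h1 *: w) - future_avg g z)).
  apply/funext => h1 /=; rewrite -FE addr0; congr (_ *: (_ - _)).
  by rewrite -FE scale0r add0r.
rewrite HE in H.
split; first by apply/cvg_ex; eexists; exact: H.
exact: cvg_lim H.
Qed.

(** Dominated convergence is a statement about sequences, so continuity of the average is tested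
    along sequences. If it failed, points in balls of radius 1/(n+1) would give a counterexample. *)
Lemma seq_continuous (F : E * R -> R) (z : E * R) :
  (forall y : nat -> E * R, y n @[n --> \oo] --> z ->
     F (y n) @[n --> \oo] --> F z) -> {for z, continuous F}.
Proof.
move=> H; apply/cvgrPdist_lt => e e0; apply: contrapT => nF.
have S n : exists y, ball z n.+1%:R^-1 y /\ e <= `|F z - F y|.
  apply: contrapT => nS; apply: nF.
  apply: (proj2 (nbhs_ballP z [set y | `|F z - F y| < e])).
  exists n.+1%:R^-1 => /=; first by rewrite invr_gt0.
  by move=> y By /=; rewrite ltNge; apply/negP => ey; apply: nS; exists y.
have [y yP] := choice S.
have yz : y n @[n --> \oo] --> z.
  apply/cvg_ballP => d d0.
  near=> n; apply: le_ball (proj1 (yP n)).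
  rewrite ltW//; near: n; exact: near_infty_natSinv_lt (PosNum d0).
have /cvgrPdist_lt/(_ e e0) := H y yz.
move=> [n _ /(_ n (leqnn n))] /=.
by rewrite ltNge (yP n).2.
Unshelve. all: by end_near. Qed.

Lemma future_avg_continuous g z : smooth_bounded K tau g -> upper z ->
  {for z, continuous (future_avg g)}.
Proof.
move=> ng Uz; have [sg Sg Bg] := ng; apply: seq_continuous => y yz.
have [C gC] := Bg [::].
(* [upper] is open, so the sequence is eventually in it. The earlier terms are dropped because [g]
   is uncontrolled for t <= 0. *)
have : \forall n \near \oo, upper (y n).
  by apply: yz; apply: open_nbhs_nbhs; split => //; exact: open_upper.
move=> [M _ MU].
rewrite -(cvg_shiftn M).
apply: fine_cvg; rewrite fineK; last first.
  apply: integrable_fin_num => //; apply: integrable_future_integrand => //; exact: ltW.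
apply: (@dominated_cvg _ _ _ lam _ _
    (fun n r => (h^-1 * expR (- r / h) * g ((y (n + M)%N).1, (y (n + M)%N).2 + r))%:E) _ (EFin \o cst (h^-1 * C))) => //=.
- move=> n; apply: measurable_EFin; apply: measurable_future_integrand => //.
  by apply/ltW/MU => /=; exact: leq_addl.
- move=> r; rewrite in_itv/= => /andP[r0 _]; apply: cvg_EFin; first exact: nearW.
  apply: cvgM; first exact: cvg_cst.
  have : {for (z.1, z.2 + r), continuous g}.
    by apply: smooth_on_continuous sg _; exact: addr_gt0.
  move=> cg.
  apply: (@cvg_comp _ _ _ (fun n => ((y (n + M)%N).1, (y (n + M)%N).2 + r)) g _ _ _ _ cg).
  have yM : y (n + M)%N @[n --> \oo] --> z.
    by apply: cvg_comp yz; exact: cvg_addnr.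
  have c1 : (y (n + M)%N).1 @[n --> \oo] --> z.1 by exact: cvg_comp yM cvg_fst.
  have c2 : (y (n + M)%N).2 + r @[n --> \oo] --> z.2 + r.
    by apply: cvgD; [exact: cvg_comp yM cvg_snd|exact: cvg_cst].
  exact: (cvg_pair c1 c2).
- exact: integrable_cst_ocT.
- move=> n r; rewrite in_itv/= => /andP[r0 _]; rewrite lee_fin.
  apply: future_integrand_le => //.
  by apply/ltW/MU => /=; exact: leq_addl.
Qed.

(** The derivative of an average is the average of the derivative, so averages form a class closed
    under differentiation; the bounds on all derivatives follow from those of [g]. *)
Lemma smooth_bounded_future_avg g :
  smooth_bounded K tau g -> smooth_bounded K tau (future_avg g).
Proof.
move=> ng.
pose P F := exists2 g, smooth_bounded K tau g & F = future_avg g.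
have [|||sm H] := @smooth_on_coind _ _ upper P open_upper _ _ (future_avg g).
- by move=> F [k nk ->] x Ux; exact: future_avg_continuous.
- move=> F w [k nk ->]; exists (future_avg ('D_w k)); last first.
    by move=> x Ux; exact: future_avg_derive.
  by exists ('D_w k) => //; exact: smooth_bounded_derive.
- by exists g.
split => //; first by move=> z; exact: future_avg0.
move=> vs; have [F [k nk ->] HF] := H vs.
have [_ _ /(_ [::])[C kC]] := nk.
exists (h^-1 * C * T) => z Uz; rewrite HF//; apply: future_avg_bounded => //.
exact: ltW.
Qed.

Lemma derivable_segment_oo_LRcontinuous (F : R -> R) (a b : R) : a <= b ->
  (forall r, a <= r <= b -> derivable F r 1) -> derivable_oo_LRcontinuous F a b.
Proof.
move=> ab dF.
have cF r : a <= r <= b -> {for r, continuous F}.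
  by move=> /dF /derivable1_diffP/differentiable_continuous.
split.
- by move=> r; rewrite in_itv/= => /andP[ar rb]; apply: dF; rewrite !ltW.
- by apply: cvg_at_right_filter; apply: cF; rewrite lexx.
- by apply: cvg_at_left_filter; apply: cF; rewrite lexx andbT.
Qed.

Lemma is_derive_time g (x : E) (t : R) : smooth_bounded K tau g -> 0 < t ->
  is_derive t 1 (fun s => g (x, s)) ('D_((0, 1) : E * R) g (x, t)).
Proof.
move=> [sg _ _] t0.
have lineE (b : R) : b *: ((0, 1) : E * R) + (x, 0) = (x, b).
  by apply: injective_projections => /=; rewrite ?scaler0 ?add0r// addr0 [_ *: _]mulr1.
have -> : (fun s => g (x, s)) = (fun b => g (b *: ((0, 1) : E * R) + (x, 0))).
  by apply/funext => s; rewrite lineE.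
apply: is_derive_line; rewrite lineE; apply: derivableP.
exact: smooth_on_derivable sg _.
Qed.

Lemma time_lipschitz g (C : R) (x : E) (s t : R) : smooth_bounded K tau g ->
  (forall z, upper z -> `|'D_((0, 1) : E * R) g z| <= C) -> 0 < s -> s < t ->
  `|g (x, t) - g (x, s)| <= C * (t - s).
Proof.
move=> ng dC s0 st.
have d r : r \in `]s, t[ -> is_derive r 1 (fun r => g (x, r)) ('D_((0, 1) : E * R) g (x, r)).
  rewrite in_itv/= => /andP[sr _]; apply: is_derive_time ng _.
  exact: lt_trans sr.
have c : {within `[s, t], continuous (fun r => g (x, r))}.
  apply: continuous_in_subspaceT => r; rewrite inE/= in_itv/= => /andP[sr _].
  by apply: continuous_time_section => //; exact: lt_le_trans sr.
have [r] := MVT st d c.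
rewrite in_itv/= => /andP[sr _] ->.
rewrite normrM (gtr0_norm (_ : 0 < t - s)) ?subr_gt0// ler_wpM2r ?subr_ge0 ?(ltW st)//.
by apply: dC; rewrite /upper/=; exact: lt_trans sr.
Qed.

(** Even at t = 0 the average only evaluates [g] at times r > 0, so the Lipschitz bound of [g] in t
    > 0 passes to the average down to the initial time. This is the rate used in the limit of the
    trace term. *)
Lemma future_avg_lipschitz0 g (C : R) (x : E) (t : R) : smooth_bounded K tau g ->
  (forall z, upper z -> `|'D_((0, 1) : E * R) g z| <= C) -> 0 < t ->
  `|future_avg g (x, t) - future_avg g (x, 0)| <= h^-1 * (C * t) * T.
Proof.
move=> ng dC t0.
have it := integrable_future_integrand ng (z := (x, t)) (ltW t0).
have i0 := integrable_future_integrand ng (z := (x, 0)) (lexx 0).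
have iB : lam.-integrable `]0, T]%classic (EFin \o (fun r =>
    h^-1 * expR (- r / h) * g (x, t + r) - h^-1 * expR (- r / h) * g (x, 0 + r))).
  rewrite (_ : EFin \o _ = fun r => ((h^-1 * expR (- r / h) * g (x, t + r))%:E
    - (h^-1 * expR (- r / h) * g (x, 0 + r))%:E)%E); first exact: integrableB.
  by apply/funext => r /=; rewrite EFinB.
rewrite /future_avg -RintegralB//.
apply: le_trans (le_normr_Rintegral _ iB) _ => //.
apply: le_trans (_ : \int[lam]_(r in `]0, T]) (cst (h^-1 * (C * t))) r <= _).
  apply: le_Rintegral => //.
  - exact: integrable_norm iB.
  - exact: integrable_cst_ocT.
  - move=> r; rewrite /= in_itv/= => /andP[r0 _].
    rewrite -mulrBr normrM ler_pM//; first exact/future_weight_le/ltW.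
    rewrite add0r (le_trans (time_lipschitz x ng dC r0 _))// ?ltrDr//.
    by rewrite addrK.
rewrite Rintegral_cst//= lebesgue_measure_itv/= lte_fin T0/=.
by rewrite subr0.
Qed.

Lemma Rintegral_occT (b : R) (F : R -> R) : measurable_fun `]0, b]%classic F ->
  \int[lam]_(r in `]0, b]) F r = \int[lam]_(r in `[0, b]) F r.
Proof. by move=> mF; congr fine; apply: integral_itv_obnd_cbnd; exact: measurable_EFin. Qed.

Lemma is_derive_shiftl (s r : R) : is_derive r (1 : R) (fun r : R => s + r) 1.
Proof.
have := is_deriveD (is_derive_cst s r (1 : R)) (is_derive_id r (1 : R)).
by rewrite add0r.
Qed.

(** Integration by parts in r with the weight W(r) = e^(-r/h) / h, for which W' = - W / h. The
    boundary term at r = T vanishes because z.2 + T > tau, and the one at r = 0 gives - g / h. *)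
Lemma future_avg_dt g z : smooth_bounded K tau g -> upper z ->
  future_avg ('D_((0, 1) : E * R) g) z = (future_avg g z - g z) / h.
Proof.
move=> ng Uz; have ndg := smooth_bounded_derive (0, 1) cK ng.
have z0 : 0 <= z.2 by exact: ltW.
have md := measurable_future_integrand ndg z0.
have mg := measurable_future_integrand ng z0.
rewrite /future_avg (Rintegral_occT md) (Rintegral_occT mg).
pose W (r : R) := h^-1 * expR (- r / h).
have dW r : is_derive r (1 : R) W (- h^-1 * W r).
  have dl : is_derive r (1 : R) (fun r : R => - h^-1 *: r) (- h^-1 *: 1).
    exact: is_deriveZ.
  have := is_deriveZ h^-1 (is_derive1_comp (is_derive_expR _) dl).
  rewrite (_ : h^-1 \*: _ = W); last first.
    by apply/funext => s; rewrite /W/= mulNr [_ *: s]mulNr [s / h]mulrC.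
  move=> H; apply: is_derive_eq.
  have -> : - h^-1 *: r = - r / h by rewrite [LHS]mulNr mulNr [h^-1 * r]mulrC.
  by rewrite /W /GRing.scale/= mulr1 [expR _ * _]mulrC mulrCA.
have dG (r : R) : 0 <= r -> is_derive r (1 : R) (fun r => g (z.1, z.2 + r))
    ('D_((0, 1) : E * R) g (z.1, z.2 + r)).
  move=> r0; rewrite -[X in is_derive _ _ _ X]mulr1.
  apply: (@is_derive1_comp _ (fun t => g (z.1, t)) (fun r => z.2 + r)).
    by apply: is_derive_time ng _; rewrite ltr_wpDr.
  exact: is_derive_shiftl.
rewrite (@Rintegration_by_parts _ W (fun r => g (z.1, z.2 + r)) (fun r => - h^-1 * W r)
   (fun r => 'D_((0, 1) : E * R) g (z.1, z.2 + r)) 0 T)//.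
- have [_ Sg _] := ng.
  rewrite (Sg (z.1, z.2 + T)); last 2 first.
  + by rewrite /upper/= addr_gt0.
  + move=> [_ /=]; apply/negP; rewrite -ltNge (lt_trans tauT)// ltrDr//.
  rewrite mulr0 sub0r /W oppr0 mul0r expR0 mulr1 addr0 -surjective_pairing.
  have -> : \int[lam]_(r in `[0, T]) (- h^-1 * (h^-1 * expR (- r / h)) * g (z.1, z.2 + r))
     = - h^-1 * \int[lam]_(r in `[0, T]) (h^-1 * expR (- r / h) * g (z.1, z.2 + r)).
    rewrite -(Rintegral_occT mg) -RintegralZl//; last exact: integrable_future_integrand.
    have mg' : measurable_fun `]0, T]%classic
        (fun r => - h^-1 * (h^-1 * expR (- r / h) * g (z.1, z.2 + r))).
      exact: measurable_funM.
    by rewrite (Rintegral_occT mg'); apply: eq_Rintegral => r _; rewrite [RHS]mulrA.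
  by rewrite mulNr opprK mulrBl addrC mulrC; congr (_ - _); rewrite mulrC.
- apply: continuous_in_subspaceT => r _; apply: cvgM; first exact: cvg_cst.
  by have [/derivable1_diffP/differentiable_continuous] := dW r.
- apply: derivable_segment_oo_LRcontinuous => [|r _]; first exact: ltW.
  by have [] := dW r.
- by move=> r _; rewrite derive1E; have [] := dW r.
- apply: continuous_in_subspaceT => r; rewrite inE/= in_itv/= => /andP[r0 _].
  apply: (@continuous_comp _ _ _ (fun r : R => z.2 + r) (fun s => 'D_((0, 1) : E * R) g (z.1, s))).
    by apply: cvgD; [exact: cvg_cst|exact: cvg_id].
  have zr0 : 0 < z.2 + r by exact: ltr_pwDl.
  exact: (@continuous_time_section ('D_((0, 1) : E * R) g) z.1 (z.2 + r) ndg zr0).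
- apply: derivable_segment_oo_LRcontinuous => [|r /andP[r0 _]]; first exact: ltW.
  by have [] := dG r r0.
- move=> r; rewrite in_itv/= => /andP[r0 _].
  by rewrite derive1E; have [] := dG r (ltW r0).
Qed.

(** The substitution t = z.2 + r turns the adjoint kernel into the weight of [future_avg], with r
    running up to T - z.2. The range extends to T because [g] vanishes beyond tau < T. *)
Lemma exp_kernel_future_avg g (psi : E * R -> R) z : smooth_bounded K tau g ->
  (forall y, psi y = if 0 < y.2 < T then g y else 0) -> 0 < z.2 < T ->
  h^-1 * \int[lam]_t (exp_kernel h t z.2 * psi (z.1, t)) = future_avg g z.
Proof.
move=> ng psiE /andP[s0 sT]; set s := z.2 in s0 sT *.
have [sg Sg _] := ng.
pose G t := expR ((s - t) / h) * g (z.1, t).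
have -> : \int[lam]_t (exp_kernel h t s * psi (z.1, t)) = \int[lam]_(t in `[s, T]) G t.
  rewrite [RHS]Rintegral_mkcond; apply: eq_Rintegral => t _; rewrite patchE psiE/=.
  rewrite /exp_kernel; case: ifPn => [st|].
    have t0 : 0 < t by exact: lt_le_trans st.
    have [tT|Tt|tT] := ltgtP t T.
    - by rewrite t0/= mem_set//= in_itv/= st ltW.
    - by rewrite t0/= mulr0 memNset//= in_itv/= st/= leNgt Tt.
    (* At t = T the cut-off [psi] is 0 while [G] still evaluates [g], which vanishes there since tau
       < T. *)
    - rewrite t0/= mulr0 mem_set ?Sg//=; last by rewrite in_itv/= st tT lexx.
      by rewrite /G Sg ?mulr0// => -[_ /=]; rewrite tT leNgt tauT.
  rewrite -ltNge => ts; rewrite mul0r memNset//= in_itv/=.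
  by move=> /andP[]; rewrite leNgt ts.
have cG : {within `[s, T], continuous G}.
  apply: continuous_in_subspaceT => r; rewrite inE/= in_itv/= => /andP[r0 _].
  apply: cvgM; last by apply: continuous_time_section => //; exact: lt_le_trans r0.
  apply: (@continuous_comp _ _ _ (fun r : R => (s - r) / h) expR); last exact: continuous_expR.
  apply: cvgM; last exact: cvg_cst.
  by apply: cvgB; [exact: cvg_cst|exact: cvg_id].
have dF := is_derive_shiftl s.
have F1 : (fun r : R => s + r)^`()%classic = cst 1.
  by apply/funext => r; rewrite derive1E; have [] := dF r.
have -> : \int[lam]_(t in `[s, T]) G t = \int[lam]_(r in `[0, T - s]) G (s + r).
  rewrite /Rintegral; congr fine.
  have := @integration_by_substitution_increasing R (fun r => s + r) G 0 (T - s).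
  rewrite F1 addr0 subrKC => ->//.
  - by apply: eq_integral => r _ /=; rewrite mulr1.
  - by rewrite subr_ge0 ltW.
  - by move=> a b _ _; rewrite ltrD2l.
  - by move=> r _; exact: cst_continuous.
  - exact: is_cvg_cst.
  - exact: is_cvg_cst.
  - apply: derivable_segment_oo_LRcontinuous; first by rewrite subr_ge0 ltW.
    by move=> r _; have [] := dF r.
have GE r : G (s + r) = h * (h^-1 * expR (- r / h) * g (z.1, z.2 + r)).
  by rewrite /G opprD addNKr !mulrA mulfV ?gt_eqF// mul1r.
have z0 : 0 <= z.2 by exact: ltW.
have sub : `]0, T - s]%classic `<=` `]0, T]%classic.
  by apply: subset_itvl; rewrite bnd_simp gerBl ltW.
have mg := measurable_funS (measurable_itv _) sub (measurable_future_integrand ng z0).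
have ig : lam.-integrable `]0, T - s]%classic
    (EFin \o (fun r => h^-1 * expR (- r / h) * g (z.1, z.2 + r))).
  exact: integrableS (integrable_future_integrand ng z0).
have mhg : measurable_fun `]0, T - s]%classic
    (fun r => h * (h^-1 * expR (- r / h) * g (z.1, z.2 + r))).
  exact: measurable_funM.
have -> : \int[lam]_(r in `[0, T - s]) G (s + r) =
    \int[lam]_(r in `[0, T - s]) (h * (h^-1 * expR (- r / h) * g (z.1, z.2 + r))).
  by apply: eq_Rintegral => r _; rewrite GE.
rewrite -(Rintegral_occT mhg).
rewrite RintegralZl// mulrA mulVf ?gt_eqF// mul1r.
rewrite Rintegral_mkcond [RHS]Rintegral_mkcond; apply: eq_Rintegral => r _.
rewrite !patchE; case: ifPn => [/set_mem/sub rT|]; first by rewrite mem_set.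
rewrite notin_setE/= in_itv/= => /negP; rewrite negb_and => /orP[r0|rT].
  by rewrite memNset//= in_itv/= (negbTE r0).
case: ifPn => // /set_mem; rewrite /= in_itv/= => /andP[r0 _].
rewrite Sg ?mulr0//; first by rewrite /upper/= addr_gt0.
move=> [_ /=]; apply/negP; rewrite -ltNge (lt_trans tauT)//.
by move: rT; rewrite -ltNge ltrBlDl.
Qed.

Lemma measurable_strip_patch g : smooth_bounded K tau g ->
  measurable_fun (setT : set ER) (g \_ (strip T)).
Proof.
move=> [sg _ _]; have mS := @measurable_strip R N T.
apply/(measurable_restrictT _ _).1 => //.
apply: within_continuous_measurable => //.
apply: continuous_in_subspaceT => z; rewrite inE => /andP[z0 _].
exact: smooth_on_continuous sg _.
Qed.

Lemma tmoll_future_avg_duality v g : time_regular T v -> smooth_bounded K tau g ->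
  \int[nu]_(z in strip T) (tmoll h v z * g z) =
  \int[nu]_(z in strip T) (v z * future_avg g z).
Proof.
move=> rv ng; have [_ _ /(_ [::])[C gC]] := ng.
have C0 : 0 <= C by exact: le_trans (normr_ge0 _) (gC (0, 1) ltr01).
have H := @tmoll_duality _ _ T h T0 h0 v (g \_ (strip T)) C rv (measurable_strip_patch ng).
transitivity (\int[nu]_z (tmoll h v z * (g \_ (strip T)) z)).
  rewrite Rintegral_mkcond; apply: eq_Rintegral => z _; rewrite !patchE.
  by case: ifP => // _; rewrite mulr0.
rewrite H; last 2 first.
- move=> z; rewrite patchE; case: ifPn => [/set_mem/andP[z0 _]|_]; last by rewrite normr0.
  exact: gC.
- by move=> z nz; rewrite patchE memNset.
have [_ _ _ vS] := rv.
rewrite [RHS]Rintegral_mkcond; apply: eq_Rintegral => z _; rewrite patchE.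
case: ifPn => [/set_mem zT|]; last by rewrite notin_setE => /vS->; rewrite mul0r.
rewrite (@exp_kernel_future_avg g)// => y; rewrite patchE.
case: ifPn => [/set_mem ->//|]; rewrite notin_setE /strip/=.
by case: ifP.
Qed.

End future_average.

Lemma ae_imply {d} {T : measurableType d} {R : realType}
    (mu : {measure set T -> \bar R}) (P Q : T -> Prop) :
  (forall x, P x -> Q x) -> (\forall x \ae mu, P x) -> (\forall x \ae mu, Q x).
Proof. by move=> PQ; apply: filterS. Qed.

Lemma ae_imply2 {d} {T : measurableType d} {R : realType}
    (mu : {measure set T -> \bar R}) (P Q S : T -> Prop) :
  (forall x, P x -> Q x -> S x) ->
  (\forall x \ae mu, P x) -> (\forall x \ae mu, Q x) -> (\forall x \ae mu, S x).
Proof. by move=> PQS; apply: filterS2. Qed.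

Lemma integrable_bounded_mul {d} {T : measurableType d} {R : realType}
    (mu : {measure set T -> \bar R}) (D : set T) (C : R) (b f : T -> R) :
  measurable D -> measurable_fun D b -> (forall x, D x -> `|b x| <= C) ->
  mu.-integrable D (EFin \o f) -> mu.-integrable D (fun x => (b x * f x)%:E).
Proof.
move=> mD mb bC intf; have /integrableP[/measurable_EFinP mf _] := intf.
apply: le_integrable (integrableZl mD C intf) => //.
  exact: measurable_EFin (measurable_funM mb mf).
move=> x Dx /=; rewrite lee_fin !normrM ler_wpM2r//.
exact: le_trans (bC x Dx) (ler_norm _).
Qed.

(** * Smooth ramps *)

Section flat.
Context {R : realType}.
Notation lam := (@lebesgue_measure R).

(* A family closed under differentiation, whose members vanish to infinite order
   at 0. *)
Definition flat (p : {poly R}) (x : R) : R :=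
  if 0 < x then p.[x^-1] * expR (- x^-1) else 0.

(** For n > 0, e^y = (e^(y/n))^n >= (y/n)^n. *)
Lemma expR_exprn_le (n : nat) (y : R) : 0 <= y -> y ^+ n <= n%:R ^+ n * expR y.
Proof.
case: n => [|n] y0; first by rewrite !expr0 mul1r -expR0 ler_expR.
have -> : expR y = expR (y / n.+1%:R) ^+ n.+1.
  by rewrite -expRM_natl mulrC divfK// pnatr_eq0.
rewrite -exprMn lerXn2r ?nnegrE ?mulr_ge0 ?expR_ge0//.
rewrite mulrC -ler_pdivrMr ?ltr0n//.
by apply: le_trans (expR_ge1Dx _); rewrite lerDr.
Qed.

(** With y = 1/x, dividing by x raises the degree of each monomial by one, and y^(i+1) e^(-y) <=
    (i+1)^(i+1). Linear decay gives continuity at 0. *)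
Lemma flat_le_linear (p : {poly R}) : exists2 C, 0 <= C & forall x, `|flat p x| <= C * `|x|.
Proof.
exists (\sum_(i < size p) `|p`_i| * i.+1%:R ^+ i.+1).
  by apply: sumr_ge0 => i _; rewrite mulr_ge0// exprn_ge0.
move=> x; rewrite /flat; case: ifPn => x0; last first.
  rewrite normr0 mulr_ge0//; apply: sumr_ge0 => i _.
  by rewrite mulr_ge0// exprn_ge0.
rewrite horner_coef normrM (ger0_norm (expR_ge0 _)).
rewrite [`|x|]gtr0_norm// -ler_pdivrMr//.
have y0 : 0 <= x^-1 by rewrite invr_ge0 ltW.
rewrite -mulrA; apply: le_trans (ler_wpM2r _ (ler_norm_sum _ _ _)) _.
  by rewrite mulr_ge0 ?expR_ge0.
rewrite mulr_suml ler_sum// => i _; rewrite normrM normrX (ger0_norm y0).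
rewrite -mulrA ler_wpM2l// expRN mulrA mulrAC -exprSr ler_pdivrMr ?expR_gt0//.
exact: expR_exprn_le.
Qed.

Lemma flat_continuous0 (p : {poly R}) : {for 0, continuous (flat p)}.
Proof.
have [C C0 HC] := flat_le_linear p.
have f0 : flat p 0 = 0 by rewrite /flat ltxx.
rewrite /prop_for /continuous_at f0; apply/cvgr0Pnorm_le => e e0.
have C1 : 0 < C + 1 by rewrite ltr_wpDl.
have := @nbhs0_le R R^o (e / (C + 1)) (divr_gt0 e0 C1).
apply: filterS => x xe; apply: le_trans (HC x) _.
move: xe; rewrite ler_pdivlMr// mulrC; apply: le_trans.
by rewrite ler_wpM2r// lerDl.
Qed.

(** With y = 1/x the derivative of p(y) e^(-y) is y^2 (p(y) - p'(y)) e^(-y), which is again of this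
    form. *)
Definition flat_next (p : {poly R}) : {poly R} := 'X ^+ 2 * (p - p^`()).

Lemma is_derive_flat (p : {poly R}) (x : R) : is_derive x (1 : R) (flat p) (flat (flat_next p) x).
Proof.
have [x0|x0|->] := ltgtP x 0.
- have : is_derive x (1 : R) (cst 0 : R -> R) 0 by exact: is_derive_cst.
  have -> : flat (flat_next p) x = 0 by rewrite /flat ltNge (ltW x0).
  apply: near_eq_is_derive.
  have : \forall y \near x, y < 0 by exact: lt_nbhsl.
  by apply: filterS => y y0; rewrite /flat ltNge (ltW y0).
- have dV : is_derive x (1 : R) (fun x : R => x^-1) (- x ^- 2).
    have := is_deriveV (lt0r_neq0 x0) (is_derive_id x (1 : R)).
    by rewrite [_ *: _]mulr1.
  have : is_derive x (1 : R) (fun x => p.[x^-1] * expR (- x^-1)) (flat (flat_next p) x).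
    have d1 := is_derive1_comp (is_derive_poly p x^-1) dV.
    have d2 := is_derive1_comp (g := fun x : R => - x^-1) (is_derive_expR (- x^-1)) (is_deriveN dV).
    apply: is_derive_eq (is_deriveM d1 d2) _.
    rewrite /flat x0 /flat_next hornerM hornerXn hornerD hornerN /GRing.scale/=.
    rewrite exprVn; ring.
  apply: near_eq_is_derive.
  have : \forall y \near x, 0 < y by exact: lt_nbhsr.
  by apply: filterS => y y0; rewrite /flat y0.
- have f0 q : flat q 0 = 0 by rewrite /flat ltxx.
  have H : h^-1 *: ((flat p \o shift 0) (h *: (1 : R)) - flat p 0) @[h --> 0^'] --> 0.
    (* For h > 0 the quotient [flat p h / h] is [flat ('X * p) h], so differentiability at 0 reduces
       to continuity at 0 of another member of the family. *)
    have : flat ('X * p) h @[h --> 0^'] --> 0.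
      have := @flat_continuous0 ('X * p); rewrite /prop_for /continuous_at f0.
      exact: cvg_within_filter.
    apply: cvg_trans; apply: near_eq_cvg; near=> h.
    rewrite f0 subr0 /= addr0 [h *: 1]mulr1 /flat; case: ifPn => h0.
      by rewrite hornerM hornerX [RHS]mulrA.
    by rewrite scaler0.
  rewrite f0; split; first by apply/cvg_ex; exists 0.
  exact: cvg_lim H.
Unshelve. all: by end_near. Qed.

Lemma is_derive_flat_affine (p : {poly R}) (c t : R) :
  is_derive t (1 : R) (fun t => flat p (c * t - 1)) (c * flat (flat_next p) (c * t - 1)).
Proof.
have dl : is_derive t (1 : R) (fun t : R => c * t - 1) c.
  have := is_deriveB (is_deriveZ c (is_derive_id t (1 : R))) (is_derive_cst (1 : R) t 1).
  by rewrite subr0 [_ *: _]mulr1.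
have := is_derive1_comp (g := fun t : R => c * t - 1) (is_derive_flat p (c * t - 1)) dl.
by rewrite mulrC.
Qed.

Definition ramp (k : nat) (t : R) : R := flat 1 (k.+1%:R * t - 1).

Definition dramp (k : nat) (t : R) : R := k.+1%:R * flat (flat_next 1) (k.+1%:R * t - 1).

Lemma is_derive_ramp k t : is_derive t (1 : R) (ramp k) (dramp k t).
Proof. exact: is_derive_flat_affine. Qed.

Lemma ramp_ge0 k t : 0 <= ramp k t.
Proof.
by rewrite /ramp /flat; case: ifP => // _; rewrite hornerC mul1r expR_ge0.
Qed.

Lemma ramp_le1 k t : ramp k t <= 1.
Proof.
rewrite /ramp /flat; case: ifPn => // t0.
by rewrite hornerC mul1r -[leRHS]expR0 ler_expR oppr_le0 invr_ge0 ltW.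
Qed.

Lemma ramp0 k t : t <= k.+1%:R^-1 -> ramp k t = 0.
Proof.
move=> tk; rewrite /ramp /flat subr_gt0 ifF//; apply/negbTE; rewrite -leNgt.
by rewrite mulrC -ler_pdivlMr ?ltr0n// mul1r.
Qed.

Lemma flat_next1 : flat_next 1 = 'X ^+ 2 :> {poly R}.
Proof. by rewrite /flat_next -[1]/(1%:P) derivC subr0 mulr1. Qed.

Lemma dramp_ge0 k t : 0 <= dramp k t.
Proof.
rewrite /dramp mulr_ge0// flat_next1 /flat; case: ifPn => // t0.
by rewrite hornerXn mulr_ge0 ?expR_ge0// exprn_ge0// invr_ge0 ltW.
Qed.

(** The assumption 2 <= (k+1) r gives (k+1) t - 1 >= (k+1) r / 2, and the exponential factor is at
    most 1. What remains is (k+1) ((k+1) r / 2)^(-2). *)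
Lemma dramp_le k (r t : R) : 0 < r -> 2 <= k.+1%:R * r -> r <= t ->
  dramp k t <= 4 / (k.+1%:R * r ^+ 2).
Proof.
move=> r0 kr rt; rewrite /dramp flat_next1 /flat.
have k0 : 0 < k.+1%:R :> R by rewrite ltr0n.
have [kk kkE] : exists kk : R, kk = k.+1%:R by eexists.
rewrite -kkE in kr k0 *.
have krt : kk * r <= kk * t by rewrite ler_wpM2l// ltW.
have y0 : 0 < kk * t - 1 by lra.
rewrite y0 hornerXn.
have H : kk * r / 2 <= kk * t - 1 by lra.
have kr0 : 0 < kk * r / 2 by lra.
apply: (@le_trans _ _ (kk * (kk * r / 2) ^- 2)); last first.
  rewrite le_eqVlt; apply/orP; left; apply/eqP; field.
  by rewrite !gt_eqF.
rewrite (ler_wpM2l (ltW k0))//.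
apply: (@le_trans _ _ ((kk * t - 1)^-1 ^+ 2 * 1)).
  rewrite ler_wpM2l ?exprn_ge0 ?invr_ge0 ?(ltW y0)//.
  by rewrite -[leRHS]expR0 ler_expR oppr_le0 invr_ge0 ltW.
rewrite mulr1 exprVn lef_pV2 ?posrE ?exprn_gt0//.
by rewrite lerXn2r// nnegrE ltW.
Qed.

Lemma ramp_cvg1 t : 0 < t -> ramp k t @[k --> \oo] --> (1 : R).
Proof.
move=> t0; apply/cvgrPdist_le => e e0; near=> k.
have [kk kkE] : exists kk : R, kk = k.+1%:R by eexists.
(* This makes y = 1 / ((k+1) t - 1) at most e, and 1 - e^(-y) <= y. *)
have H : 1 + e^-1 <= kk * t.
  rewrite -ler_pdivrMr// kkE; near: k.
  exists (Num.truncn ((1 + e^-1) / t)) => // n /= Hn.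
  apply: le_trans (ltW (truncnS_gt _)) _.
  by rewrite ler_nat ltnS.
have e1 : 0 < e^-1 by rewrite invr_gt0.
have y0 : 0 < kk * t - 1 by lra.
rewrite /ramp /flat -kkE y0 hornerC mul1r ger0_norm; last first.
  by rewrite subr_ge0 -[leRHS]expR0 ler_expR oppr_le0 invr_ge0 ltW.
have : 1 + - (kk * t - 1)^-1 <= expR (- (kk * t - 1)^-1) by exact: expR_ge1Dx.
have : (kk * t - 1)^-1 <= e.
  by rewrite -[e]invrK lef_pV2 ?posrE//; lra.
by lra.
Unshelve. all: by end_near. Qed.

Lemma continuous_dramp k : continuous (dramp k).
Proof.
move=> t; apply: cvgM; first exact: cvg_cst.
by have [/derivable1_diffP/differentiable_continuous + _] := is_derive_flat_affine (flat_next 1) k.+1%:R t.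
Qed.

Lemma Rintegral_dramp k (T : R) : 0 < T ->
  \int[lam]_(t in `]0, T[) dramp k t = ramp k T.
Proof.
move=> T0.
have mF (D : set R) : measurable_fun D (dramp k).
  by apply: measurable_funTS; apply: continuous_measurable_fun; exact: continuous_dramp.
have -> : \int[lam]_(t in `]0, T[) dramp k t = \int[lam]_(t in `[0, T]) dramp k t.
  congr fine; apply/esym/(@integral_itv_bndoo _ _ _ _ true false).
  exact: measurable_EFin (mF _).
rewrite /Rintegral (@continuous_FTC2 _ _ (ramp k))//.
- by rewrite [ramp k 0]ramp0 ?invr_ge0// oppe0 adde0.
- by apply: continuous_subspaceT; exact: continuous_dramp.
- split.
  + by move=> t _; have [] := is_derive_ramp k t.
  + apply: cvg_at_right_filter.
    by have [/derivable1_diffP/differentiable_continuous + _] := is_derive_ramp k 0.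
  + apply: cvg_at_left_filter.
    by have [/derivable1_diffP/differentiable_continuous + _] := is_derive_ramp k T.
- by move=> t _; rewrite derive1E; have [_] := is_derive_ramp k t.
Qed.

(* dramp k is nonnegative with mass ramp k T -> 1, and is O(1/k) away from t = 0. *)
Lemma dramp_limit (T : R) (G : R -> R) (G0 : R) : 0 < T ->
  lam.-integrable `]0, T[%classic (EFin \o G) ->
  (forall e, 0 < e -> exists2 r, 0 < r &
    \forall t \ae lam, 0 < t < r -> `|G t - G0| <= e) ->
  \int[lam]_(t in `]0, T[) (dramp k t * G t) @[k --> \oo] --> G0.
Proof.
move=> T0 iG HG.
have mD : measurable (`]0, T[%classic : set (measurableTypeR R)).
  exact: measurable_itv.
have Dfin : (lam `]0%R, T[%classic < +oo)%E.
  by rewrite /= lebesgue_measure_itv/= lte_fin T0 -EFinB ltry.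
have mG : measurable_fun `]0, T[%classic G by have /integrableP[/measurable_EFinP] := iG.
have md k (D : set R) : measurable_fun D (dramp k).
  by apply: measurable_funTS; apply: continuous_measurable_fun; exact: continuous_dramp.
have HB0 k : exists B : R, forall t, `]0, T[%classic t -> `|dramp k t| <= B.
  have [C C0 HC] := flat_le_linear (flat_next 1).
  exists (k.+1%:R * (C * (k.+1%:R * T + 1))) => t /=; rewrite in_itv/= => /andP[t0 tT].
  rewrite /dramp normrM ger0_norm// ler_wpM2l// (le_trans (HC _))// ler_wpM2l//.
  rewrite (le_trans (ler_normB _ _))// normr1 lerD2r normrM !ger0_norm ?(ltW t0)//.
  by rewrite ler_wpM2l// ltW.
have [B HB] := choice HB0.
have icst c : lam.-integrable `]0, T[%classic (EFin \o cst c).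
  by apply: measurable_bounded_integrable => //; exact: bounded_cst.
have id_ k : lam.-integrable `]0, T[%classic (EFin \o dramp k).
  rewrite (_ : EFin \o _ = fun t => (dramp k t * cst 1 t)%:E).
    by apply: (@integrable_bounded_mul _ _ _ lam _ (B k) (dramp k) (cst 1)) => //; first [exact: md|exact: HB|exact: icst].
  by apply/funext => t /=; rewrite mulr1.
have iB : lam.-integrable `]0, T[%classic (EFin \o (fun t => G t - G0)).
  rewrite (_ : EFin \o _ = fun t => ((G t)%:E - (cst G0 t)%:E)%E).
    by apply: integrableB => //; exact: icst.
  by apply/funext => t /=; rewrite EFinB.
have idB k : lam.-integrable `]0, T[%classic (EFin \o (fun t => dramp k t * (G t - G0))).
  by apply: (@integrable_bounded_mul _ _ _ lam _ (B k) (dramp k) (fun t => G t - G0)) => //; first [exact: md|exact: HB].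
have idG k : lam.-integrable `]0, T[%classic (EFin \o (fun t => dramp k t * G t)).
  by apply: (@integrable_bounded_mul _ _ _ lam _ (B k) (dramp k) G) => //; first [exact: md|exact: HB].
pose M := \int[lam]_(t in `]0, T[) `|G t - G0|.
have M0 : 0 <= M by exact: Rintegral_ge0.
have E k : \int[lam]_(t in `]0, T[) (dramp k t * G t) =
    \int[lam]_(t in `]0, T[) (dramp k t * (G t - G0)) + G0 * ramp k T.
  have iZ : lam.-integrable `]0, T[%classic (EFin \o (fun t => G0 * dramp k t)).
    exact: (integrableZl mD G0 (id_ k)).
  rewrite -Rintegral_dramp// -RintegralZl// -RintegralD//.
  by apply: eq_Rintegral => t _; rewrite [G0 * _]mulrC -mulrDr subrK.
suff H : \int[lam]_(t in `]0, T[) (dramp k t * (G t - G0)) @[k --> \oo] --> (0 : R).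
  have -> : (fun k => \int[lam]_(t in `]0, T[) (dramp k t * G t)) =
    (fun k => \int[lam]_(t in `]0, T[) (dramp k t * (G t - G0)) + G0 * ramp k T).
    by apply/funext => k; rewrite E.
  have H1 : G0 * ramp k T @[k --> \oo] --> G0 * 1.
    by apply: cvgM; [exact: cvg_cst|exact: ramp_cvg1].
  suff : \int[lam]_(t in `]0, T[) (dramp k t * (G t - G0)) + G0 * ramp k T @[k --> \oo]
      --> 0 + G0 * 1 by rewrite add0r mulr1.
  exact: (cvgD H H1).
apply/cvgr0Pnorm_le => e e0.
have e2 : 0 < e / 2 by rewrite divr_gt0.
have [r r0 Hr] := HG (e / 2) e2.
near=> k.
have [kk kkE] : exists kk : R, kk = k.+1%:R by eexists.
have k0 : 0 < kk by rewrite kkE ltr0n.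
have Hk1 : 2 <= kk * r.
  rewrite -ler_pdivrMr// kkE; near: k.
  exists (Num.truncn (2 / r)) => // n /= Hn.
  by apply: le_trans (ltW (truncnS_gt _)) _; rewrite ler_nat ltnS.
pose c := 4 / (kk * r ^+ 2).
have c0 : 0 <= c by rewrite divr_ge0// mulr_ge0 ?exprn_ge0// ltW.
have cM : c * M <= e / 2.
  have r2 : 0 < r ^+ 2 by rewrite exprn_gt0.
  rewrite /c mulrAC ler_pdivrMr ?mulr_gt0//.
  rewrite [leRHS](_ : _ = kk * (e / 2 * r ^+ 2)); last by ring.
  rewrite -ler_pdivrMr ?mulr_gt0// kkE; near: k.
  exists (Num.truncn (4 * M / (e / 2 * r ^+ 2))) => // n /= Hn.
  by apply: le_trans (ltW (truncnS_gt _)) _; rewrite ler_nat ltnS.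
(* A majorant of [dramp k t * |G t - G0|]: the first summand serves t < r, where [G] is close to
   [G0], the second t >= r, where [dramp k t <= c]. Since [dramp k] has mass at most 1, its integral
   is at most e/2 + c M. *)
pose U t := e / 2 * dramp k t + c * `|G t - G0|.
have i1 : lam.-integrable `]0, T[%classic (EFin \o (fun t => e / 2 * dramp k t)).
  exact: (integrableZl mD (e / 2) (id_ k)).
have i2 : lam.-integrable `]0, T[%classic (EFin \o (fun t => c * `|G t - G0|)).
  exact: (integrableZl mD c (integrable_norm iB)).
have iU : lam.-integrable `]0, T[%classic (EFin \o U).
  rewrite (_ : EFin \o U = fun t => ((e / 2 * dramp k t)%:E + (c * `|G t - G0|)%:E)%E).
    exact: integrableD.
  by apply/funext => t /=; rewrite -EFinD.
apply: le_trans (le_normr_Rintegral mD (idB k)) _.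
apply: (@le_trans _ _ (\int[lam]_(t in `]0, T[) U t)).
  apply: fine_le.
  - exact/integrable_fin_num/(integrable_norm (idB k)).
  - exact: integrable_fin_num.
  apply: ae_ge0_le_integral => //.
  - exact: measurable_int (integrable_norm (idB k)).
  - move=> t _; rewrite lee_fin addr_ge0// mulr_ge0// ?dramp_ge0//; exact: ltW.
  - exact: measurable_int iU.
  apply: ae_imply Hr => t Ht; rewrite /= in_itv/= => /andP[t0 tT].
  rewrite lee_fin normrM ger0_norm ?dramp_ge0//.
  have [tr|rt] := ltP t r.
    rewrite /U mulrC (le_trans (ler_wpM2r (dramp_ge0 _ _) (Ht _)))//.
      by rewrite t0.
    by rewrite lerDl mulr_ge0.
  have := dramp_le r0 (k := k) _ rt; rewrite -kkE => /(_ Hk1) H.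
  rewrite (le_trans (ler_wpM2r (normr_ge0 _) H))// /U lerDr mulr_ge0 ?dramp_ge0//.
  exact: ltW.
have iN := integrable_norm iB.
have -> : \int[lam]_(t in `]0, T[) U t = e / 2 * ramp k T + c * M.
  rewrite RintegralD//; congr (_ + _).
    by rewrite -(Rintegral_dramp k T0) -RintegralZl.
  by rewrite /M -RintegralZl.
have := ler_wpM2l (ltW e2) (ramp_le1 k T); lra.
Unshelve. all: by end_near. Qed.

End flat.

(** * Products with ramps as test functions *)

Section test_functions.
Context {R : realType} {N : nat}.
Notation E := 'rV[R]_N.

Lemma is_derive_of_line (g : E * R -> R) (p w : E * R) (d : R) :
  is_derive (0 : R) (1 : R) (fun b : R => g (b *: w + p)) d -> is_derive p w g d.
Proof.
have H : (fun h => h^-1 *: (((fun b : R => g (b *: w + p)) \o shift 0) (h *: (1 : R)) - g (0 *: w + p))) =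
  (fun h => h^-1 *: ((g \o shift p) (h *: w) - g p)).
  apply/funext => h /=; congr (_ *: (g _ - g _)); last by rewrite scale0r add0r.
  by rewrite [h *: 1]mulr1 addr0.
move=> [dg dE]; split; first by rewrite /derivable -H.
by rewrite -dE /derive H.
Qed.

Lemma is_derive_comp_snd (f : R -> R) (z w : E * R) (d : R) :
  is_derive z.2 (1 : R) f d -> is_derive z w (fun y => f y.2) (w.2 * d).
Proof.
move=> df; apply: is_derive_of_line.
have dl : is_derive (0 : R) (1 : R) (fun b : R => b * w.2 + z.2) w.2.
  have := is_deriveD (is_deriveZ w.2 (is_derive_id (0 : R) (1 : R))) (is_derive_cst z.2 (0 : R) (1 : R)).
  rewrite addr0 [_ *: 1]mulr1.
  rewrite (_ : _ + cst z.2 = fun b : R => b * w.2 + z.2)//.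
  by apply/funext => b; rewrite [b * _]mulrC.
rewrite mulrC; apply: (@is_derive1_comp _ f (fun b : R => b * w.2 + z.2)).
by rewrite mul0r add0r.
Qed.

Lemma flatZ (a : R) (p : {poly R}) x : flat (a *: p) x = a * flat p x.
Proof. by rewrite /flat; case: ifP => _; rewrite ?mulr0// hornerZ mulrA. Qed.

(** Differentiating in the direction w replaces q by a multiple of [flat_next q], so the family
    indexed by polynomials is closed under differentiation. *)
Lemma smooth_flat (p : {poly R}) (c : R) :
  smooth_on [set: E * R] (fun z => flat p (c * z.2 - 1)).
Proof.
pose P (F : E * R -> R) := exists q, F = fun z => flat q (c * z.2 - 1).
have dP q z w : is_derive z w (fun z : E * R => flat q (c * z.2 - 1))
    (flat ((w.2 * c) *: flat_next q) (c * z.2 - 1)).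
  rewrite flatZ -mulrA.
  exact: (is_derive_comp_snd w (is_derive_flat_affine q c z.2)).
apply: (proj1 (@smooth_on_coind _ _ setT P openT _ _ _ _)); last by exists p.
- move=> F [q ->] z _.
  apply: (@continuous_comp _ _ _ snd (fun t : R => flat q (c * t - 1))).
    exact: cvg_snd.
  by have [/derivable1_diffP/differentiable_continuous] := is_derive_flat_affine q c z.2.
- move=> F w [q ->].
  exists (fun z => flat ((w.2 * c) *: flat_next q) (c * z.2 - 1)); last by move=> z _; exact: dP.
  by exists ((w.2 * c) *: flat_next q).
Qed.

Definition ramped (k : nat) (Phi : E * R -> R) (z : E * R) : R := Phi z * ramp k z.2.

Lemma ramped_derive k Phi K tau z w : smooth_bounded K tau Phi -> upper z ->
  is_derive z w (ramped k Phi) ('D_w Phi z * ramp k z.2 + Phi z * (w.2 * dramp k z.2)).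
Proof.
move=> [sP _ _] Uz.
have dP := derivableP (smooth_on_derivable (v := w) sP Uz).
have dr := is_derive_comp_snd w (is_derive_ramp k z.2).
have := is_deriveM dP dr.
by rewrite addrC [ramp k z.2 *: _]mulrC.
Qed.

(** Smoothness holds on two open sets covering the space: on t > 0 as a product of smooth functions,
    and on t < 1/(k+1), where the product is 0. The support lies in the compact set [K x
    [1/(k+1), tau]]. *)
Lemma ramped_test_function (Om K : set E) (T tau : R) Phi k :
  compact K -> K `<=` Om -> tau < T -> smooth_bounded K tau Phi ->
  test_function (cylinder Om T) (ramped k Phi).
Proof.
move=> cK KOm tauT [sP SP BP].
have k0 : 0 < k.+1%:R^-1 :> R by rewrite invr_gt0.
have smooth : smooth_on [set: E * R] (ramped k Phi).
  have s1 : smooth_on upper (ramped k Phi).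
    apply: (@smooth_onM _ _ upper Phi (fun z => ramp k z.2)).
    - exact: open_upper.
    - exact: sP.
    - by move=> vs x _; apply: (@smooth_flat 1 k.+1%:R).
  have s2 : smooth_on [set z : E * R | z.2 < k.+1%:R^-1] (ramped k Phi).
    have oL : open [set z : E * R | z.2 < k.+1%:R^-1].
      rewrite (_ : [set z | _] = snd @^-1` [set t : R | t < k.+1%:R^-1])//.
      by apply: open_comp => [z _|]; [exact: cvg_snd|exact: open_lt].
    apply: (@smooth_on_eq _ _ _ (cst 0) _ oL); last exact: smooth_on_cst0.
    by move=> z /= zk; rewrite /ramped ramp0 ?mulr0// ltW.
  move=> vs z _; have [z0|z0] := ltP 0 z.2; first exact: s1.
  by apply: s2 => /=; exact: le_lt_trans k0.
pose S := K `*` `[k.+1%:R^-1, tau]%classic.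
have cS : compact S by apply: compact_setX => //; exact: segment_compact.
have clS : closed S by apply: compact_closed cS; exact: norm_hausdorff.
have sub : support_in setT (ramped k Phi) `<=` S.
  rewrite /support_in setTI [X in _ `<=` X](closure_id S).1//.
  apply: closure_subset => z /= /eqP nz.
  have zk : k.+1%:R^-1 < z.2.
    by rewrite ltNge; apply/negP => zk; apply: nz; rewrite /ramped ramp0 ?mulr0.
  have Uz : upper z by exact: lt_trans zk.
  have [Kz zt] : K z.1 /\ z.2 <= tau.
    by apply: contrapT => h; apply: nz; rewrite /ramped SP ?mul0r.
  by split => //=; rewrite in_itv/= zt ltW.
split => //.
- by apply: subclosed_compact cS sub; exact: closed_closure.
- move=> z /sub[Kz]; rewrite /= in_itv/= => /andP[kz zt]; split => /=.
    exact: KOm.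
  by rewrite in_itv/= (lt_le_trans k0 kz) (le_lt_trans zt).
Qed.

End test_functions.

(** * Lebesgue norms *)

Section Lq.
Context {d} {T : measurableType d} {R : realType}.
Variable mu : {measure set T -> \bar R}.
Implicit Types (D : set T) (f g : T -> R) (q : R).

Lemma Lnorm_patch q D f : 0 < q ->
  Lnorm mu q%:E (EFin \o (f \_ D)) =
  ((\int[mu]_(x in D) (`|f x| `^ q)%:E) `^ q^-1)%E.
Proof.
move=> q0; rewrite Lnorm.unlock; congr (_ `^ _)%E; rewrite [RHS]integral_mkcond.
apply: eq_integral => x _; rewrite !patchE /= patchE; case: ifP => // _.
(* Off [D] the integrand is 0 to the power q; this is 0 because q > 0, whereas the power 0 would
   give 1. *)
by rewrite (_ : point = 0)// normr0 powR0// gt_eqF.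
Qed.

Lemma finite_norm_patch q D f : 0 < q ->
  finite_norm mu q%:E (f \_ D) <->
  (\int[mu]_(x in D) (`|f x| `^ q)%:E < +oo)%E.
Proof.
move=> q0; rewrite /finite_norm Lnorm_patch//; split=> [|H].
  by apply: lty_poweRy; rewrite invr_neq0// gt_eqF.
exact: poweR_lty.
Qed.

Lemma Lnorm_patch_le q D f (e : R) : 0 < q -> 0 <= e ->
  (Lnorm mu q%:E (EFin \o (f \_ D)) <= e%:E)%E <->
  (\int[mu]_(x in D) (`|f x| `^ q)%:E <= (e `^ q)%:E)%E.
Proof.
move=> q0 e0; rewrite Lnorm_patch//; set I := (\int[mu]_(x in D) _)%E.
have I0 : (0 <= I)%E by apply: integral_ge0 => x _; rewrite lee_fin powR_ge0.
have q0' : 0 <= q^-1 by rewrite invr_ge0 ltW.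
have itv (y : \bar R) : (0 <= y)%E -> y \in `[0%E, +oo%E].
  by move=> y0; rewrite in_itv/= y0 leey.
split => H.
- have : ((I `^ q^-1) `^ q <= (e%:E `^ q))%E.
    by apply: gt0_ler_poweR => //; rewrite ?ltW// itv ?lee_fin// poweR_ge0.
  by rewrite -poweRrM mulVf ?gt_eqF// poweRe1// poweR_EFin.
- have : (I `^ q^-1 <= ((e `^ q)%:E `^ q^-1))%E.
    by apply: gt0_ler_poweR => //; rewrite ?itv ?lee_fin// powR_ge0.
  by rewrite poweR_EFin -powRrM mulfV ?gt_eqF// powRr1.
Qed.

Lemma measurable_norm_powR D f q : measurable_fun D f ->
  measurable_fun D (fun x => `|f x| `^ q).
Proof.
move=> mf; apply: (measurableT_comp (measurable_powR q)).
exact: measurableT_comp.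
Qed.

(** Either y <= de, or y / de > 1 and then y / de <= (y / de)^q. *)
Lemma norm_le_powR q (de y : R) : 1 <= q -> 0 < de -> 0 <= y ->
  y <= de + de * (de `^ q)^-1 * y `^ q.
Proof.
move=> q1 d0 y0; have dq : 0 < de `^ q by exact: powR_gt0.
have [yd|dy] := leP y de.
  rewrite (le_trans yd)// lerDl mulr_ge0 ?powR_ge0//.
  by rewrite mulr_ge0 ?invr_ge0 ?powR_ge0// ltW.
have H : y / de <= (y / de) `^ q by apply: le1r_powR => //; rewrite ler_pdivlMr// mul1r ltW.
have yE : (y / de) `^ q = (de `^ q)^-1 * y `^ q.
  rewrite powRM ?invr_ge0 ?(ltW d0)// mulrC; congr (_ * _).
  by rewrite -powR_inv1 ?(ltW d0)// -powRrM mulN1r powRN.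
rewrite -mulrA -yE; move: H; rewrite ler_pdivrMr// mulrC => /le_trans; apply.
by rewrite lerDr ltW.
Qed.

(** An elementary substitute for the Hölder inequality on sets of finite measure: [de] is free, so a
    small integral of |f|^q forces a small integral of |f|. *)
Lemma integral_norm_le_powR q D f (de : R) : measurable D -> (mu D < +oo)%E ->
  1 <= q -> 0 < de -> measurable_fun D f ->
  (\int[mu]_(x in D) `|(f x)%:E| <=
   de%:E * mu D + (de * (de `^ q)^-1)%:E * \int[mu]_(x in D) (`|f x| `^ q)%:E)%E.
Proof.
move=> mD Doo q1 d0 mf; have c0 : 0 <= de * (de `^ q)^-1.
  by rewrite mulr_ge0 ?invr_ge0 ?powR_ge0// ltW.
have mp := measurable_EFin (measurable_norm_powR q mf).
rewrite -integral_cst// -ge0_integralZl//=.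
rewrite -ge0_integralD//=; last 3 first.
- by move=> x _; rewrite lee_fin ltW.
- by move=> x _; rewrite -EFinM lee_fin mulr_ge0 ?powR_ge0.
- by apply: emeasurable_funM.
apply: ge0_le_integral => //.
- by apply: measurable_EFin; exact: measurableT_comp.
- by apply: emeasurable_funD => //; apply: emeasurable_funM.
- by move=> x _; rewrite -EFinM -EFinD lee_fin; exact: norm_le_powR.
Qed.

Lemma integrable_powR q D f : measurable D -> (mu D < +oo)%E -> 1 <= q ->
  measurable_fun D f -> (\int[mu]_(x in D) (`|f x| `^ q)%:E < +oo)%E ->
  mu.-integrable D (EFin \o f).
Proof.
move=> mD Doo q1 mf foo; apply/integrableP; split; first exact: measurable_EFin.
apply: le_lt_trans (integral_norm_le_powR mD Doo q1 ltr01 mf) _.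
by rewrite lte_add_pinfty// lte_mul_pinfty ?lee_fin// powR1 invr1 mulr1.
Qed.

(** Write f P - g P0 = P (f - g) + (P - P0) g. *)
Lemma product_difference_le D f g (P P0 : T -> R) (C e : R) : measurable D ->
  mu.-integrable D (EFin \o f) -> mu.-integrable D (EFin \o g) ->
  measurable_fun D P -> measurable_fun D P0 ->
  (forall x, D x -> `|P x| <= C) -> (forall x, D x -> `|P x - P0 x| <= e) ->
  `|\int[mu]_(x in D) (f x * P x) - \int[mu]_(x in D) (g x * P0 x)| <=
  C * \int[mu]_(x in D) `|f x - g x| + e * \int[mu]_(x in D) `|g x|.
Proof.
move=> mD intf intg mP mP0 PC Pe.
have P0C x : D x -> `|P0 x| <= C + e.
  move=> Dx; rewrite -[P0 x](subrK (P x)) addrC (le_trans (ler_normD _ _))//.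
  by rewrite lerD ?PC// distrC Pe.
have ifP : mu.-integrable D (EFin \o (fun x => f x * P x)).
  under eq_fun do rewrite mulrC; exact: integrable_bounded_mul mD mP PC intf.
have igP : mu.-integrable D (EFin \o (fun x => g x * P0 x)).
  under eq_fun do rewrite mulrC; exact: integrable_bounded_mul mD mP0 P0C intg.
have ifg : mu.-integrable D (EFin \o (fun x => f x - g x)).
  exact: (integrableB mD intf intg).
have infg : mu.-integrable D (EFin \o (fun x => `|f x - g x|)).
  exact: integrable_norm ifg.
have ing : mu.-integrable D (EFin \o (fun x => `|g x|)) by exact: integrable_norm intg.
rewrite -RintegralB// -!RintegralZl// -RintegralD//; last 2 first.
- exact: (integrableZl mD C infg).
- exact: (integrableZl mD e ing).
have ifPgP : mu.-integrable D (EFin \o (fun x => f x * P x - g x * P0 x)).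
  exact: (integrableB mD ifP igP).
apply: le_trans (le_normr_Rintegral mD ifPgP) _.
apply: le_Rintegral => //.
- exact: integrable_norm ifPgP.
- exact: (integrableD mD (integrableZl mD C infg) (integrableZl mD e ing)).
- move=> x Dx; rewrite (_ : _ - _ = P x * (f x - g x) + (P x - P0 x) * g x); last by ring.
  by rewrite (le_trans (ler_normD _ _))// !normrM lerD// ler_wpM2r// ?PC// Pe.
Qed.

End Lq.

(** * Sets of finite volume and the limit of the ramps *)

Section finite_volume.
Context {R : realType} {N : nat}.
Notation E := 'rV[R]_N.
Notation mu := (lebesgueN R N).
Notation lam := (@lebesgue_measure R).
Notation nu := (lebesgueNT R N).

(** [U] is the slice at time 0 of the open set [U x R], to which the product case applies. *)
Lemma measurable_open_rV (U : set E) : open U -> measurable U.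
Proof.
move=> oU.
have oU' : open (fst @^-1` U : set (E * R)).
  by apply: open_comp => // z _; exact: cvg_fst.
have := measurable_ysection (0 : R) (open_rV_prod_measurable oU').
rewrite (_ : ysection _ _ = U)//; apply/seteqP; split => x /=.
  by rewrite /ysection/= inE.
by rewrite /ysection/= inE.
Qed.

Lemma measurable_compact_rV (K : set E) : compact K -> measurable K.
Proof.
move=> cK; have clK : closed K by apply: compact_closed cK; exact: norm_hausdorff.
rewrite -[K]setCK; apply: measurableC; apply: measurable_open_rV.
exact: closed_openC.
Qed.

(** The set lies in a cube, whose volume is a finite product of lengths of intervals. *)
Lemma bounded_set_volume (B : set E) : measurable B -> bounded_set B ->
  (mu B < +oo)%E.
Proof.
move=> mB [M [Mr BM]].
have BM1 : B `<=` [set x | `|x| <= M + 1] by apply: BM; rewrite ltrDl.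
pose A (i : 'I_N) : set R := `[- (M + 1), M + 1]%classic.
have mA i : measurable (A i) by exact: measurable_itv.
have BA : B `<=` [set x | forall i, A i (x ord0 i)].
  move=> x /BM1 xM i; rewrite /A/= in_itv/= -ler_norml.
  apply: le_trans xM; rewrite [leRHS]mx_normrE.
  exact: (@le_bigmax _ _ _ _ (fun ij : 'I_1 * 'I_N => `|x ij.1 ij.2|) (ord0, i)).
have mbox : measurable [set x : E | forall i, A i (x ord0 i)].
  have -> : [set x : E | forall i, A i (x ord0 i)] =
      \bigcap_(j in [set: 'I_N]) (rV_coord j @^-1` A j).
    by apply/seteqP; split => x /= Ax j; [move=> _|]; exact: Ax.
  apply: fin_bigcap_measurable => // j _.
  by rewrite -[X in measurable X]setTI; exact: measurable_rV_coord.
apply: (@le_lt_trans _ _ (mu [set x | forall i, A i (x ord0 i)])).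
  by apply: le_measure; rewrite ?inE.
rewrite lebesgueN_box//.
have : forall r : seq 'I_N,
    (\big[*%E/1%E]_(i <- r) lam (A i))%E \is a fin_num.
  elim=> [|i r IH]; first by rewrite big_nil.
  rewrite big_cons fin_numM// /A lebesgue_measure_itv/=.
  by case: ifP => // _; rewrite -EFinD.
by move=> /(_ (index_enum _)); rewrite ltey_eq => ->.
Qed.

Lemma compact_volume (K : set E) : compact K -> (mu K < +oo)%E.
Proof.
move=> cK; apply: bounded_set_volume; first exact: measurable_compact_rV.
exact: compact_bounded.
Qed.

Lemma cylinder_volume (B : set E) (T : R) : measurable B -> (mu B < +oo)%E -> 0 < T ->
  (nu (cylinder B T) < +oo)%E.
Proof.
move=> mB Boo T0; rewrite [X in (X < _)%E](_ : _ = mu B * lam `]0%R, T[%classic)%E; last exact: product_measure1E.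
rewrite /= lebesgue_measure_itv/= lte_fin T0 oppr0 adde0.
by apply: lte_mul_pinfty; rewrite ?ge0_fin_numE// ltry.
Qed.

Lemma ramp_limit (T : R) (F : E * R -> R) :
  nu.-integrable (strip T) (EFin \o F) ->
  \int[nu]_(z in strip T) (F z * ramp k z.2) @[k --> \oo] -->
  \int[nu]_(z in strip T) F z.
Proof.
move=> iF; have mS := measurable_strip (N := N) T.
have mF : measurable_fun (strip T) F.
  by have /measurable_int := iF; move/measurable_EFinP.
have mr k : measurable_fun (strip T) (fun z : E * measurableTypeR R => ramp k z.2).
  apply: (@measurableT_comp _ _ _ _ _ _ (ramp k)) => //; last first.
    exact: measurable_funS (@measurable_snd _ _ E (measurableTypeR R)).
  apply: continuous_measurable_fun => t.
  by have [/derivable1_diffP/differentiable_continuous] := is_derive_ramp k t.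
have mFk k : measurable_fun (strip T) (EFin \o (fun z => F z * ramp k z.2)).
  by apply: measurable_EFin; apply: measurable_funM.
have := @dominated_cvg _ _ _ nu (strip T) mS
  (fun k z => (F z * ramp k z.2)%:E) (EFin \o F) (fun z => `|(F z)%:E|%E) mFk.
have c1 : (forall z, strip T z ->
   (fun k => (F z * ramp k z.2)%:E) @ \oo --> (EFin \o F) z).
  move=> z /= /andP[z0 _]; apply: cvg_EFin; first exact: nearW.
  rewrite -[X in _ --> X]mulr1.
  by apply: cvgM; [exact: cvg_cst|exact: ramp_cvg1].
have c2 : nu.-integrable (strip T) (fun z => `|(F z)%:E|%E).
  by apply: integrable_abse.
have c3 k z : strip T z -> (`|(F z * ramp k z.2)%:E| <= `|(F z)%:E|)%E.
  move=> Sz; rewrite /= lee_fin normrM ler_piMr// ger0_norm ?ramp_ge0//.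
  exact: ramp_le1.
move=> /(_ c1 (fun _ _ => isT) c2 c3) cv.
apply: fine_cvg; rewrite fineK; last exact: integrable_fin_num.
exact: cv.
Qed.

End finite_volume.

Lemma dramp_bounded {R : realType} (k : nat) (T : R) : 0 < T ->
  exists M, forall t, 0 < t < T -> `|dramp k t| <= M.
Proof.
move=> T0.
have ck : {within `[0, T], continuous (dramp k)}.
  by apply: continuous_subspaceT; exact: continuous_dramp.
have [c _ cM] := EVT_max (ltW T0) ck.
exists (dramp k c) => t /andP[t0 tT]; rewrite ger0_norm ?dramp_ge0//.
by apply: cM; rewrite in_itv/= !ltW.
Qed.

(** * The initial trace *)

Section initial_trace.
Context {R : realType} {N : nat}.
Notation E := 'rV[R]_N.
Notation mu := (lebesgueN R N).
Notation lam := (@lebesgue_measure R).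
Notation nu := (lebesgueNT R N).
Notation ER := (E * measurableTypeR R)%type.

(** Fubini with time as the outer variable. [G] is defined at every t and agrees with the
    extended-real slice integral for almost every t only. *)
Lemma Rintegral_slices (F : E * R -> R) (T : R) (g : R -> R) (M : R) :
  nu.-integrable setT (EFin \o F) -> measurable_fun setT g -> (forall t, 0 < t < T -> `|g t| <= M) ->
  let G t := \int[mu]_x F (x, t) in
  lam.-integrable `]0, T[%classic (EFin \o G) /\
  \int[nu]_(z in strip T) (F z * g z.2) = \int[lam]_(t in `]0, T[) (g t * G t).
Proof.
move=> iF mg gM G.
have mI : measurable (`]0, T[%classic : set (measurableTypeR R)) by exact: measurable_itv.
have mS := measurable_strip (N := N) T.
have aeG : {ae lam, forall t, fubini_G mu (EFin \o F) t = (G t)%:E}.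
  have /= := ae_integrable2 iF; apply: ae_imply => t it.
  by rewrite /G /Rintegral fineK//; exact: integrable_fin_num it.
have mF : measurable_fun setT F by have /integrableP[/measurable_EFinP] := iF.
have mG : measurable_fun setT G.
  by apply: measurableT_comp => //; exact: (@measurable_fubini_G _ _ _ _ R mu lam _ iF).
have iG : lam.-integrable setT (EFin \o G).
  apply/integrableP; split; first exact: measurable_EFin.
  have := (integrable21ltyP mu lam (measurable_EFin mF)).1 iF.
  apply: le_lt_trans; apply: ge0_le_integral => //.
  - exact: measurableT_comp (measurable_EFin mG).
  - apply: (@measurable_fun_fubini_tonelli_G _ _ _ _ R mu (abse \o (EFin \o F))).
      by apply: measurableT_comp => //; exact: measurable_EFin.
    by move=> z; exact: abse_ge0.
  - move=> t _; apply: (@le_trans _ _ `|\int[mu]_x (F (x, t))%:E|%E).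
      (* Where the slice integral is infinite, [fine] returns 0 and the inequality is trivial. *)
      by rewrite /G /Rintegral /=; case: (\int[mu]_x (F (x, t))%:E)%E => [r| |]//=; rewrite ?lexx// normr0 leey.
    apply: le_abse_integral => //; apply: measurable_EFin.
    exact: measurableT_comp mF (pair2_measurable t).
have mgS : measurable_fun (strip T) (fun z : ER => g z.2).
  exact: measurable_funS (measurableT_comp mg measurable_snd).
have iFg : nu.-integrable setT (EFin \o ((fun z => F z * g z.2) \_ (strip T))).
  rewrite (_ : _ \o _ = (EFin \o (fun z => F z * g z.2)) \_ (strip T)); last first.
    by apply/funext => z; rewrite /= !patchE; case: ifP.
  apply/(integrable_mkcond _ _).1 => //.
  under eq_fun do rewrite mulrC.
  apply: (@integrable_bounded_mul _ _ _ nu _ M) => //.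
    by move=> z; exact: gM.
  exact: integrableS iF.
split; first exact: integrableS iG.
rewrite Rintegral_mkcond [RHS]Rintegral_mkcond; congr fine.
rewrite -(integral21_prod_meas1 (m1 := mu) (m2 := lam) iFg).
apply: ae_integral => //.
  apply: measurable_EFin; apply/(measurable_restrictT _ _).1 => //.
  by apply: measurable_funS (measurable_funM mg mG).
have /= := ae_integrable2 iF; move: aeG; apply: ae_imply2 => t Gt it _; rewrite /fubini_G.
transitivity (\int[mu]_x ((if t \in `]0, T[%classic then g t else 0)%:E * (F (x, t))%:E))%E.
  apply: eq_integral => x _; rewrite /= patchE.
  have -> : ((x, t) \in strip T) = (t \in `]0, T[%classic).
    by apply/idP/idP => /set_mem/=; rewrite ?in_itv/= => tT; apply/mem_set; rewrite /= ?in_itv.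
  by case: ifP => _; rewrite -EFinM ?mul0r// mulrC.
rewrite patchE; case: ifPn => tT; last first.
  by under eq_integral do rewrite mul0e; rewrite integral0.
by rewrite EFinM -Gt /fubini_G integralZl.
Qed.

(** Continuity in L^q is restated with integrals of q-th powers, which can be compared and added
    directly; one direction uses a given representative, the other builds a new one. *)
Lemma Lnorm_continuousP (D : set E) (T q t0 : R) (w : R -> E -> R) :
  0 < q ->
  Lnorm mu q%:E (EFin \o ((w t \- w t0) \_ D)) @[t --> within `[0, T] (nbhs t0)] --> 0%E
  <->
  forall e, 0 < e -> exists2 r, 0 < r & forall t, 0 <= t <= T -> `|t - t0| < r ->
    (\int[mu]_(x in D) (`|w t x - w t0 x| `^ q)%:E <= e%:E)%E.
Proof.
move=> q0; split => [wc e e0|H].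
- pose e' := e `^ q^-1; have e'0 : 0 < e' by rewrite powR_gt0.
  have e'q : e' `^ q = e by rewrite /e' -powRrM mulVf ?gt_eqF// powRr1// ltW.
  have : \forall t \near within `[0, T] (nbhs t0),
      (Lnorm mu q%:E (EFin \o ((w t \- w t0)%R \_ D)) < e'%:E)%E.
    by refine (wc [set y | (y < e'%:E)%E] _); apply: open_ereal_lt'; rewrite lte_fin.
  rewrite near_withinE => /nbhs_ballP[r r0 rP]; exists r => // t tT tr.
  rewrite -e'q; apply/(Lnorm_patch_le mu D (w t \- w t0) q0 (ltW e'0)).
  apply: ltW; apply: (rP t) => /=; last by rewrite in_itv.
  by rewrite /ball/= distrC.
- move=> A [e /= e0 eA].
  suff : \forall t \near within `[0, T] (nbhs t0),
      A (Lnorm mu q%:E (EFin \o ((w t \- w t0)%R \_ D))) by [].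
  rewrite near_withinE.
  pose e2 := e / 2; have e20 : 0 < e2 by rewrite divr_gt0.
  have [r r0 rP] := H (e2 `^ q) (powR_gt0 _ e20).
  apply/nbhs_ballP; exists r => // t /=; rewrite /ball/= distrC => tr.
  rewrite in_itv/= => tT.
  have := rP t tT tr.
  move/(Lnorm_patch_le mu D (w t \- w t0) q0 (ltW e20)).
  have := Lnorm_ge0 mu q%:E (EFin \o ((w t \- w t0) \_ D)).
  case: (Lnorm _ _ _) => [y| |] //; rewrite !lee_fin => y0 ye.
  by apply: eA; rewrite /ball/= sub0r normrN ger0_norm// (le_lt_trans ye)// /e2 ltr_pdivrMr// ltr_pMr// ltr1n.
Qed.

(** For almost every small t the slice integral [G t] equals that of w(t) Phi(., t) over [K]. It is
    close to that of w(0) Phi(., 0) by continuity of [w] and the Lipschitz bound on [Phi], and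
    [dramp_limit] then applies. *)
Lemma trace_limit (K : set E) (T q C L : R) (v v' Phi : E * R -> R) w :
  0 < T -> 1 <= q -> 0 <= L -> measurable K -> (mu K < +oo)%E ->
  continuous_rep K T q v w -> time_regular T v' ->
  (forall z, ~ cylinder K T z -> v' z = 0) ->
  v = v' %[ae nu in cylinder K T] ->
  measurable_fun (strip T : set ER) Phi ->
  measurable_fun setT (fun x => Phi (x, 0)) ->
  (forall z, 0 <= z.2 < T -> `|Phi z| <= C) ->
  (forall x t, 0 < t < T -> `|Phi (x, t) - Phi (x, 0)| <= L * t) ->
  \int[nu]_(z in strip T) (v' z * Phi z * dramp k z.2) @[k --> \oo] -->
  \int[mu]_(x in K) (w 0 x * Phi (x, 0)).
Proof.
move=> T0 q1 L0 mK Koo [wLq wc vw] [mv' iv' iv'x v'S] v'C vv' mPhi mPhi0 PC PL.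
have q0 : 0 < q by exact: lt_le_trans q1.
have mS := measurable_strip (N := N) T.
have C0 : 0 <= C by apply: le_trans (PC (0, 0) _); rewrite //= lexx.
pose F : E * R -> R := (fun z => v' z * Phi z) \_ (strip T).
have iF : nu.-integrable setT (EFin \o F).
  rewrite (_ : _ \o _ = (EFin \o (fun z => v' z * Phi z)) \_ (strip T)); last first.
    by apply/funext => z; rewrite /= /F !patchE; case: ifP.
  apply/(integrable_mkcond _ _).1 => //.
  under eq_fun do rewrite mulrC.
  apply: (@integrable_bounded_mul _ _ _ nu _ C) => //.
    by move=> z /andP[z0 zT]; apply: PC; rewrite ltW.
  exact: integrableS iv'.
have bd k := dramp_bounded k T0.
pose G t := \int[mu]_x F (x, t).
have md k : measurable_fun (setT : set (measurableTypeR R)) (dramp k : R -> R).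
  by apply: continuous_measurable_fun; exact: continuous_dramp.
have iG : lam.-integrable `]0, T[%classic (EFin \o G).
  by have [M bM] := bd 0; have [] := Rintegral_slices iF (md 0) bM.
rewrite (_ : (fun k => _) = (fun k => \int[lam]_(t in `]0, T[) (dramp k t * G t))); last first.
  apply/funext => k; have [M bM] := bd k; have [_ <-] := Rintegral_slices iF (md k) bM.
  by apply: eq_Rintegral => z Sz; rewrite /F patchE Sz.
have l0 : `[0, T]%classic (0 : R) by rewrite /= in_itv/= lexx ltW.
(* [w 0] is Borel only up to a null set; [g0] is its Borel representative. *)
have [[g0 mg0 wg0] /(finite_norm_patch mu K (w 0) q0) woo] := wLq 0 l0.
have g0q : (\int[mu]_(x in K) (`|g0 x| `^ q)%:E < +oo)%E.
  apply: le_lt_trans woo; rewrite le_eqVlt; apply/orP; left; apply/eqP.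
  apply/esym; apply: ae_integral => //.
    exact: measurable_EFin (measurable_norm_powR q mg0).
  by move: wg0; apply: ae_imply => x wx Kx; rewrite wx.
have ig0 : mu.-integrable K (EFin \o g0) by exact: integrable_powR g0q.
rewrite (@ae_Rintegral _ _ _ mu K _ (fun x => g0 x * Phi (x, 0)))//; last 2 first.
- by apply: measurable_funM => //; exact: measurable_funS mPhi0.
- by move: wg0; apply: ae_imply => x wx Kx; rewrite wx.
apply: dramp_limit => // e e0.
set I0 := \int[mu]_(x in K) `|g0 x|.
have I00 : 0 <= I0 by apply: Rintegral_ge0 => x _.
set m := fine (mu K); have m0 : 0 <= m by apply: fine_ge0.
have mE : mu K = m%:E by rewrite /m fineK// ge0_fin_numE.
(* The error is bounded by C m de + C c e1 + L t I0. The choices of [de], [e1] and [r2] make each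
   term at most e/3, and the added 1 keeps the denominators positive. *)
pose de := e / (3 * (C * m + 1)).
have Cm1 : 0 < C * m + 1 by rewrite ltr_wpDl// mulr_ge0.
have de0 : 0 < de by rewrite divr_gt0// mulr_gt0.
pose c := de * (de `^ q)^-1; have c0 : 0 < c by rewrite mulr_gt0// invr_gt0 powR_gt0.
have Cc1 : 0 < C * c + 1 by rewrite ltr_wpDl// mulr_ge0// ltW.
pose e1 := e / (3 * (C * c + 1)); have e10 : 0 < e1 by rewrite divr_gt0// mulr_gt0.
have LI1 : 0 < L * I0 + 1 by rewrite ltr_wpDl// mulr_ge0.
pose r2 := e / (3 * (L * I0 + 1)); have r20 : 0 < r2 by rewrite divr_gt0// mulr_gt0.
have [r1 r10 wr1] := (Lnorm_continuousP K T 0 w q0).1 (wc 0 l0) e1 e10.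
exists (Num.min (Num.min r1 r2) T); first by rewrite !lt_min r10 r20 T0.
have A1 : {ae lam, forall t, `]0, T[%classic t ->
   {ae mu, forall x, K x -> v (x, t) = v' (x, t)}}.
  have := product_ae2 (m1 := mu) (m2 := lam) vv'; apply: ae_imply => t vt tT.
  by move: vt; apply: ae_imply => x H Kx; apply: H.
have A2 := ae_integrable2 iv'.
have A12 := ae_imply2 (fun t P Q => conj P Q) A1 vw.
move: A12 A2; apply: ae_imply2 => t [vt vwt] it; rewrite !lt_min => /andP[t0 /andP[/andP[tr1 tr2] tT]].
have tTT : `]0, T[%classic t by rewrite /= in_itv/= t0.
have tTb : 0 < t < T by rewrite t0.
have {vt} vt := vt tTT; have {vwt} vwt := vwt tTT.
have it' : mu.-integrable K (fun x => (v' (x, t))%:E) by exact: integrableS it.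
have GE : G t = \int[mu]_(x in K) (v' (x, t) * Phi (x, t)).
  rewrite /G [RHS]Rintegral_mkcond; apply: eq_Rintegral => x _; rewrite /F !patchE.
  rewrite mem_set//=; case: ifPn => //; rewrite notin_setE => nK.
  by rewrite v'C ?mul0r// => -[].
have mPt : measurable_fun K (fun x => Phi (x, t)).
  have mPS : measurable_fun (setT : set ER) (Phi \_ (strip T)).
    exact/(measurable_restrictT _ _).1.
  have := measurable_funS measurableT (@subsetT _ K) (measurableT_comp mPS (pair2_measurable t)).
  by apply: eq_measurable_fun => x _; rewrite /= patchE mem_set.
rewrite GE.
have mv't : measurable_fun K (fun x => v' (x, t)).
  exact: measurable_funS (measurableT_comp mv' (pair2_measurable t)).
apply: le_trans (product_difference_le mK it' ig0 mPt _ _ _) _.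
- exact: measurable_funS mPhi0.
- by move=> x _; apply: PC; rewrite /= tT ltW.
- by move=> x _; apply: PL.
have dq : (\int[mu]_(x in K) (`|v' (x, t) - g0 x| `^ q)%:E <= e1%:E)%E.
  apply: le_trans (wr1 t _ _); last 2 first.
  - by rewrite !ltW.
  - by rewrite subr0 gtr0_norm.
  rewrite le_eqVlt; apply/orP; left; apply/eqP; apply/esym.
  apply: ae_integral => //.
    by apply: measurable_EFin; apply: measurable_norm_powR; exact: measurable_funB.
  have vv := ae_imply2 (fun t P Q => conj P Q) vt vwt.
  move: vv wg0; apply: ae_imply2 => x [H1 H2] H3 Kx.
  by rewrite -(H2 Kx) (H1 Kx) (H3 Kx).
have i1 : \int[mu]_(x in K) `|v' (x, t) - g0 x| <= de * m + c * e1.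
  have mB : measurable_fun K (fun x => v' (x, t) - g0 x) by exact: measurable_funB.
  have iB : mu.-integrable K (EFin \o (fun x => v' (x, t) - g0 x)).
    exact: (integrableB mK it' ig0).
  have ifn := integrable_fin_num mK (integrable_norm iB).
  rewrite -lee_fin /Rintegral fineK//.
  apply: le_trans (integral_norm_le_powR mK Koo q1 de0 mB) _.
  rewrite [X in (_ * X + _ <= _)%E](_ : _ = m%:E); last exact: mE.
  rewrite (_ : (de * m + c * e1)%:E = de%:E * m%:E + c%:E * e1%:E)%E; last by [].
  by apply: leeD => //; rewrite lee_pmul2l.
apply: (@le_trans _ _ (C * (de * m + c * e1) + L * t * I0)).
  by rewrite lerD2r ler_wpM2l.
have frac y : 0 <= y -> e / (3 * (y + 1)) * y <= e / 3.
  move=> y0; have y1 : 0 < y + 1 by rewrite ltr_wpDl.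
  rewrite (_ : _ * y = e / 3 * (y / (y + 1))); last by field; rewrite gt_eqF.
  by rewrite ler_piMr ?divr_ge0 ?(ltW e0)// ler_pdivrMr// mul1r lerDl.
have b1 := frac (C * m) (mulr_ge0 C0 m0).
have b2 := frac (C * c) (mulr_ge0 C0 (ltW c0)).
have b3 := frac (L * I0) (mulr_ge0 L0 I00).
have b4 : L * t * I0 <= r2 * (L * I0).
  by rewrite mulrAC mulrC ler_wpM2r ?mulr_ge0// ltW.
rewrite -/de in b1; rewrite -/e1 in b2; rewrite -/r2 in b3.
lra.
Qed.

End initial_trace.

(** * Extension by zero *)

Section compactly_supported.
Context {R : realType} {N : nat}.
Notation E := 'rV[R]_N.
Notation lam := (@lebesgue_measure R).

Lemma continuous_compact_bounded {X : topologicalType} (A : set X) (f : X -> R) :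
  compact A -> {within A, continuous f} -> exists2 C, 0 <= C & forall x, A x -> `|f x| <= C.
Proof.
move=> cA cf; have /compact_bounded[M [_ HM]] := continuous_compact cf cA.
exists (`|M| + 1); first by rewrite addr_ge0.
move=> x Ax; apply: HM; last by exists x.
by rewrite (le_lt_trans (ler_norm M))// ltrDl.
Qed.

Lemma iter_derive0 {V : normedModType R} (U F : set V) (f : V -> R) vs x :
  open U -> closed F -> (forall x, U x -> ~ F x -> f x = 0) -> U x -> ~ F x ->
  iter_derive vs f x = 0.
Proof.
move=> oU cF f0 Ux Fx.
have H : forall vs, iter_derive vs (cst 0 : V -> R) = cst 0.
  by elim=> //= v vs' ->; apply/funext => y; exact: derive_cst.
rewrite (@eq_iter_derive _ _ (U `&` ~` F) f (cst 0)) ?H//.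
  by apply: openI => //; exact: closed_openC.
by move=> y [Uy Fy]; exact: f0.
Qed.

(** [K] is the spatial projection of the support and [tau] the latest time in it, attained by
    compactness; for an empty support tau = 0 serves because T > 0. *)
Lemma test_function_smooth_bounded (Om : set E) (T : R) psi : 0 < T ->
  test_function (cylinder Om T) psi ->
  exists K tau, [/\ compact K, K `<=` Om, tau < T & smooth_bounded K tau psi].
Proof.
move=> T0 [smp cS SC]; set S := support_in setT psi in cS SC.
have clS : closed S by exact: closed_closure.
have psi0 z : ~ S z -> psi z = 0.
  by move=> nS; apply: contrapT => /eqP h; apply: nS; exact: subset_closure.
have [tau tauT Stau] : exists2 tau, tau < T & forall z, S z -> z.2 <= tau.
  have [->|/set0P S0] := eqVneq S set0; first by exists 0.
  have c2 : {within S, continuous (snd : E * R -> R)}.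
    by apply: continuous_subspaceT => z; exact: cvg_snd.
  have [c Sc cP] := compact_EVT_max S0 cS c2.
  exists c.2; first by have /SC[_] := set_mem Sc; rewrite /= in_itv/= => /andP[].
  by move=> z Sz; apply: cP; exact: mem_set.
exists (fst @` S), tau; split => //.
- apply: continuous_compact => //.
  by apply: continuous_subspaceT => z; exact: cvg_fst.
- by move=> x [z /SC[Oz _] <-].
- split.
  + by move=> vs z _; exact: smp.
  + move=> z _ nz; apply: psi0 => Sz; apply: nz; split; first by exists z.
    exact: Stau.
  + move=> vs.
    have cvs : {within S, continuous (iter_derive vs psi)}.
      by apply: continuous_subspaceT => z; have [] := smp vs z I.
    have [C C0 HC] := continuous_compact_bounded cS cvs.
    exists C => z _; have [/HC//|nS] := pselect (S z).
    rewrite (@iter_derive0 _ setT S psi vs z)// ?normr0//; first exact: openT.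
    by move=> y _; exact: psi0.
Qed.

Variables (Om K : set E) (T tau : R) (phi : E * R -> R).
Hypotheses (oOm : open Om) (cK : compact K) (KOm : K `<=` Om) (tauT : 0 < tau < T).
Hypothesis phi_smooth : smooth_closed_cylinder Om T phi.
Hypothesis phi_supp : support_in (closed_cylinder Om T) phi `<=` K `*` `[0, tau].

Lemma open_cylinder : open (cylinder Om T).
Proof.
rewrite (_ : cylinder Om T = (fst @^-1` Om) `&` (snd @^-1` `]0, T[%classic))//.
apply: openI; apply: open_comp => //; try exact: itv_open.
- by move=> z _; exact: cvg_fst.
- by move=> z _; exact: cvg_snd.
Qed.

Let phi0 : E * R -> R := phi \_ (cylinder Om T).

Lemma zero_extensionE z : cylinder Om T z -> phi0 z = phi z.
Proof. by move=> Cz; rewrite /phi0 patchE mem_set. Qed.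

Lemma closed_cylinder_support z : closed_cylinder Om T z ->
  ~ (K `*` `[0, tau]) z -> phi z = 0.
Proof.
move=> Cz nz; apply: contrapT => /eqP h; apply: nz; apply: phi_supp.
exact: subset_closure.
Qed.

(** On t > 0 the extension agrees with [phi] near the closed set [F], which there lies inside the
    open cylinder, and is 0 off [F]. Derivatives are bounded because each extends continuously to
    the compact set [K x [0, tau]]. *)
Lemma zero_extension_bounded : smooth_bounded K tau phi0.
Proof.
have /andP[tau0 tT] := tauT.
have [sphi cphi gphi] := phi_smooth.
have clK : closed K by apply: compact_closed cK; exact: norm_hausdorff.
have cF := closed_shadow (tau := tau) clK.
set F := [set z : E * R | _] in cF.
have z0 z : upper z -> ~ F z -> phi0 z = 0.
  move=> Uz nF; rewrite /phi0 patchE; case: ifPn => // /set_mem Cz.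
  apply: closed_cylinder_support.
    case: Cz => Oz; rewrite /= in_itv/= => /andP[a b]; split => //=.
    by rewrite in_itv/= !ltW.
  by move=> [Kz]; rewrite /= in_itv/= => /andP[_ zt]; apply: nF.
have FC z : upper z -> F z -> cylinder Om T z.
  move=> Uz [Kz zt]; split; first exact: KOm.
  by rewrite /= in_itv/= Uz (le_lt_trans zt).
split => //.
- move=> vs z Uz; have [Fz|nF] := pselect (F z).
    apply: (smooth_on_eq open_cylinder (f := phi)) => //; last exact: FC.
    by move=> y Cy; rewrite zero_extensionE.
  have oW : open (upper `&` ~` F) by apply: openI; [exact: open_upper|exact: closed_openC].
  apply: (smooth_on_eq oW (f := cst 0)) => //; last exact: smooth_on_cst0.
  by move=> y [Uy nFy]; rewrite z0.
- move=> vs; have [g cg gE] := gphi vs.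
  have cKt : compact (K `*` `[0, tau]%classic).
    by apply: compact_setX => //; exact: segment_compact.
  have KC : K `*` `[0, tau]%classic `<=` closed_cylinder Om T.
    move=> z [Kz]; rewrite /= in_itv/= => /andP[a b]; split; first exact: KOm.
    by rewrite /= in_itv/= a (le_trans b)// ltW.
  have [C C0 HC] := continuous_compact_bounded cKt (continuous_subspaceW KC cg).
  exists C => z Uz; have [Fz|nF] := pselect (F z); last first.
    by rewrite (iter_derive0 vs open_upper cF z0)// normr0.
  have Cz := FC z Uz Fz.
  rewrite (eq_iter_derive open_cylinder (g := phi))//; last by move=> y Cy; rewrite zero_extensionE.
  rewrite -gE; last exact: mem_set.
  by apply: HC; case: Fz => Kz zt; split => //=; rewrite in_itv/= zt ltW.
Qed.

Lemma grad_zero_extension z : cylinder Om T z -> grad phi0 z = grad phi z.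
Proof.
move=> Cz; apply/rowP => i; rewrite !mxE.
by apply: (eq_iter_derive open_cylinder zero_extensionE [:: _]).
Qed.

Lemma tmoll_bar_future_avg h x : 0 < h -> Om x ->
  tmoll_bar T h phi (x, 0) = future_avg T h phi0 (x, 0).
Proof.
move=> h0 Ox; have /andP[tau0 tT] := tauT.
have T0 : 0 < T by exact: lt_trans tT.
have sb := zero_extension_bounded.
pose F (r : R) := h^-1 * expR (- r / h) * phi0 (x, 0 + r).
have iF : lam.-integrable `]0, T]%classic (EFin \o F).
  exact: (integrable_future_integrand T0 h0 sb (z := (x, 0)) (lexx 0)).
have FE s : `]0, T]%classic s -> expR ((0 - s) / h) * phi (x, s) = h * F s.
  rewrite /= in_itv/= => /andP[s0 sT].
  rewrite /F /= sub0r add0r -mulrA mulVKf ?gt_eqF//; congr (_ * _).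
  (* The endpoint s = T is in the range of integration but not in the open cylinder: [phi0] is 0
     there by construction, and [phi] because tau < T. *)
  have [sltT|Tles] := ltP s T.
    by rewrite zero_extensionE//; split => //=; rewrite in_itv/= s0.
  have sE : s = T by apply/eqP; rewrite eq_le sT.
  rewrite closed_cylinder_support; last 2 first.
  - by split => //=; rewrite in_itv/= sT ltW.
  - by case=> _; rewrite /= in_itv/= sE [T <= tau]leNgt tT andbF.
  rewrite /phi0 patchE memNset// => -[_]; rewrite /= in_itv/= sE ltxx andbF//.
have mF : measurable_fun `]0, T]%classic F by have /integrableP[/measurable_EFinP] := iF.
(* The point s = 0 has to be removed: [phi0] is 0 there, while [phi] may be nonzero. *)
rewrite /tmoll_bar /= -Rintegral_itv_obnd_cbnd; last first.
  apply: eq_integrable (integrableZl _ h iF) => //.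
  by move=> s /set_mem sT /=; rewrite FE.
rewrite (@eq_Rintegral _ _ _ lam _ (fun s => h * F s)); last first.
  by move=> s /set_mem sT; rewrite FE.
by rewrite RintegralZl// mulrA mulVf ?mul1r// gt_eqF.
Qed.

Lemma future_avg_off_support h x : ~ K x -> future_avg T h phi0 (x, 0) = 0.
Proof.
move=> nK; rewrite /future_avg /Rintegral integral0_eq// => r.
rewrite /= in_itv/= => /andP[r0 _]; have [_ z0 _] := zero_extension_bounded.
by rewrite z0 ?mulr0// ?/upper/= ?add0r// => -[].
Qed.

End compactly_supported.

(** * Signed powers *)

Section spow_theory.
Context {R : realType}.
Implicit Types a b e q alpha : R.

Lemma powRD_le q a b : 0 < q -> 0 <= a -> 0 <= b ->
  (a + b) `^ q <= 2 `^ q * (a `^ q + b `^ q).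
Proof.
move=> q0; wlog ab : a b / a <= b.
  move=> H a0 b0; have [ab|/ltW ba] := leP a b; first exact: H.
  by rewrite addrC [_ `^ q + _]addrC; exact: H.
move=> a0 b0; apply: (@le_trans _ _ ((2 * b) `^ q)).
  by rewrite ge0_ler_powR ?nnegrE ?addr_ge0 ?mulr_ge0 ?(ltW q0)// mulrDl mul1r lerD2r.
by rewrite powRM// ler_wpM2l ?powR_ge0// lerDr powR_ge0.
Qed.

Lemma measurable_spow alpha : measurable_fun setT (spow alpha).
Proof.
apply: measurable_funM => //.
apply: (measurableT_comp (measurable_powR (alpha - 1))).
exact: normr_measurable.
Qed.

Lemma norm_spow alpha a : 0 < alpha -> `|spow alpha a| = `|a| `^ alpha.
Proof.
move=> al0; rewrite /spow normrM [`| _ `^ _|]ger0_norm ?powR_ge0//.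
have [->|a0] := eqVneq a 0.
  by rewrite normr0 mulr0 powR0// gt_eqF.
by rewrite -[X in _ * X]powRr1 ?normr_ge0// -powRD ?subrK// normr_eq0 a0 implybT.
Qed.

Lemma spowN alpha a : spow alpha (- a) = - spow alpha a.
Proof. by rewrite /spow normrN mulrN. Qed.

Lemma spow_ge0E alpha a : 0 < alpha -> 0 <= a -> spow alpha a = a `^ alpha.
Proof.
move=> al0 a0; rewrite -[a in RHS]ger0_norm// -norm_spow// ger0_norm//.
by rewrite /spow mulr_ge0// powR_ge0.
Qed.

(** This explains the exponent (alpha + 1) / alpha: it is the integrability of the signed power of a
    function in L^(alpha+1). *)
Lemma powR_norm_spow alpha a : 0 < alpha ->
  `|spow alpha a| `^ ((alpha + 1) / alpha) = `|a| `^ (alpha + 1).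
Proof.
by move=> al0; rewrite norm_spow// -powRrM mulrCA mulfV ?mulr1// gt_eqF.
Qed.

Lemma powR_le1D (a b q : R) : 0 <= b <= q -> `|a| `^ b <= 1 + `|a| `^ q.
Proof.
move=> /andP[b0 bq]; have [a1|a1] := leP `|a| 1.
  rewrite (le_trans (_ : _ <= 1))// ?lerDl ?powR_ge0//.
  by rewrite (le_trans (ge0_ler_powR b0 _ _ a1)) ?nnegrE// powR1.
by rewrite (le_trans (_ : _ <= `|a| `^ q)) ?lerDr// ler_powR// ltW.
Qed.

(* Both sides scale as the power alpha + 1, so it suffices to compare
   b / a with a threshold close to 1. *)
Lemma powR_sub_le alpha e : 0 < alpha -> 0 < e -> exists2 C, 0 <= C &
  forall a b, 0 <= b -> b <= a ->
  (a `^ alpha - b `^ alpha) `^ ((alpha + 1) / alpha) <=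
  e * a `^ (alpha + 1) + C * (a - b) `^ (alpha + 1).
Proof.
move=> al0 e0; set q := (alpha + 1) / alpha.
have al1 : 0 < alpha + 1 by rewrite addr_gt0.
have q0 : 0 < q by rewrite divr_gt0.
have alq : alpha * q = alpha + 1 by rewrite /q mulrCA mulfV ?mulr1// gt_eqF.
(* [e1] satisfies e1^q <= e, and the cap 1/2 keeps 1 - e1 positive. The threshold [th] below has
   th^alpha = 1 - e1, so for b > th a the difference of the powers is at most e1 a^alpha. *)
pose e1 := Num.min (e `^ q^-1) (1 / 2).
have e10 : 0 < e1 by rewrite lt_min powR_gt0//= divr_gt0.
have e1h : e1 <= 1 / 2 by rewrite ge_min lexx orbT.
have e11 : e1 < 1 by lra.
have e1e : e1 `^ q <= e.
  have eE : e = (e `^ q^-1) `^ q by rewrite -powRrM mulVf ?gt_eqF// powRr1// ltW.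
  rewrite [leRHS]eE.
  by rewrite ge0_ler_powR ?nnegrE ?powR_ge0 ?(ltW e10) ?(ltW q0)// ge_min lexx.
pose th := (1 - e1) `^ alpha^-1.
have th0 : 0 <= th by exact: powR_ge0.
have tha : th `^ alpha = 1 - e1.
  by rewrite /th -powRrM mulVf ?gt_eqF// powRr1// subr_ge0 ltW.
have th1 : th < 1.
  rewrite ltNge; apply/negP => th1.
  have : 1 `^ alpha <= th `^ alpha by rewrite ge0_ler_powR ?nnegrE ?(ltW al0).
  by rewrite powR1 tha; lra.
have d0 : 0 < 1 - th by rewrite subr_gt0.
(* For b <= th a one has a <= (a - b) / (1 - th), whence this constant. *)
exists ((1 - th) `^ (alpha + 1))^-1; first by rewrite invr_ge0 powR_ge0.
move=> a b b0 ba; have a0 : 0 <= a by exact: le_trans ba.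
have ab : b `^ alpha <= a `^ alpha by rewrite ge0_ler_powR ?nnegrE ?(ltW al0).
have [bth|thb] := leP b (th * a).
- apply: (@le_trans _ _ (a `^ (alpha + 1))).
    rewrite -alq powRrM ge0_ler_powR ?nnegrE ?powR_ge0 ?subr_ge0 ?(ltW q0)//.
    by rewrite gerBl powR_ge0.
  rewrite -[leLHS]add0r lerD//; first by rewrite mulr_ge0 ?powR_ge0// ltW.
  rewrite mulrC ler_pdivlMr ?powR_gt0// -powRM ?(ltW d0)//.
  rewrite ge0_ler_powR ?nnegrE ?mulr_ge0 ?subr_ge0 ?(ltW th1) ?(ltW al1)//.
  by rewrite mulrBr mulr1 lerB// mulrC.
- rewrite -[leLHS]addr0 lerD ?mulr_ge0 ?invr_ge0 ?powR_ge0//.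
  apply: (@le_trans _ _ ((e1 * a `^ alpha) `^ q)).
    rewrite ge0_ler_powR ?nnegrE ?subr_ge0 ?(ltW q0) ?mulr_ge0 ?powR_ge0 ?(ltW e10)//.
    rewrite lerBlDr -lerBlDl -{1}[a `^ alpha]mul1r -mulrBl -tha -powRM//.
    by rewrite ge0_ler_powR ?nnegrE ?mulr_ge0 ?(ltW al0) ?(ltW thb).
  by rewrite powRM ?powR_ge0 ?(ltW e10)// -powRrM alq ler_wpM2r ?powR_ge0.
Qed.

(** For equal signs this is the inequality for powers. For opposite signs |a| and |b| are both at
    most |a - b|, which accounts for the summand 2^q in the constant. *)
Lemma spow_sub_le alpha e : 0 < alpha -> 0 < e -> exists2 C, 0 <= C &
  forall a b, `|spow alpha a - spow alpha b| `^ ((alpha + 1) / alpha) <=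
    e * (`|a| `^ (alpha + 1) + `|b| `^ (alpha + 1)) + C * `|a - b| `^ (alpha + 1).
Proof.
move=> al0 e0; have [C C0 CP] := powR_sub_le al0 e0.
set q := (alpha + 1) / alpha in CP *.
have al1 : 0 < alpha + 1 by rewrite addr_gt0.
have q0 : 0 < q by rewrite divr_gt0.
have alq : alpha * q = alpha + 1 by rewrite /q mulrCA mulfV ?mulr1// gt_eqF.
have C'0 : 0 <= C + 2 `^ q by rewrite addr_ge0// powR_ge0.
exists (C + 2 `^ q) => // a b.
wlog a0 : a b / 0 <= a.
  move=> H; have [/H//|/ltW a0] := leP 0 a.
  have := H (- a) (- b); rewrite oppr_ge0 => /(_ a0).
  by rewrite !spowN !normrN -!opprD !normrN.
have [b0|/ltW b0] := leP 0 b.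
- wlog ba : a b a0 b0 / b <= a.
    move=> H; have [/H->//|/ltW ab] := leP b a.
    by rewrite distrC [`|a - b|]distrC [X in e * X]addrC; exact: H.
  have ab : b `^ alpha <= a `^ alpha by rewrite ge0_ler_powR ?nnegrE ?(ltW al0).
  rewrite !spow_ge0E// !ger0_norm ?subr_ge0//.
  apply: le_trans (CP a b b0 ba) _; rewrite lerD//.
    by rewrite ler_wpM2l ?(ltW e0)// lerDl powR_ge0.
  by rewrite ler_wpM2r ?powR_ge0// lerDl powR_ge0.
- have nb0 : 0 <= - b by rewrite oppr_ge0.
  rewrite -[leLHS]add0r lerD ?mulr_ge0 ?addr_ge0 ?powR_ge0 ?(ltW e0)//.
  apply: (@le_trans _ _ (2 `^ q * `|a - b| `^ (alpha + 1))); last first.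
    by rewrite ler_wpM2r ?powR_ge0// lerDr.
  rewrite -alq powRrM -powRM ?powR_ge0//.
  have -> : spow alpha b = - spow alpha (- b) by rewrite spowN opprK.
  rewrite opprK !spow_ge0E//.
  rewrite ge0_ler_powR ?(ltW q0) ?nnegrE ?mulr_ge0 ?powR_ge0//.
  rewrite ger0_norm ?addr_ge0 ?powR_ge0// ger0_norm; last by rewrite addr_ge0.
  rewrite [2]/(1 + 1 : R) mulrDl !mul1r.
  by rewrite lerD// ge0_ler_powR ?nnegrE ?addr_ge0 ?(ltW al0)// ?lerDl ?lerDr.
Qed.

End spow_theory.

(** * Continuous representatives *)

Section continuous_representatives.
Context {R : realType} {N : nat}.
Notation E := 'rV[R]_N.
Notation mu := (lebesgueN R N).
Notation lam := (@lebesgue_measure R).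
Notation nu := (lebesgueNT R N).
Notation ER := (E * measurableTypeR R)%type.

Lemma ae_eq_integral_powR {d} {X : measurableType d} (m : {measure set X -> \bar R})
    (D : set X) (f g : X -> R) q :
  measurable D -> measurable_fun D g -> f = g %[ae m in D] ->
  (\int[m]_(x in D) (`|f x| `^ q)%:E = \int[m]_(x in D) (`|g x| `^ q)%:E)%E.
Proof.
move=> mD mg fg; apply: ae_integral => //.
  exact: measurable_EFin (measurable_norm_powR q mg).
by move: fg; apply: ae_imply => x H Dx; rewrite H.
Qed.

Lemma Lp_on_L1 {d} {X : measurableType d} (m : {measure set X -> \bar R})
    (D : set X) (f : X -> R) q :
  measurable D -> (m D < +oo)%E -> 1 <= q -> Lp_on m D q f ->
  ae_measurable m D f /\ (\int[m]_(x in D) `|(f x)%:E| < +oo)%E.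
Proof.
move=> mD Doo q1 [[g mg fg] foo]; split; first by exists g.
have q0 : 0 < q by exact: lt_le_trans q1.
move/(finite_norm_patch m D f q0) : foo; rewrite (ae_eq_integral_powR q mD mg fg) => goo.
have /integrableP[_] := integrable_powR mD Doo q1 mg goo.
apply: le_lt_trans; rewrite le_eqVlt; apply/orP; left; apply/eqP.
apply: ae_integral => //; first by apply: measurableT_comp => //; exact: measurable_EFin.
by move: fg; apply: ae_imply => x H Dx; rewrite H.
Qed.

(** A Borel representative is chosen for each t separately; the three conditions see [w t] only up
    to null sets of [D]. *)
Lemma continuous_rep_measurable (D : set E) (T q : R) v w : measurable D -> 0 < q ->
  continuous_rep D T q v w ->
  exists2 g : R -> E -> R, (forall t, `[0, T]%classic t -> measurable_fun D (g t)) &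
    continuous_rep D T q v g.
Proof.
move=> mD q0 [wL wc vw].
have H t : exists g : E -> R, `[0, T]%classic t ->
    measurable_fun D g /\ w t = g %[ae mu in D].
  have [tT|ntT] := pselect (`[0, T]%classic t); last by exists (cst 0).
  by have [[g mg wg] _] := wL t tT; exists g.
have [g gP] := choice H; exists g; first by move=> t /gP[].
split.
- move=> t tT; have [mg wg] := gP t tT; have [_ woo] := wL t tT; split.
    by exists (g t) => //; exact: aeW.
  apply/(finite_norm_patch mu D (g t) q0); rewrite -(ae_eq_integral_powR q mD mg wg).
  exact/(finite_norm_patch mu D (w t) q0).
- move=> t0 t0T; apply/(Lnorm_continuousP D T t0 g q0) => e e0.
  have [r r0 rP] := (Lnorm_continuousP D T t0 w q0).1 (wc t0 t0T) e e0.
  exists r; first exact: r0.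
  move=> t tT tr; have tT' : `[0, T]%classic t by rewrite /= in_itv.
  have [mg wg] := gP t tT'; have [mg0 wg0] := gP t0 t0T.
  have wgt : (fun x => w t x - w t0 x) = (fun x => g t x - g t0 x) %[ae mu in D].
    by move: wg wg0; apply: ae_imply2 => x H1 H2 Dx; rewrite H1// H2.
  have <- := ae_eq_integral_powR q mD (measurable_funB mg mg0) wgt.
  exact: rP.
- move: vw; apply: ae_imply => t vw tT.
  have tT' : `[0, T]%classic t by move: tT; rewrite /= !in_itv/= => /andP[a b]; rewrite !ltW.
  have [mg wg] := gP t tT'.
  by move: (vw tT) wg; apply: ae_imply2 => x H1 H2 Dx; rewrite H1// H2.
Qed.

Lemma integral_powRD_le {d} {X : measurableType d} (m : {measure set X -> \bar R})
    (D : set X) (f g : X -> R) q : measurable D -> 0 < q ->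
  measurable_fun D f -> measurable_fun D g ->
  (\int[m]_(x in D) (`|f x| `^ q)%:E <= (2 `^ q)%:E *
    (\int[m]_(x in D) (`|f x - g x| `^ q)%:E + \int[m]_(x in D) (`|g x| `^ q)%:E))%E.
Proof.
move=> mD q0 mf mg.
have mfg : measurable_fun D (fun x => f x - g x) by exact: measurable_funB.
have m1 := measurable_EFin (measurable_norm_powR q mfg).
have m2 := measurable_EFin (measurable_norm_powR q mg).
rewrite -ge0_integralD//= -ge0_integralZl//=; last 2 first.
- exact: emeasurable_funD.
- by move=> x _; rewrite -EFinD lee_fin addr_ge0 ?powR_ge0.
apply: ge0_le_integral => //.
- exact: measurable_EFin (measurable_norm_powR q mf).
- by apply: emeasurable_funM => //; exact: emeasurable_funD.
- move=> x _; rewrite -EFinD -EFinM lee_fin.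
  apply: le_trans (powRD_le q0 (normr_ge0 _) (normr_ge0 _)).
  rewrite ge0_ler_powR ?nnegrE ?addr_ge0 ?(ltW q0)//.
  by rewrite -{1}[f x](subrK (g x)) ler_normD.
Qed.

(** Continuity bounds the integral near each t through the quasi-triangle inequality for q-th
    powers, and compactness of [0, T] makes the bound uniform. *)
Lemma continuous_rep_bounded (D : set E) (T q : R) v g : measurable D -> 0 < q ->
  (forall t, `[0, T]%classic t -> measurable_fun D (g t)) ->
  continuous_rep D T q v g ->
  exists2 M, 0 <= M & forall t, `[0, T]%classic t ->
    (\int[mu]_(x in D) (`|g t x| `^ q)%:E <= M%:E)%E.
Proof.
move=> mD q0 mg [gL gc _].
have /compact_near_coveringP := @segment_compact R 0 T.
move=> /(_ R +oo (fun M t => `[0, T]%classic t ->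
  (\int[mu]_(x in D) (`|g t x| `^ q)%:E <= M%:E)%E) _) [].
  move=> t tT.
  have [r r0 rP] := (Lnorm_continuousP D T t g q0).1 (gc t tT) 1 ltr01.
  have [_ /(finite_norm_patch mu D (g t) q0) goo] := gL t tT.
  pose M0 := 2 `^ q * (1 + fine (\int[mu]_(x in D) (`|g t x| `^ q)%:E)%E).
  exists (ball t r, [set M | M0 <= M]) => /=.
    split; first exact: nbhsx_ballx.
    by exists M0; split; [exact: num_real|move=> x; exact: ltW].
  move=> [s M] /= [+ M0M]; rewrite /ball/= distrC => sr sT.
  apply: le_trans (_ : M0%:E <= _)%E; last by rewrite lee_fin.
  have := integral_powRD_le mu mD q0 (mg s sT) (mg t tT).
  move=> /le_trans; apply.
  rewrite /M0 EFinM lee_wpmul2l ?lee_fin ?powR_ge0// EFinD leeD//.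
    by apply: rP => //; move: sT; rewrite /= in_itv.
  rewrite fineK// ge0_fin_numE//; apply: integral_ge0 => x _.
  by rewrite lee_fin powR_ge0.
move=> M [_ HM]; exists (`|M| + 1); first by rewrite addr_ge0.
move=> t tT; apply: HM => //.
by rewrite (le_lt_trans (ler_norm M))// ltrDl.
Qed.

(** The signed power is continuous from L^(alpha+1) to L^((alpha+1)/alpha): in [spow_sub_le] the
    term with the small factor is controlled by the uniform bound on [g], the term with [C] by the
    continuity of [g]. *)
Lemma continuous_rep_spow (D K : set E) (T alpha : R) u g :
  measurable K -> K `<=` D -> measurable D -> 0 < alpha ->
  (forall t, `[0, T]%classic t -> measurable_fun D (g t)) ->
  continuous_rep D T (alpha + 1) u g ->
  continuous_rep K T ((alpha + 1) / alpha) (fun z => spow alpha (u z))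
    (fun t x => spow alpha (g t x)).
Proof.
move=> mK KD mD al0 mg crep; have [gL gc ug] := crep.
have al1 : 0 < alpha + 1 by rewrite addr_gt0.
have q0 : 0 < (alpha + 1) / alpha by rewrite divr_gt0.
have [M M0 HM] := continuous_rep_bounded mD al1 mg crep.
have mgK t : `[0, T]%classic t -> measurable_fun K (g t).
  by move=> tT; exact: measurable_funS (mg t tT).
have HMK t : `[0, T]%classic t ->
    (\int[mu]_(x in K) (`|g t x| `^ (alpha + 1))%:E <= M%:E)%E.
  move=> tT; apply: le_trans (HM t tT); apply: ge0_subset_integral => //.
  - exact: measurable_EFin (measurable_norm_powR _ (mg t tT)).
split.
- move=> t tT; split.
    exists (fun x => spow alpha (g t x)); last exact: aeW.
    exact: measurableT_comp (measurable_spow alpha) (mgK t tT).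
  apply/(finite_norm_patch mu K (fun x => spow alpha (g t x)) q0).
  under eq_integral do rewrite powR_norm_spow//.
  exact: le_lt_trans (HMK t tT) (ltry _).
- move=> t0 t0T; apply/(Lnorm_continuousP K T t0 (fun t x => spow alpha (g t x)) q0) => e e0.
  (* The integrals of |g t|^(alpha+1) and |g t0|^(alpha+1) are at most M each, so this choice spends
     e/2 on them. It fixes [C], and the radius [r] is then taken so that the term with [C] costs at
     most e/2. *)
  pose e1 := e / (2 * (2 * M + 1)).
  have M1 : 0 < 2 * M + 1 by rewrite ltr_wpDl// mulr_ge0.
  have e10 : 0 < e1 by rewrite divr_gt0// mulr_gt0.
  have [C C0 HC] := spow_sub_le al0 e10.
  have C1 : 0 < C + 1 by rewrite ltr_wpDl.
  have [r r0 rP] := (Lnorm_continuousP D T t0 g al1).1 (gc t0 t0T) (e / (2 * (C + 1)))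
    (divr_gt0 e0 (mulr_gt0 (ltr0Sn _ _) C1)).
  exists r; first exact: r0.
  move=> t tT tr; have tT' : `[0, T]%classic t by rewrite /= in_itv.
  have mt := mgK t tT'; have mt0 := mgK t0 t0T.
  have p1 := measurable_norm_powR (alpha + 1) mt.
  have p2 := measurable_norm_powR (alpha + 1) mt0.
  have p3 := measurable_norm_powR (alpha + 1) (measurable_funB mt mt0).
  have ps : measurable_fun K (fun x => spow alpha (g t x) - spow alpha (g t0 x)).
    by apply: measurable_funB; exact: measurableT_comp (measurable_spow alpha) _.
  have I3 : (\int[mu]_(x in K) (`|g t x - g t0 x| `^ (alpha + 1))%:E <= (e / (2 * (C + 1)))%:E)%E.
    apply: le_trans (rP t tT tr); apply: ge0_subset_integral => //.
    apply: measurable_EFin; apply: measurable_norm_powR; apply: measurable_funB; exact: mg.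
  apply: (@le_trans _ _ (\int[mu]_(x in K) (e1%:E *
     ((`|g t x| `^ (alpha + 1))%:E + (`|g t0 x| `^ (alpha + 1))%:E) +
     C%:E * (`|g t x - g t0 x| `^ (alpha + 1))%:E))%E).
    apply: ge0_le_integral => //.
    + exact: measurable_EFin (measurable_norm_powR _ ps).
    + apply: emeasurable_funD; apply: emeasurable_funM => //.
        by apply: emeasurable_funD; exact: measurable_EFin.
      exact: measurable_EFin.
    + by move=> x _; rewrite -EFinD lee_fin; exact: HC.
  rewrite ge0_integralD//=; last 4 first.
  + by move=> x _; rewrite -EFinD -EFinM lee_fin mulr_ge0 ?addr_ge0 ?powR_ge0 ?(ltW e10).
  + by apply: emeasurable_funM => //; apply: emeasurable_funD; exact: measurable_EFin.
  + by move=> x _; rewrite -EFinM lee_fin mulr_ge0 ?powR_ge0.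
  + by apply: emeasurable_funM => //; exact: measurable_EFin.
  rewrite !ge0_integralZl//=; last 4 first.
  + exact: measurable_EFin.
  + by apply: emeasurable_funD; exact: measurable_EFin.
  + by move=> x _; rewrite -EFinD lee_fin addr_ge0 ?powR_ge0.
  + by rewrite lee_fin ltW.
  rewrite ge0_integralD//=; last 2 first.
  + exact: measurable_EFin.
  + exact: measurable_EFin.
  apply: (@le_trans _ _ (e1%:E * (M%:E + M%:E) + C%:E * (e / (2 * (C + 1)))%:E)%E).
    apply: leeD.
      by rewrite lee_wpmul2l ?lee_fin ?(ltW e10)// leeD// HMK.
    by rewrite lee_wpmul2l ?lee_fin.
  suff : e1 * (M + M) + C * (e / (2 * (C + 1))) <= e by rewrite -lee_fin.
  have frac y : 0 <= y -> e / (2 * (y + 1)) * y <= e / 2.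
    move=> y0; have y1 : 0 < y + 1 by rewrite ltr_wpDl.
    rewrite (_ : _ * y = e / 2 * (y / (y + 1))); last by field; rewrite gt_eqF.
    by rewrite ler_piMr ?divr_ge0 ?(ltW e0)// ler_pdivrMr// mul1r lerDl.
  have f1 := frac C C0; have := frac (2 * M) (mulr_ge0 (ler0n _ 2) M0).
  by rewrite -/e1 => f2; lra.
- move: ug; apply: ae_imply => t ut tT.
  by move: (ut tT); apply: ae_imply => x H Kx; rewrite H//; exact: KD.
Qed.

Lemma integrable_le_powR {d} {X : measurableType d} (m : {measure set X -> \bar R})
    (D : set X) (f g : X -> R) c q : measurable D -> (m D < +oo)%E -> 0 <= c ->
  measurable_fun D f -> measurable_fun D g ->
  (forall x, D x -> `|f x| <= c * (1 + `|g x| `^ q)) ->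
  (\int[m]_(x in D) (`|g x| `^ q)%:E < +oo)%E -> m.-integrable D (EFin \o f).
Proof.
move=> mD Doo c0 mf mg fg goo.
have mgq := measurable_EFin (measurable_norm_powR q mg).
have i1 : m.-integrable D (fun x => (`|g x| `^ q)%:E).
  apply/integrableP; split => //.
  by under eq_integral do rewrite gee0_abs ?lee_fin ?powR_ge0//.
have ic : m.-integrable D (cst 1%E).
  apply/integrableP; split => //.
  by under eq_integral do rewrite /= normr1; rewrite integral_cst// mul1e.
apply: le_integrable (integrableZl mD c (integrableD mD ic i1)) => //.
  exact: measurable_EFin.
move=> x Dx /=; rewrite lee_fin (le_trans (fg x Dx))//.
exact: ler_norm.
Qed.

(** Almost every slice of [u] coincides with a value of the representative, whose q-th power
    integrals are bounded by one [M]; the total is then at most M T. *)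
Lemma integral_powR_cylinder (D : set E) (T q : R) u w : measurable D -> 0 < q -> 0 < T ->
  measurable_fun (cylinder D T : set ER) u -> continuous_rep D T q u w ->
  (\int[nu]_(z in cylinder D T) (`|u z| `^ q)%:E < +oo)%E.
Proof.
move=> mD q0 T0 mu' crep0.
have [g mg crep] := continuous_rep_measurable mD q0 crep0.
have [M M0 HM] := continuous_rep_bounded mD q0 mg crep.
have mC := measurable_cylinder T mD.
have mI : measurable (`]0, T[%classic : set (measurableTypeR R)) by exact: measurable_itv.
pose F : E * R -> \bar R := (fun z => (`|u z| `^ q)%:E) \_ (cylinder D T).
have mF : measurable_fun (setT : set ER) F.
  apply/(measurable_restrictT _ _).1 => //.
  exact: measurable_EFin (measurable_norm_powR q mu').
have F0 z : (0 <= F z)%E.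
  by rewrite /F patchE; case: ifP => // _; rewrite lee_fin powR_ge0.
rewrite integral_mkcond (fubini_tonelli2 (m1 := mu) (m2 := lam) F mF F0).
have mG : measurable_fun setT (fubini_G mu F).
  exact: measurable_fun_fubini_tonelli_G.
have [_ _ ug] := crep.
pose H : measurableTypeR R -> \bar R := (fun=> M%:E) \_ `]0, T[%classic.
have Mae : {ae lam, forall t, setT t -> (fubini_G mu F t <= H t)%E}.
  move: ug; apply: ae_imply => t ut _; rewrite /H patchE; case: ifPn => [/set_mem tT|].
    have tT' : `[0, T]%classic t by move: tT; rewrite /= !in_itv/= => /andP[a b]; rewrite !ltW.
    apply: le_trans (HM t tT').
    rewrite -(ae_eq_integral_powR q mD (mg t tT') (ut tT)) /fubini_G.
    rewrite [leRHS]integral_mkcond; apply: ge0_le_integralT => [x|x]; first exact: F0.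
    rewrite /F !patchE; case: ifPn => [/set_mem[/= Dx _]|_].
      by rewrite mem_set.
    by case: ifPn => // _; rewrite lee_fin powR_ge0.
  rewrite notin_setE => ntT; rewrite /fubini_G integral0_eq// => x _.
  by rewrite /F patchE memNset// => -[].
apply: (@le_lt_trans _ _ (\int[lam]_t H t)%E).
  apply: ae_ge0_le_integral => //.
  - by move=> t _; apply: integral_ge0 => x _; exact: F0.
  - by move=> t _; rewrite /H patchE; case: ifP => //; rewrite lee_fin.
  - exact/(measurable_restrictT _ _).1.
rewrite /H -integral_mkcond integral_cst//= lebesgue_measure_itv/= lte_fin T0 -EFinB -EFinM.
exact: ltry.
Qed.

(** |u|^alpha <= 1 + |u|^(alpha+1), and the right-hand side is integrable on the cylinder by
    continuity in time. *)
Lemma spow_L1 (D : set E) (T alpha : R) u w : measurable D -> (mu D < +oo)%E ->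
  0 < T -> 0 < alpha -> ae_measurable nu (cylinder D T) u ->
  continuous_rep D T (alpha + 1) u w ->
  ae_measurable nu (cylinder D T) (fun z => spow alpha (u z)) /\
  (\int[nu]_(z in cylinder D T) `|(spow alpha (u z))%:E| < +oo)%E.
Proof.
move=> mD Doo T0 al0 [u' mu' uu'] [wL wc uw].
have al1 : 0 < alpha + 1 by rewrite addr_gt0.
have mC := measurable_cylinder T mD.
have crep : continuous_rep D T (alpha + 1) u' w.
  split => //; have := product_ae2 (m1 := mu) (m2 := lam) uu'.
  move: uw; apply: ae_imply2 => t uw uu tT; move: (uw tT) uu.
  by apply: ae_imply2 => x H1 H2 Dx; rewrite -H1// H2.
have foo := integral_powR_cylinder mD al1 T0 mu' crep.
have ms : measurable_fun (cylinder D T : set ER) (fun z => spow alpha (u' z)).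
  exact: measurableT_comp (measurable_spow alpha) mu'.
have vv : (fun z => spow alpha (u z)) = (fun z => spow alpha (u' z)) %[ae nu in cylinder D T].
  by move: uu'; apply: ae_imply => z H Cz; rewrite H.
split; first by exists (fun z => spow alpha (u' z)).
have : nu.-integrable (cylinder D T) (EFin \o (fun z => spow alpha (u' z))).
  apply: (@integrable_le_powR _ _ nu _ _ u' 1 (alpha + 1)) => //.
    exact: cylinder_volume.
  move=> z _; rewrite norm_spow// mul1r; apply: powR_le1D.
  by rewrite (ltW al0)/= lerDl.
move=> /integrableP[_]; apply: le_lt_trans.
rewrite (_ : integral _ _ _ = \int[nu]_(z in cylinder D T) `|(spow alpha (u' z))%:E|)%E//.
apply: ae_integral => //; first by apply: measurableT_comp => //; exact: measurable_EFin.
by move: vv; apply: ae_imply => z H Cz; rewrite H.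
Qed.

End continuous_representatives.

(** * Integrability of the vector field *)

Section vector_field.
Context {R : realType} {N : nat}.
Notation E := 'rV[R]_N.
Notation mu := (lebesgueN R N).
Notation nu := (lebesgueNT R N).
Notation ER := (E * measurableTypeR R)%type.

(** The growth is |A_i| <= Lambda |Du_i|^(p-1) <= Lambda (1 + |Du_i|^p), because truncation by
    [delta i >= 0] only decreases the modulus. *)
Lemma vfield_L1 (D : set E) (T p Lambda : R) (a : 'I_N -> E * R -> R)
    (delta : 'I_N -> R) (Du : E * R -> E) (i : 'I_N) :
  measurable D -> (mu D < +oo)%E -> 0 < T -> 1 < p -> 0 <= delta i -> 1 <= Lambda ->
  ae_measurable nu (cylinder D T) (a i) ->
  {ae nu, forall z, cylinder D T z -> Lambda^-1 <= a i z <= Lambda} ->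
  Lp_on nu (cylinder D T) p (fun z => Du z 0 i) ->
  ae_measurable nu (cylinder D T) (fun z => vfield a delta p z (Du z) 0 i) /\
  (\int[nu]_(z in cylinder D T) `|(vfield a delta p z (Du z) 0 i)%:E| < +oo)%E.
Proof.
move=> mD Doo T0 p1 de0 La1 [a' ma' aa'] aLa [[g mg gDu] Doop].
have p0 : 0 < p by lra.
have mC := measurable_cylinder T mD.
have La0 : 0 < Lambda by lra.
move/(finite_norm_patch nu _ (fun z => Du z 0 i) p0) : Doop.
rewrite (ae_eq_integral_powR p mC mg gDu) => goo.
(* Clipping the Borel representative of [a i] to [0, Lambda] makes the upper bound valid everywhere
   and changes nothing where the assumed bounds hold. *)
pose b z := Num.min (Num.max (a' z) 0) Lambda.
(* The inverse of |g| is written as a real power, whose measurability is available; at g = 0 the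
   factor g makes the product vanish, as in [vfield]. *)
pose A z := b z * Num.max (`|g z| - delta i) 0 `^ (p - 1) * (g z * `|g z| `^ (-1)).
have mb : measurable_fun (cylinder D T : set ER) b.
  by apply: measurable_minr => //; apply: measurable_maxr.
have mA : measurable_fun (cylinder D T : set ER) A.
  have mng : measurable_fun (cylinder D T : set ER) (fun z => `|g z|).
    exact: measurableT_comp.
  apply: measurable_funM; last first.
    by apply: measurable_funM => //; exact: measurableT_comp (measurable_powR (-1)) mng.
  apply: measurable_funM => //; apply: (measurableT_comp (measurable_powR (p - 1))).
  by apply: measurable_maxr => //; apply: measurable_funB.
have AE : (fun z => vfield a delta p z (Du z) 0 i) = A %[ae nu in cylinder D T].
  have aa := ae_imply2 (fun z P Q => conj P Q) aa' aLa.
  move: aa gDu; apply: ae_imply2 => z [H1 H2] H3 Cz.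
  rewrite /vfield mxE /A /b H3// -(H1 Cz) powR_inv1//.
  have /andP[La aL] := H2 Cz.
  have a0 : 0 <= a i z by apply: le_trans La; rewrite invr_ge0 ltW.
  by rewrite [Num.max (a i z) 0]max_l// min_l.
split; first by exists A.
have Ale z : `|A z| <= Lambda * (1 + `|g z| `^ p).
  have b0 : 0 <= b z <= Lambda.
    by rewrite /b ge_min lexx orbT andbT le_min le_max lexx orbT ltW.
  have /andP[b1 b2] := b0.
  rewrite /A -mulrA normrM ger0_norm// ler_pM//.
  rewrite normrM [X in X * _]ger0_norm ?powR_ge0//.
  apply: (@le_trans _ _ (`|g z| `^ (p - 1) * 1)).
    rewrite ler_pM ?powR_ge0//.
      rewrite ge0_ler_powR ?nnegrE ?subr_ge0 ?(ltW p1)//; first by rewrite le_max lexx orbT.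
      by rewrite ge_max normr_ge0 andbT lerBlDr lerDl.
    rewrite normrM [X in _ * X]ger0_norm ?powR_ge0// powR_inv1//.
    have [->|g0] := eqVneq (g z) 0; first by rewrite normr0 mul0r.
    by rewrite mulfV// normr_eq0.
  rewrite mulr1; apply: powR_le1D; lra.
have : nu.-integrable (cylinder D T) (EFin \o A).
  apply: (@integrable_le_powR _ _ _ nu _ _ g Lambda p) => //.
  - exact: cylinder_volume.
  - exact: ltW.
move=> /integrableP[_]; apply: le_lt_trans.
rewrite (_ : integral _ _ _ = \int[nu]_(z in cylinder D T) `|(A z)%:E|)%E//.
apply: ae_integral => //; first by apply: measurableT_comp => //; exact: measurable_EFin.
by move: AE; apply: ae_imply => z H Cz; rewrite H.
Qed.

End vector_field.

(** * The mollified equation *)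

Section mollified_equation.
Context {R : realType} {N : nat}.
Notation E := 'rV[R]_N.
Notation mu := (lebesgueN R N).
Notation lam := (@lebesgue_measure R).
Notation nu := (lebesgueNT R N).
Notation ER := (E * measurableTypeR R)%type.

Lemma measurable_compact_prod (C : set (E * R)) : compact C -> measurable (C : set ER).
Proof.
move=> cC; have clC : closed C by apply: compact_closed cC; exact: norm_hausdorff.
rewrite -[C]setCK; apply: measurableC; apply: open_rV_prod_measurable.
exact: closed_openC.
Qed.

Lemma ae_product_fst (P : E -> Prop) : {ae mu, forall x, P x} ->
  {ae nu, forall z, P z.1}.
Proof.
move=> [Z [mZ Z0 PZ]]; exists (Z `*` setT); split.
- exact: measurableX.
- rewrite [LHS](product_measure1E mu lam)//.
  by rewrite -[X in (X * _)%E]/(mu Z) Z0 mul0e.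
- by move=> z /= nP; split => //; exact: PZ.
Qed.

(** The value of [tmoll] at (x, t) depends on the slice over x, so equality is assumed on almost
    every slice; null sets of s then disappear in the integral. *)
Lemma tmoll_ae (K : set E) (T h : R) (v v' : E * R -> R) :
  measurable_fun (setT : set ER) v' ->
  {ae mu, forall x, K x ->
     {ae lam, forall s, `]0, T[%classic s -> v (x, s) = v' (x, s)}} ->
  tmoll h v = tmoll h v' %[ae nu in cylinder K T].
Proof.
move=> mv' /ae_product_fst; apply: ae_imply => -[x t] /= H [/= Kx].
rewrite in_itv/= => /andP[t0 tT]; rewrite /tmoll /=; congr (_ * _).
have mI : measurable (`[0, t]%classic : set (measurableTypeR R)) by exact: measurable_itv.
have mvx : measurable_fun setT (fun s : measurableTypeR R => v' (x, s)).
  exact: measurableT_comp mv' (pair1_measurable x).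
apply: ae_Rintegral => //.
  apply: measurable_funM; last exact: measurable_funS mvx.
  apply: measurable_funTS; apply: measurableT_comp => //.
  by apply: measurable_funM => //; apply: measurable_funB.
(* [tmoll] integrates over [0, t], whereas [v] and [v'] are compared on (0, T); the endpoint 0 is
   discarded as a null set. *)
have n0 : {ae lam, forall s, s != 0}.
  exists [set 0]; split => //; first exact: lebesgue_measure_set1.
  by move=> s /= /negP; rewrite negbK => /eqP.
move: (H Kx) n0; apply: ae_imply2 => s vs s0.
rewrite /= in_itv/= => /andP[s0' st]; rewrite vs//= in_itv/= (le_lt_trans st)// andbT.
by rewrite lt_neqAle eq_sym s0.
Qed.

(** Both integrals live on [K x (0, T)]. This exchanges the integrals of the statement for integrals
    of regular representatives over all of space, where the duality is formulated. *)
Lemma integral_cylinder_strip (Om K : set E) (T : R) (F F' : E * R -> R) :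
  measurable K -> K `<=` Om ->
  (forall z, cylinder Om T z -> ~ K z.1 -> F z = 0) ->
  (forall z, strip T z -> ~ K z.1 -> F' z = 0) ->
  measurable_fun (strip T : set ER) F' ->
  F = F' %[ae nu in cylinder K T] ->
  \int[nu]_(z in cylinder Om T) F z = \int[nu]_(z in strip T) F' z.
Proof.
move=> mK KOm F0 F'0 mF FF'.
have CS : cylinder K T `<=` strip T by move=> z [_]; rewrite /= in_itv.
have mC := measurable_cylinder T mK.
transitivity (\int[nu]_(z in cylinder K T) F z).
  rewrite Rintegral_mkcond [RHS]Rintegral_mkcond; apply: eq_Rintegral => z _.
  rewrite !patchE; case: ifPn => [/set_mem[Oz Tz]|].
    by have [Kz|nK] := pselect (K z.1); [rewrite mem_set|rewrite memNset ?F0// => -[]].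
  by rewrite notin_setE => nC; rewrite memNset// => -[Kz Tz]; apply: nC; split => //; exact: KOm.
rewrite (@ae_Rintegral _ _ _ nu _ _ F')//; last exact: (measurable_funS (measurable_strip T) CS mF).
rewrite Rintegral_mkcond [RHS]Rintegral_mkcond; apply: eq_Rintegral => z _.
rewrite !patchE; case: ifPn => [/set_mem Cz|]; first by rewrite mem_set//; exact: CS.
rewrite notin_setE => nC; case: ifPn => // /set_mem Sz; rewrite F'0// => Kz.
by apply: nC; split => //=; rewrite in_itv.
Qed.

Lemma measurable_smooth_bounded (K : set E) (tau T : R) g : smooth_bounded K tau g ->
  measurable_fun (strip T : set ER) g.
Proof. by move=> /(measurable_strip_patch T); move/(measurable_restrictT _ (measurable_strip T)).2. Qed.

Lemma integrable_mul_smooth (K : set E) (tau T : R) (f g : E * R -> R) :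
  smooth_bounded K tau g -> nu.-integrable (strip T) (EFin \o f) ->
  nu.-integrable (strip T) (EFin \o (fun z => f z * g z)).
Proof.
move=> ng intf; have [_ _ /(_ [::])[C gC]] := ng.
under eq_fun do rewrite mulrC.
apply: (@integrable_bounded_mul _ _ _ nu _ C) => //.
- exact: measurable_strip.
- exact: measurable_smooth_bounded ng.
- by move=> z /andP[z0 _]; exact: gC.
Qed.

Lemma time_regular_strip (T : R) v : time_regular T v -> nu.-integrable (strip T) (EFin \o v).
Proof. by move=> [_ iv _ _]; apply: integrableS iv => //; exact: measurable_strip. Qed.

Lemma integrable_dt_tmoll (T h : R) v : 0 < T -> 0 < h -> time_regular T v ->
  nu.-integrable (strip T) (EFin \o dt_tmoll h v).
Proof.
move=> T0 h0 rv; have mS := measurable_strip (N := N) T.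
have := integrableZl mS h^-1 (integrableB mS (time_regular_strip rv) (integrable_tmoll T0 h0 rv)).
by apply: eq_integrable => // z _ /=; rewrite /dt_tmoll mulrC.
Qed.

(** The left-hand side is the integral of v times (B g - g) / h; moving the average from [g] to [v]
    turns it into that of ([v]_h - v) g / h. *)
Lemma dt_tmoll_duality (K : set E) (T h tau : R) v g : 0 < T -> 0 < h -> closed K ->
  tau < T -> time_regular T v -> smooth_bounded K tau g ->
  \int[nu]_(z in strip T) (v z * future_avg T h (dt g) z) =
  - \int[nu]_(z in strip T) (dt_tmoll h v z * g z).
Proof.
move=> T0 h0 clK tauT rv ng; have mS := measurable_strip (N := N) T.
have nB := smooth_bounded_future_avg T0 h0 clK ng.
have iv := time_regular_strip rv.
have ivg := integrable_mul_smooth ng iv; have ivB := integrable_mul_smooth nB iv.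
have itg := integrable_mul_smooth ng (integrable_tmoll T0 h0 rv).
rewrite (@eq_Rintegral _ _ _ nu _ (fun z => h^-1 * (v z * future_avg T h g z - v z * g z))); last first.
  move=> z /set_mem/andP[z0 _].
  have -> : future_avg T h (dt g) z = (future_avg T h g z - g z) / h.
    exact: (future_avg_dt T0 h0 clK tauT ng).
  by ring.
rewrite RintegralZl//; last exact: (integrableB mS ivB ivg).
rewrite RintegralB// -(tmoll_future_avg_duality T0 h0 tauT rv ng).
rewrite [in RHS](@eq_Rintegral _ _ _ nu _ (fun z => h^-1 * (v z * g z - tmoll h v z * g z))); last first.
  by move=> z _; rewrite /dt_tmoll -mulrBl mulrA [h^-1 * _]mulrC.
rewrite [in RHS]RintegralZl//; last exact: (integrableB mS ivg itg).
by rewrite RintegralB// -mulrN opprB.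
Qed.

Lemma Rintegral_sum {d} {X : measurableType d} (m : {measure set X -> \bar R})
    (D : set X) (I : Type) (r : seq I) (F : I -> X -> R) : measurable D ->
  (forall i, m.-integrable D (EFin \o F i)) ->
  m.-integrable D (EFin \o (fun x => \sum_(i <- r) F i x)) /\
  \int[m]_(x in D) (\sum_(i <- r) F i x) = \sum_(i <- r) \int[m]_(x in D) F i x.
Proof.
move=> mD iF; elim: r => [|i r [IHi IH]].
  under eq_fun do rewrite big_nil; split; first exact: integrable0.
  by rewrite big_nil Rintegral_cst// mul0r.
under eq_fun do rewrite big_cons; split; first exact: (integrableD mD (iF i) IHi).
by rewrite big_cons RintegralD// IH.
Qed.

Lemma L1loc_of_strip (Om : set E) (T : R) f f' : measurable_fun (strip T : set ER) f' ->
  nu.-integrable (strip T) (EFin \o f') ->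
  f = f' %[ae nu in cylinder Om T] -> L1loc (cylinder Om T) f.
Proof.
move=> mf' if' ff' C cC COm; have mC := measurable_compact_prod cC.
have CS : C `<=` strip T by move=> z /COm[_]; rewrite /= in_itv.
have mf'C : measurable_fun (C : set ER) f' by exact: (measurable_funS (measurable_strip T) CS mf').
have ffC : f = f' %[ae nu in C].
  by move: ff'; apply: ae_imply => z H Cz; apply: H; exact: COm.
split; first by exists f'.
apply/(finite_norm_patch nu C f ltr01); rewrite (ae_eq_integral_powR 1 mC mf'C ffC).
have /integrableP[_] : nu.-integrable C (EFin \o f') by exact: (integrableS (measurable_strip T) mC CS if').
by under [X in (X < _)%E -> _]eq_integral do rewrite /= -[`|_|]powRr1//.
Qed.

Lemma weak_dt_tmoll (Om : set E) (T h : R) (v : E * R -> R) :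
  open Om -> 0 < T -> 0 < h -> ae_measurable nu (cylinder Om T) v ->
  (\int[nu]_(z in cylinder Om T) `|(v z)%:E| < +oo)%E ->
  weak_dt Om T (tmoll h v) (dt_tmoll h v).
Proof.
move=> oOm T0 h0 mv voo; have mOm := measurable_open_rV oOm.
have [v' [rv v'0 vv' vv'x]] := time_regular_rep mOm mv voo.
have [mv' _ _ _] := rv.
have tv : tmoll h v = tmoll h v' %[ae nu in cylinder Om T] by exact: tmoll_ae.
have dv : dt_tmoll h v = dt_tmoll h v' %[ae nu in cylinder Om T].
  by move: vv' tv; apply: ae_imply2 => z H1 H2 Cz; rewrite /dt_tmoll H1// H2.
have mt := measurable_tmoll h rv.
have mtS : measurable_fun (strip T : set ER) (tmoll h v') by exact: measurable_funS mt.
have it := integrable_tmoll T0 h0 rv.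
have id_ := integrable_dt_tmoll T0 h0 rv.
have md : measurable_fun (strip T : set ER) (dt_tmoll h v').
  by have /integrableP[/measurable_EFinP] := id_.
split.
- exact: L1loc_of_strip tv.
- exact: L1loc_of_strip dv.
- move=> psi tpsi.
  have [K [tau [cK KOm tauT spsi]]] := test_function_smooth_bounded T0 tpsi.
  have clK : closed K by apply: compact_closed cK; exact: norm_hausdorff.
  have mK := measurable_compact_rV cK.
  have sd : smooth_bounded K tau (dt psi) by exact: smooth_bounded_derive.
  have KC : cylinder K T `<=` cylinder Om T by move=> z [Kz Tz]; split => //; exact: KOm.
  have off (g f' : E * R -> R) (D : set (E * R)) : smooth_bounded K tau g ->
      (forall z, D z -> upper z) -> forall z, D z -> ~ K z.1 -> f' z * g z = 0.
    by move=> [_ g0 _] DU z Dz nK; rewrite g0 ?mulr0//; [exact: DU|case].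
  have CU z : cylinder Om T z -> upper z by move=> [_]; rewrite /= in_itv/= => /andP[].
  have SU (z : E * R) : strip T z -> upper z by move=> /andP[].
  rewrite (integral_cylinder_strip (K := K) (F' := fun z => tmoll h v' z * dt psi z))//; last 4 first.
  + exact: off sd CU.
  + exact: off sd SU.
  + by apply: measurable_funM => //; exact: measurable_smooth_bounded sd.
  + by move: tv; apply: ae_imply => z H Cz; rewrite H//; exact: KC.
  rewrite (integral_cylinder_strip (K := K) (F' := fun z => dt_tmoll h v' z * psi z))//; last 4 first.
  + exact: off spsi CU.
  + exact: off spsi SU.
  + by apply: measurable_funM => //; exact: measurable_smooth_bounded spsi.
  + by move: dv; apply: ae_imply => z H Cz; rewrite H//; exact: KC.
  (* Both sides are the integral of [v'] times the average of [dt psi]. *)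
  rewrite -(dt_tmoll_duality T0 h0 clK tauT rv spsi).
  exact: tmoll_future_avg_duality sd.
Qed.

Lemma integrable_mul_snd (T C : R) (F : E * R -> R) (g : R -> R) :
  measurable_fun (setT : set (measurableTypeR R)) g ->
  (forall t, 0 < t < T -> `|g t| <= C) -> nu.-integrable (strip T) (EFin \o F) ->
  nu.-integrable (strip T) (EFin \o (fun z => F z * g z.2)).
Proof.
move=> mg gC iF; have mS := measurable_strip (N := N) T.
have mgS : measurable_fun (strip T) (fun z : ER => g z.2).
  exact: measurable_funS (measurableT_comp mg measurable_snd).
under eq_fun do rewrite mulrC.
apply: (@integrable_bounded_mul _ _ _ nu _ C) => //.
by move=> z; exact: gC.
Qed.

(** The weak formulation survives for a [Phi] that does not vanish at t = 0, at the price of the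
    initial term. The bounds on [Phi] and on its increments from t = 0 are separate hypotheses since
    [smooth_bounded] says nothing at t = 0. *)
Lemma limit_equation (Om K : set E) (T tau q C L : R) (A : E * R -> E)
    (A' : 'I_N -> E * R -> R) (v v' f f' Phi : E * R -> R) w :
  0 < T -> tau < T -> 1 <= q -> 0 <= L -> compact K -> K `<=` Om ->
  (forall psi, test_function (cylinder Om T) psi ->
    \int[nu]_(z in cylinder Om T) (dot (A z) (grad psi z) - v z * dt psi z) =
    \int[nu]_(z in cylinder Om T) (f z * psi z)) ->
  (forall i, time_regular T (A' i)) -> time_regular T v' -> time_regular T f' ->
  (forall i, (fun z => A z 0 i) = A' i %[ae nu in cylinder K T]) ->
  v = v' %[ae nu in cylinder K T] -> f = f' %[ae nu in cylinder K T] ->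
  (forall z, ~ cylinder K T z -> v' z = 0) ->
  continuous_rep K T q v w -> smooth_bounded K tau Phi ->
  (forall z, 0 <= z.2 -> `|Phi z| <= C) ->
  (forall x t, 0 < t -> `|Phi (x, t) - Phi (x, 0)| <= L * t) ->
  \sum_(i < N) \int[nu]_(z in strip T)
    (A' i z * 'D_((delta_mx 0 i, 0) : E * R) Phi z) -
  \int[nu]_(z in strip T) (v' z * dt Phi z) -
  \int[mu]_(x in K) (w 0 x * Phi (x, 0)) =
  \int[nu]_(z in strip T) (f' z * Phi z).
Proof.
move=> T0 tauT q1 L0 cK KOm weak rA rv rf AA vv ff v'0 crep sPhi PC PL.
have clK : closed K by apply: compact_closed cK; exact: norm_hausdorff.
have mK := measurable_compact_rV cK; have Koo := compact_volume cK.
have mS := measurable_strip (N := N) T.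
have mPhi : measurable_fun (strip T : set ER) Phi by exact: measurable_smooth_bounded sPhi.
have KC : cylinder K T `<=` cylinder Om T by move=> z [Kz Tz]; split => //; exact: KOm.
have CU (z : E * R) : cylinder Om T z -> upper z by move=> [_]; rewrite /= in_itv/= => /andP[].
have SU (z : E * R) : strip T z -> upper z by move=> /andP[].
have sD w' : smooth_bounded K tau ('D_w' Phi) by exact: smooth_bounded_derive.
have [_ Phi0 _] := sPhi.
have D0 w' z : upper z -> ~ K z.1 -> 'D_w' Phi z = 0.
  by move=> Uz nK; have [_ z0 _] := sD w'; rewrite z0// => -[].
pose G z := \sum_(i < N) A' i z * 'D_((delta_mx 0 i, 0) : E * R) Phi z - v' z * dt Phi z.
have iA i : nu.-integrable (strip T)
    (EFin \o (fun z => A' i z * 'D_((delta_mx 0 i, 0) : E * R) Phi z)).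
  exact: integrable_mul_smooth (sD _) (time_regular_strip (rA i)).
have [isA sAE] := Rintegral_sum (index_enum 'I_N) mS iA.
have ivd : nu.-integrable (strip T) (EFin \o (fun z => v' z * dt Phi z)).
  exact: integrable_mul_smooth (sD _) (time_regular_strip rv).
have iG : nu.-integrable (strip T) (EFin \o G) by exact: (integrableB mS isA ivd).
have ivP : nu.-integrable (strip T) (EFin \o (fun z => v' z * Phi z)).
  exact: integrable_mul_smooth sPhi (time_regular_strip rv).
have ifP : nu.-integrable (strip T) (EFin \o (fun z => f' z * Phi z)).
  exact: integrable_mul_smooth sPhi (time_regular_strip rf).
have mr k : measurable_fun (setT : set (measurableTypeR R)) (ramp k : R -> R).
  apply: continuous_measurable_fun => t.
  by have [/derivable1_diffP/differentiable_continuous] := is_derive_ramp k t.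
have md k : measurable_fun (setT : set (measurableTypeR R)) (dramp k : R -> R).
  by apply: continuous_measurable_fun; exact: continuous_dramp.
have r1 k t : 0 < t < T -> `|ramp k t| <= 1.
  by move=> _; rewrite ger0_norm ?ramp_ge0// ramp_le1.
have iGr k := integrable_mul_snd (mr k) (r1 k) iG.
have ifr k := integrable_mul_snd (mr k) (r1 k) ifP.
have ivr k : nu.-integrable (strip T) (EFin \o (fun z => v' z * Phi z * dramp k z.2)).
  by have [M bM] := dramp_bounded k T0; exact: integrable_mul_snd (md k) bM ivP.
(* The equation tested with [ramped k Phi]. A spatial direction has time component 0, so the
   derivative of the ramp enters only through [dt]. *)
have eqk k : \int[nu]_(z in strip T) (G z * ramp k z.2) -
    \int[nu]_(z in strip T) (v' z * Phi z * dramp k z.2) =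
    \int[nu]_(z in strip T) (f' z * Phi z * ramp k z.2).
  have tP := ramped_test_function k cK KOm tauT sPhi.
  have dP w' z : upper z -> 'D_w' (ramped k Phi) z =
      'D_w' Phi z * ramp k z.2 + Phi z * (w'.2 * dramp k z.2).
    by move=> Uz; have [_] := ramped_derive k w' sPhi Uz.
  have gE z : upper z -> dot (A z) (grad (ramped k Phi) z) =
      (\sum_(i < N) A z 0 i * 'D_((delta_mx 0 i, 0) : E * R) Phi z) * ramp k z.2.
    move=> Uz; rewrite /dot mulr_suml; apply: eq_bigr => i _.
    by rewrite mxE dP//= mul0r mulr0 addr0 mulrA.
  have tE z : upper z -> dt (ramped k Phi) z = dt Phi z * ramp k z.2 + Phi z * dramp k z.2.
    by move=> Uz; rewrite /dt dP//= mul1r.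
  have PhiK z : upper z -> ~ K z.1 -> Phi z = 0.
    by move=> Uz nK; rewrite Phi0// => -[].
  have := weak _ tP.
  rewrite (integral_cylinder_strip (K := K)
    (F' := fun z => G z * ramp k z.2 - v' z * Phi z * dramp k z.2))//; last 4 first.
  - move=> z Cz nK; have Uz := CU z Cz; rewrite gE// tE// /dt D0// PhiK//.
    by rewrite big1 ?mul0r ?addr0 ?mulr0 ?subr0// => i _; rewrite D0// mulr0.
  - move=> z Sz nK; have Uz := SU z Sz; rewrite /G /dt D0// PhiK//.
    by rewrite big1 ?mulr0 ?mul0r ?subr0 ?mul0r// => i _; rewrite D0// mulr0.
  - have /integrableP[/measurable_EFinP//] : nu.-integrable (strip T) (EFin \o
      (fun z => G z * ramp k z.2 - v' z * Phi z * dramp k z.2)).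
    exact: (integrableB mS (iGr k) (ivr k)).
  - have AAf : {ae nu, forall z, forall i, cylinder K T z -> A z 0 i = A' i z}.
      exact: filter_forall.
    move: AAf vv; apply: ae_imply2 => z H1 H2 Cz; have Uz := CU z (KC z Cz).
    rewrite gE// tE// H2// /G; under eq_bigr do rewrite H1//.
    by ring.
  rewrite (integral_cylinder_strip (K := K)
    (F' := fun z => f' z * Phi z * ramp k z.2))//; last 4 first.
  - by move=> z Cz nK; rewrite /ramped PhiK ?mul0r ?mulr0//; exact: CU.
  - by move=> z Sz nK; rewrite PhiK ?mulr0 ?mul0r//; exact: SU.
  - by have /integrableP[/measurable_EFinP] := ifr k.
  - by move: ff; apply: ae_imply => z H Cz; rewrite H// mulrA.
  by rewrite RintegralB.
(* Times T / (2 (n+1)) in (0, T) decreasing to 0: measurability of [Phi] is known on the open strip,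
   and Phi(., 0) is the pointwise limit of these slices. *)
pose tn n : R := T / 2 * harmonic n.
have tn0 n : 0 < tn n by rewrite !mulr_gt0// invr_gt0.
have tnT n : tn n < T.
  rewrite (le_lt_trans (_ : _ <= T / 2 * 1))//; last by rewrite mulr1 ltr_pdivrMr// ltr_pMr// ltr1n.
  by rewrite ler_wpM2l ?divr_ge0 ?(ltW T0)// /harmonic/= invf_le1// ler1n.
have tn_cvg : tn n @[n --> \oo] --> (0 : R).
  rewrite -[X in _ --> X](mulr0 (T / 2)); apply: cvgM; first exact: cvg_cst.
  exact: cvg_harmonic.
have mPhi0 : measurable_fun setT (fun x => Phi (x, 0)).
  apply: (measurable_fun_cvg (h := fun n x => Phi (x, tn n))).
    move=> n; have mPS : measurable_fun (setT : set ER) (Phi \_ (strip T)).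
      exact: measurable_strip_patch sPhi.
    have := measurableT_comp mPS (pair2_measurable (tn n)).
    by apply: eq_measurable_fun => x _; rewrite /= patchE mem_set//= /strip/= tn0 tnT.
  move=> x _; apply/subr_cvg0; apply: norm_cvg0.
  have c0 : (fun=> 0 : R) @ \oo --> (0 : R) by exact: cvg_cst.
  have c1 : L * tn n @[n --> \oo] --> (0 : R).
    by rewrite -[X in _ --> X](mulr0 L); apply: cvgM; [exact: cvg_cst|exact: tn_cvg].
  apply: (squeeze_cvgr _ c0 c1); apply: nearW => n.
  by rewrite normr_ge0 PL.
have c1 := ramp_limit iG; have c2 := ramp_limit ifP.
have c3 : \int[nu]_(z in strip T) (v' z * Phi z * dramp k z.2) @[k --> \oo] -->
    \int[mu]_(x in K) (w 0 x * Phi (x, 0)).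
  apply: (trace_limit (C := C) (L := L) T0 q1 L0 mK Koo crep rv v'0 vv mPhi mPhi0).
  - by move=> z /andP[z0 _]; exact: PC.
  - by move=> x t /andP[t0 _]; exact: PL.
have c13 : (\int[nu]_(z in strip T) (G z * ramp k z.2) -
    \int[nu]_(z in strip T) (v' z * Phi z * dramp k z.2)) @[k --> \oo] -->
    (\int[nu]_(z in strip T) G z - \int[mu]_(x in K) (w 0 x * Phi (x, 0))).
  exact: (cvgB c1 c3).
rewrite -sAE -RintegralB//.
by rewrite -(cvg_lim _ c13)// (eq_fun eqk); exact: cvg_lim c2.
Qed.

Lemma ae_L1_subset {d} {X : measurableType d} (m : {measure set X -> \bar R})
    (D D' : set X) (f : X -> R) : measurable D -> measurable D' -> D' `<=` D ->
  ae_measurable m D f /\ (\int[m]_(x in D) `|(f x)%:E| < +oo)%E ->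
  ae_measurable m D' f /\ (\int[m]_(x in D') `|(f x)%:E| < +oo)%E.
Proof.
move=> mD mD' D'D [[g mg fg] foo].
have mg' : measurable_fun D' g by exact: (measurable_funS mD D'D mg).
have fg' : f = g %[ae m in D'] by move: fg; apply: ae_imply => x H Dx; apply: H; exact: D'D.
have nE B : measurable B -> measurable_fun B g -> f = g %[ae m in B] ->
    (\int[m]_(x in B) `|(f x)%:E| = \int[m]_(x in B) `|(g x)%:E|)%E.
  move=> mB mgB fgB; apply: ae_integral => //.
    by apply: measurableT_comp => //; exact: measurable_EFin.
  by move: fgB; apply: ae_imply => x H Bx; rewrite H.
split; first by exists g.
rewrite nE//; move: foo; rewrite nE//.
apply: le_lt_trans; apply: ge0_subset_integral => //.
by apply: measurableT_comp => //; exact: measurable_EFin.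
Qed.

End mollified_equation.

Unset Implicit Arguments.

Theorem lemma2p13 (R : realType) (N : nat) (hN : (2 <= N)%N)
    (T : R) (hT : 0 < T)
    (Om : set 'rV[R]_N) (Om_open : open Om) (Om_bounded : bounded_set Om)
    (alpha : R) (halpha : 0 < alpha) (p : R) (hp : 1 < p)
    (delta : 'I_N -> R) (hdelta : forall i, 0 <= delta i)
    (a : 'I_N -> 'rV[R]_N * R -> R)
    (a_meas : forall i, ae_measurable (lebesgueNT R N) (cylinder Om T) (a i))
    (Lambda : R) (hLambda : 1 <= Lambda)
    (a_bound : forall i, \forall z \ae lebesgueNT R N,
       cylinder Om T z -> Lambda^-1 <= a i z <= Lambda)
    (beta : R) (hbeta : 1 < beta)
    (f : 'rV[R]_N * R -> R) (hf : Lq_Lqloc Om T beta f)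
    (u : 'rV[R]_N * R -> R) (Du : 'rV[R]_N * R -> 'rV[R]_N)
    (u_sol : weak_solution Om T alpha p a delta f u Du)
    (h : R) (hh : 0 < h < T)
    (K : set 'rV[R]_N) (K_compact : compact K) (K_sub : K `<=` Om)
    (tau : R) (htau : 0 < tau < T)
    (phi : 'rV[R]_N * R -> R) (phi_smooth : smooth_closed_cylinder Om T phi)
    (phi_supp : support_in (closed_cylinder Om T) phi `<=` K `*` `[0, tau]) :
  let v := fun z => spow alpha (u z) in
  let A := fun z => vfield a delta p z (Du z) in
  [/\ weak_dt Om T (tmoll h v) (dt_tmoll h v),
      exists w, continuous_rep K T ((alpha + 1) / alpha) v w &
      forall w, continuous_rep K T ((alpha + 1) / alpha) v w ->
        \int[lebesgueNT R N]_(z in cylinder Om T)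
          (dot (tmoll_vec h A z) (grad phi z) + dt_tmoll h v z * phi z)
        - \int[lebesgueN R N]_(x in Om) (w 0 x * tmoll_bar T h phi (x, 0))
        = \int[lebesgueNT R N]_(z in cylinder Om T) (tmoll h f z * phi z)].
Proof.
move=> v A; have /andP[h0 hT'] := hh; have /andP[tau0 tauT] := htau.
have mOm := measurable_open_rV Om_open; have Omoo := bounded_set_volume mOm Om_bounded.
have mK := measurable_compact_rV K_compact; have Koo := compact_volume K_compact.
have clK : closed K by apply: compact_closed K_compact; exact: norm_hausdorff.
have mC := measurable_cylinder T mOm; have mCK := measurable_cylinder T mK.
have mS := measurable_strip (N := N) T.
have KC : cylinder K T `<=` cylinder Om T by move=> z [Kz Tz]; split => //; exact: K_sub.
have [_ [[u_meas _] DuLp _] [w0 u_rep] weak] := u_sol.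
have al1 : 0 < alpha + 1 by rewrite addr_gt0.
have q1 : 1 <= (alpha + 1) / alpha by rewrite ler_pdivlMr// mul1r lerDl.
have vL1 := spow_L1 mOm Omoo hT halpha u_meas u_rep.
split.
- by apply: weak_dt_tmoll => //; have [] := vL1.
- have [g mg g_rep] := continuous_rep_measurable mOm al1 u_rep.
  by eexists; exact: (continuous_rep_spow mK K_sub mOm halpha mg g_rep).
move=> w w_rep.
(* The weak time derivative concerned all of [Om]; from here on representatives are taken over [K],
   where [f] is integrable and outside of which [phi] vanishes. *)
have [vm vi] := ae_L1_subset mC mCK KC vL1.
have [v' [rv v'0 vv' vv'x]] := time_regular_rep mK vm vi.
have [fm fi] := Lp_on_L1 mCK (cylinder_volume mK Koo hT) (ltW hbeta) (hf K K_compact K_sub).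
have [f' [rf f'0 ff' ff'x]] := time_regular_rep mK fm fi.
have AL1 i := ae_L1_subset mC mCK KC
  (vfield_L1 mOm Omoo hT hp (hdelta i) hLambda (a_meas i) (a_bound i) (DuLp i)).
have Arep i : exists A', [/\ time_regular T A',
    (fun z => A z 0 i) = A' %[ae lebesgueNT R N in cylinder K T] &
    {ae lebesgueN R N, forall x, K x -> {ae @lebesgue_measure R, forall s,
      `]0, T[%classic s -> A (x, s) 0 i = A' (x, s)}}].
  have [Am Ai] := AL1 i.
  by have [A' [? ? ? ?]] := time_regular_rep mK Am Ai; exists A'.
have [A' A'P] := choice Arep.
pose phi0 := phi \_ (cylinder Om T).
have s0 : smooth_bounded K tau phi0 by exact: zero_extension_bounded.
pose Phi := future_avg T h phi0.
have sPhi : smooth_bounded K tau Phi by exact: smooth_bounded_future_avg.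
have sD w' : smooth_bounded K tau ('D_w' phi0) by exact: smooth_bounded_derive.
have [_ phi00 /(_ [::])[C0 C0P]] := s0.
have [_ _ /(_ [::])[C1 C1P]] := sD (0, 1).
have C10 : 0 <= C1 by exact: le_trans (normr_ge0 _) (C1P (0, 1) ltr01).
have L0 : 0 <= h^-1 * C1 * T by rewrite !mulr_ge0 ?invr_ge0// ltW.
have PC z : 0 <= z.2 -> `|Phi z| <= h^-1 * C0 * T.
  by move=> z0; exact: (future_avg_bounded hT h0 s0 C0P z0).
have PL x t : 0 < t -> `|Phi (x, t) - Phi (x, 0)| <= h^-1 * C1 * T * t.
  move=> t0; rewrite (_ : _ * t = h^-1 * (C1 * t) * T); last by ring.
  exact: (future_avg_lipschitz0 hT h0 x s0 C1P t0).
have rA i : time_regular T (A' i) by have [] := A'P i.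
have AA i : (fun z => A z 0 i) = A' i %[ae lebesgueNT R N in cylinder K T] by have [] := A'P i.
have := limit_equation hT tauT q1 L0 K_compact K_sub weak rA rv rf AA vv' ff' v'0
  w_rep sPhi PC PL.
have CU (z : 'rV[R]_N * R) : cylinder Om T z -> upper z.
  by move=> [_]; rewrite /= in_itv/= => /andP[].
have SU (z : 'rV[R]_N * R) : strip T z -> upper z by move=> /andP[].
have phiE z : cylinder Om T z -> phi z = phi0 z by move=> Cz; rewrite /phi0 zero_extensionE.
have gradE z : cylinder Om T z -> grad phi z = grad phi0 z.
  by move=> Cz; rewrite /phi0 grad_zero_extension.
have phiK z : upper z -> ~ K z.1 -> phi0 z = 0 by move=> Uz nK; rewrite phi00// => -[].
have DK w' z : upper z -> ~ K z.1 -> 'D_w' phi0 z = 0.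
  by move=> Uz nK; have [_ z0 _] := sD w'; rewrite z0// => -[].
have tA i : tmoll h (fun y => A y 0 i) = tmoll h (A' i) %[ae lebesgueNT R N in cylinder K T].
  by have [[mA _ _ _] _ AAx] := A'P i; exact: tmoll_ae.
have tf : tmoll h f = tmoll h f' %[ae lebesgueNT R N in cylinder K T].
  by have [mf _ _ _] := rf; exact: tmoll_ae.
have tv : tmoll h v = tmoll h v' %[ae lebesgueNT R N in cylinder K T].
  by have [mv _ _ _] := rv; exact: tmoll_ae.
have iA i : (lebesgueNT R N).-integrable (strip T)
    (EFin \o (fun z => tmoll h (A' i) z * 'D_((delta_mx 0 i, 0) : 'rV[R]_N * R) phi0 z)).
  exact: integrable_mul_smooth (sD _) (integrable_tmoll hT h0 (rA i)).
have [isA sAE] := Rintegral_sum (index_enum 'I_N) mS iA.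
have id_ : (lebesgueNT R N).-integrable (strip T)
    (EFin \o (fun z => dt_tmoll h v' z * phi0 z)).
  exact: integrable_mul_smooth s0 (integrable_dt_tmoll hT h0 rv).
have if_ : (lebesgueNT R N).-integrable (strip T)
    (EFin \o (fun z => tmoll h f' z * phi0 z)).
  exact: integrable_mul_smooth s0 (integrable_tmoll hT h0 rf).
have lhs : \int[lebesgueNT R N]_(z in cylinder Om T)
    (dot (tmoll_vec h A z) (grad phi z) + dt_tmoll h v z * phi z) =
  \int[lebesgueNT R N]_(z in strip T)
    (\sum_(i < N) tmoll h (A' i) z * 'D_((delta_mx 0 i, 0) : 'rV[R]_N * R) phi0 z +
     dt_tmoll h v' z * phi0 z).
  apply: (integral_cylinder_strip (K := K)) => //.
  - move=> z Cz nK; have Uz := CU z Cz; rewrite gradE// phiE// phiK// mulr0 addr0.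
    by rewrite /dot big1// => i _; rewrite !mxE DK// mulr0.
  - move=> z Sz nK; have Uz := SU z Sz; rewrite phiK// mulr0 addr0.
    by rewrite big1// => i _; rewrite DK// mulr0.
  - by have /integrableP[/measurable_EFinP] := integrableD mS isA id_.
  - have tAf : {ae lebesgueNT R N, forall z, forall i, cylinder K T z ->
        tmoll h (fun y => A y 0 i) z = tmoll h (A' i) z}.
      exact: filter_forall.
    have vtv := ae_imply2 (fun z P Q => conj P Q) vv' tv.
    move: tAf vtv; apply: ae_imply2 => z H1 [H2 H3] Cz.
    rewrite gradE ?phiE; [|exact: KC..].
    rewrite /dt_tmoll /v H2// -/v H3//; congr (_ + _).
    by rewrite /dot; apply: eq_bigr => i _; rewrite !mxE H1.
have rhs : \int[lebesgueNT R N]_(z in cylinder Om T) (tmoll h f z * phi z) =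
    \int[lebesgueNT R N]_(z in strip T) (tmoll h f' z * phi0 z).
  apply: (integral_cylinder_strip (K := K)) => //.
  - by move=> z Cz nK; rewrite phiE// phiK ?mulr0//; exact: CU.
  - by move=> z Sz nK; rewrite phiK ?mulr0//; exact: SU.
  - by have /integrableP[/measurable_EFinP] := if_.
  - by move: tf; apply: ae_imply => z H Cz; rewrite H// phiE//; exact: KC.
(* [w] is controlled on [K] only; off [K] the average of [phi] is 0, so the values of [w] there do
   not enter. *)
have init : \int[lebesgueN R N]_(x in Om) (w 0 x * tmoll_bar T h phi (x, 0)) =
    \int[lebesgueN R N]_(x in K) (w 0 x * Phi (x, 0)).
  rewrite Rintegral_mkcond [RHS]Rintegral_mkcond; apply: eq_Rintegral => x _.
  rewrite !patchE; case: ifPn => [/set_mem Ox|].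
    rewrite (tmoll_bar_future_avg Om_open K_compact K_sub htau phi_smooth phi_supp h0 Ox).
    case: ifPn => // /negP nK.
    rewrite (future_avg_off_support Om_open K_compact K_sub htau phi_smooth phi_supp) ?mulr0//.
    by move=> Kx; apply: nK; exact: mem_set.
  by rewrite notin_setE => nO; rewrite memNset// => Kx; apply: nO; exact: K_sub.
have dPhi w' z : strip T z -> future_avg T h ('D_w' phi0) z = 'D_w' Phi z.
  move=> /SU Uz.
  have H : is_derive z w' Phi (future_avg T h ('D_w' phi0) z) by exact: (future_avg_derive hT h0 w' s0 Uz).
  by have [_ ->] := H.
(* The average commutes with the i-th spatial derivative, so the duality turns the mollified
   component tested with [phi0] into the component itself tested with [Phi]. *)
have eA i : \int[lebesgueNT R N]_(z in strip T)
      (tmoll h (A' i) z * 'D_((delta_mx 0 i, 0) : 'rV[R]_N * R) phi0 z) =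
    \int[lebesgueNT R N]_(z in strip T)
      (A' i z * 'D_((delta_mx 0 i, 0) : 'rV[R]_N * R) Phi z).
  rewrite (tmoll_future_avg_duality hT h0 tauT (rA i) (sD _)).
  apply: eq_Rintegral => z /set_mem Sz; congr (_ * _).
  exact: dPhi.
have ev : \int[lebesgueNT R N]_(z in strip T) (dt_tmoll h v' z * phi0 z) =
    - \int[lebesgueNT R N]_(z in strip T) (v' z * dt Phi z).
  apply: (canRL (@opprK R)); rewrite -(dt_tmoll_duality hT h0 clK tauT rv s0).
  by apply: eq_Rintegral => z /set_mem Sz; congr (_ * _); exact: dPhi.
rewrite lhs rhs init RintegralD// sAE (tmoll_future_avg_duality hT h0 tauT rf s0).
move=> limit; apply: etrans limit.
apply: (f_equal2 (fun x y : R => x - y)) => //; apply: (f_equal2 +%R) ev.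
by apply: eq_bigr => i _; exact: eA.
Qed.
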